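(* Let $\mathcal{A}$ be an abelian category. The triple $(\mathbf{C}^+(\mathbf{F}\mathcal{A}),\mathcal{E}_r,\mathbf{s}^r)$ is a cohomological descent category for all $r\geq 0$.
   Context: Filtered complexes. $\mathbf{F}\mathcal{A}$ is the category of objects of $\mathcal{A}$ with an increasing filtration, and $\mathbf{C}^+(\mathbf{F}\mathcal{A})$ is the category of bounded below complexes of such. A filtered complex $(K,W)$ has a spectral sequence with $E_0^{p,q}(K)=Gr^W_{-p}K^{p+q}$ and $d_r$ of bidegree $(r,1-r)$. A morphism $f$ of filtered complexes is an $E_r$-quasi-isomorphism if $E_r(f)$ is a quasi-isomorphism with respect to $d_r$, i.e. $E_{r+1}(f)$ is an isomorphism; $\mathcal{E}_r$ is the class of $E_r$-quasi-isomorphisms. Cubical codiagrams. For a non-empty finite set $S$, $\square_S$ is the poset of non-empty subsets of $S$ ordered by inclusion; $\square_n=\square_{\{0,\dots,n\}}$. An injection $u:S\to T$ induces $\square_u:\square_S\to\square_T$, $\alpha\mapsto u(\alpha)$. $\Pi$ is the category of finite products of categories $\square_S$, with morphisms the functors induced by injections in each component. For $\alpha\in\square_S$ put $|\alpha|=\mathrm{card}(\alpha)-1$; on products, $|\cdot|$ is the sum over the components. A cubical codiagram of $\mathcal{D}$ is a pair $(X,\square)$ with $\square\in\Pi$ and $X:\square\to\mathcal{D}$ a functor; a morphism $(X,\square)\to(Y,\square')$ is a pair $(a,\delta)$ with $\delta:\square'\to\square$ in $\Pi$ and $a:X\circ\delta\to Y$ a natural transformation. They form the category $CoDiag_\Pi\mathcal{D}$.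 The simple functors. For a codiagram $K$ of complexes, $\mathbf{s}(K)$ is the total complex, $\mathbf{s}(K)^n=\bigoplus_\alpha (K^\alpha)^{n-|\alpha|}$, with differential the sum of the (signed) internal differentials and the alternating (signed) sums of the maps $K^\alpha\to K^{\beta}$ for $\alpha\subset\beta$, $|\beta|=|\alpha|+1$. For a codiagram $K$ of filtered complexes $(K^\alpha,W)$, the $r$-simple is $\mathbf{s}^r(K)=(\mathbf{s}(K),W(r))$ with $$W(r)_p\,\mathbf{s}(K)=\bigoplus_{|\alpha|=0}W_pK^\alpha\oplus\bigoplus_{|\alpha|=1}W_{p+r}K^\alpha[-1]\oplus\cdots=\bigoplus_\alpha W_{p+r|\alpha|}K^\alpha[-|\alpha|].$$ Cohomological descent category (Guillén–Navarro Aznar, Publ. IHES 95, Def. 1.5.3). This is a category $\mathcal{D}$ with finite products and an object $1$ which is initial and final; a class $\mathcal{E}$ of weak equivalences which is saturated (it consists of exactly the morphisms that become invertible in $\mathrm{Ho}(\mathcal{D}):=\mathcal{D}[\mathcal{E}^{-1}]$) and stable under finite products; and a functor $\mathbf{s}:CoDiag_\Pi\mathcal{D}\to\mathcal{D}$ (sending a morphism of cubical codiagrams $(a,\delta):(X,\square)\to(Y,\square')$, where $\delta:\square'\to\square$ is in $\Pi$ and $a:X\circ\delta\to Y$ is a natural transformation, to a morphism $\mathbf{s}X\to\mathbf{s}Y$), with restriction $\mathbf{s}_\square$ to $\mathcal{D}^\square$, such that: (products) $\mathbf{s}_\square(X\times Y)\to\mathbf{s}_\square X\times\mathbf{s}_\square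 Y$ and $\mathbf{s}_\square(1)\to 1$ are weak equivalences; (factorization) there are isomorphisms $\mu:\mathbf{s}_{\square\times\square'}X\cong\mathbf{s}_\square\mathbf{s}_{\square'}X$ in $\mathrm{Ho}(\mathcal{D})$, natural in $X,\square,\square'$; (normalization) there are natural morphisms $\lambda_\square:B\to\mathbf{s}_\square(\mathrm{const}\,B)$, compatible with morphisms of $\Pi$ and with $\mu$, with $\lambda_{\square_0}\in\mathcal{E}$; (exactness) if $f:X\to Y$ in $\mathcal{D}^\square$ is a pointwise weak equivalence then $\mathbf{s}_\square f\in\mathcal{E}$; (acyclicity) $f:B\to C$ is in $\mathcal{E}$ if and only if $\mathbf{s}_{\square_1}(B\xrightarrow{f}C\leftarrow 1)$ is acyclic, where an object is called acyclic if it is weakly equivalent to $1$; (extension) for $u:S\to T$ injective and $X:\square_S\to\mathcal{D}$, with $(u_*X)_\alpha=X_{u^{-1}(\alpha)}$ if $\alpha\subset u(S)$ and $(u_*X)_\alpha=1$ otherwise, the morphism $\mathbf{s}_{\square_T}(u_*X)\to\mathbf{s}_{\square_S}X$ is in $\mathcal{E}$. *)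

(* Defs.v *)
From mathcomp Require Import all_boot all_order all_algebra.
From mathcomp Require Import boolp.

Set Implicit Arguments.
Unset Strict Implicit.
Unset Printing Implicit Defensive.

Import Order.TTheory GRing.Theory Num.Theory.

Reserved Notation "X ⟶ Y" (at level 55, no associativity).
Reserved Notation "g ∘ f" (at level 40, left associativity).
Reserved Notation "X ~> Y" (at level 55, no associativity).
Reserved Notation "g ⊙ f" (at level 40, left associativity).

Record category := Category {
  cob :> Type;
  chom : cob -> cob -> Type;
  cidm : forall X, chom X X;
  ccomp : forall X Y Z, chom Y Z -> chom X Y -> chom X Z;
  ccompA : forall X Y Z T (h : chom Z T) (g : chom Y Z) (f : chom X Y),
    ccomp h (ccomp g f) = ccomp (ccomp h g) f;
  ccomp1m : forall X Y (f : chom X Y), ccomp (cidm Y) f = f;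
  ccompm1 : forall X Y (f : chom X Y), ccomp f (cidm X) = f }.

Notation "X ⟶ Y" := (chom X Y).
Notation "g ∘ f" := (ccomp g f).
Arguments cidm {c} X.

Record functor (C D : category) := Functor {
  fob :> C -> D;
  fmap : forall X Y, (X ⟶ Y) -> (fob X ⟶ fob Y);
  fmap1 : forall X, fmap (cidm X) = cidm (fob X);
  fmap_comp : forall X Y Z (g : Y ⟶ Z) (f : X ⟶ Y),
    fmap (g ∘ f) = fmap g ∘ fmap f }.

Section CategoryNotions.
Variable D : category.

Definition is_product (X Y P : D) (p : P ⟶ X) (q : P ⟶ Y) : Prop :=
  forall Z (f : Z ⟶ X) (g : Z ⟶ Y),
    exists! h : Z ⟶ P, p ∘ h = f /\ q ∘ h = g.

Record zero_object := ZeroObject {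
  zob :> D;
  zto : forall X, X ⟶ zob;
  zfrom : forall X, zob ⟶ X;
  zto_unique : forall X (f : X ⟶ zob), f = zto X;
  zfrom_unique : forall X (f : zob ⟶ X), f = zfrom X }.

Definition morphism_class := forall X Y : D, (X ⟶ Y) -> Prop.

Variable E : morphism_class.

(* The localization Ho(D) = D[E^-1] has the objects of D; its morphisms are the
   formal composites of morphisms of D and of formal inverses of elements of E,
   modulo the congruence ho_eq. *)
Inductive ho_mor : D -> D -> Type :=
| ho_loc X Y (f : X ⟶ Y) : ho_mor X Y
| ho_inv X Y (w : X ⟶ Y) (Ew : E w) : ho_mor Y X
| ho_comp X Y Z (b : ho_mor Y Z) (a : ho_mor X Y) : ho_mor X Z.

Inductive ho_eq : forall X Y, ho_mor X Y -> ho_mor X Y -> Prop :=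
| ho_refl X Y (a : ho_mor X Y) : ho_eq a a
| ho_sym X Y (a b : ho_mor X Y) : ho_eq a b -> ho_eq b a
| ho_trans X Y (a b c : ho_mor X Y) : ho_eq a b -> ho_eq b c -> ho_eq a c
| ho_cong X Y Z (b b' : ho_mor Y Z) (a a' : ho_mor X Y) :
    ho_eq b b' -> ho_eq a a' -> ho_eq (ho_comp b a) (ho_comp b' a')
| ho_compA X Y Z T (c : ho_mor Z T) (b : ho_mor Y Z) (a : ho_mor X Y) :
    ho_eq (ho_comp c (ho_comp b a)) (ho_comp (ho_comp c b) a)
| ho_comp1m X Y (a : ho_mor X Y) : ho_eq (ho_comp (ho_loc (cidm Y)) a) a
| ho_compm1 X Y (a : ho_mor X Y) : ho_eq (ho_comp a (ho_loc (cidm X))) a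
| ho_loc_comp X Y Z (g : Y ⟶ Z) (f : X ⟶ Y) :
    ho_eq (ho_loc (g ∘ f)) (ho_comp (ho_loc g) (ho_loc f))
| ho_invl X Y (w : X ⟶ Y) (Ew : E w) :
    ho_eq (ho_comp (ho_inv Ew) (ho_loc w)) (ho_loc (cidm X))
| ho_invr X Y (w : X ⟶ Y) (Ew : E w) :
    ho_eq (ho_comp (ho_loc w) (ho_inv Ew)) (ho_loc (cidm Y)).

Definition ho_iso X Y (a : ho_mor X Y) : Prop :=
  exists b : ho_mor Y X,
    ho_eq (ho_comp b a) (ho_loc (cidm X)) /\
    ho_eq (ho_comp a b) (ho_loc (cidm Y)).

Inductive weakly_equivalent : D -> D -> Prop :=
| we_mor X Y (w : X ⟶ Y) : E w -> weakly_equivalent X Y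
| we_refl X : weakly_equivalent X X
| we_sym X Y : weakly_equivalent X Y -> weakly_equivalent Y X
| we_trans X Y Z :
    weakly_equivalent X Y -> weakly_equivalent Y Z -> weakly_equivalent X Z.

End CategoryNotions.

Record nefin := NeFin {
  nf_carrier :> finType;
  nf_nonempty : (0 < #|nf_carrier|)%N }.

Definition cube (S : nefin) : finType := {A : {set S} | A != set0}.

(* The list [:: S1; ...; Sk] stands for the product of the posets of non-empty
   subsets of S1, ..., Sk; the empty list is the one-point category. *)
Definition shape := seq nefin.

Fixpoint sob (P : shape) : finType :=
  if P is S0 :: P' then (cube S0 * sob P')%type else unit.

Fixpoint sle (P : shape) : rel (sob P) :=
  match P return rel (sob P) with
  | [::] => fun _ _ => true
  | S0 :: P' => fun a b => (val a.1 \subset val b.1) && sle a.2 b.2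
  end.

Fixpoint sdeg (P : shape) : sob P -> nat :=
  match P return sob P -> nat with
  | [::] => fun _ => 0%N
  | S0 :: P' => fun a => (#|val a.1|.-1 + sdeg a.2)%N
  end.

Record injection (S T : nefin) := Injection {
  inj_fun :> S -> T;
  inj_injective : injective inj_fun }.

Arguments inj_injective {S T} i {x1 x2}.

Lemma injection_eq (S T : nefin) (u v : injection S T) : u =1 v -> u = v.
Proof.
case: u v => [u hu] [v hv] /= /funext e; rewrite e in hu *.
by rewrite (Prop_irrelevance hu hv).
Qed.

Definition injection_id S : injection S S := Injection (fun x y (e : x = y) => e).

Definition injection_comp S T U (v : injection T U) (u : injection S T) :
  injection S U := Injection (inj_comp (@inj_injective _ _ v) (@inj_injective _ _ u)).

Lemma cube_map_subproof (S T : nefin) (u : injection S T) (a : cube S) :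
  u @: val a != set0.
Proof.
have /set0Pn[x xa] := valP a.
by apply/set0Pn; exists (u x); apply: imset_f.
Qed.

Definition cube_map (S T : nefin) (u : injection S T) (a : cube S) : cube T :=
  exist _ (u @: val a) (cube_map_subproof u a).

Lemma cube_map_id S a : cube_map (injection_id S) a = a.
Proof. by apply: val_inj; rewrite /= imset_id. Qed.

Lemma cube_map_comp S T U (v : injection T U) (u : injection S T) a :
  cube_map (injection_comp v u) a = cube_map v (cube_map u a).
Proof. by apply: val_inj; rewrite /= imset_comp. Qed.

Lemma cube_map_le S T (u : injection S T) (a b : cube S) :
  (val (cube_map u a) \subset val (cube_map u b)) = (val a \subset val b).
Proof.
apply/idP/idP => [/subsetP h|]; last exact: imsetS.
apply/subsetP => x xa; have /h := imset_f u xa.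
by case/imsetP => y yb /inj_injective ->.
Qed.

Fixpoint injs (P Q : shape) : Type :=
  match P, Q with
  | [::], [::] => unit
  | S0 :: P', T :: Q' => (injection S0 T * injs P' Q')%type
  | _, _ => Empty_set
  end.

Fixpoint injs_act (P Q : shape) : injs P Q -> sob P -> sob Q :=
  match P, Q return injs P Q -> sob P -> sob Q with
  | [::], [::] => fun _ _ => tt
  | S0 :: P', T :: Q' => fun u a => (cube_map u.1 a.1, injs_act u.2 a.2)
  | _, _ => fun u => match u with end
  end.

Fixpoint injs_id (P : shape) : injs P P :=
  match P return injs P P with
  | [::] => tt
  | S0 :: P' => (injection_id S0, injs_id P')
  end.

Fixpoint injs_comp (P Q R : shape) : injs Q R -> injs P Q -> injs P R :=
  match P, Q, R return injs Q R -> injs P Q -> injs P R with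
  | [::], [::], [::] => fun _ _ => tt
  | S0 :: P', T :: Q', U :: R' =>
      fun v u => (injection_comp v.1 u.1, injs_comp v.2 u.2)
  | _, [::], _ :: _ => fun v => match v with end
  | _, _ :: _, [::] => fun v => match v with end
  | [::], _ :: _, _ => fun _ u => match u with end
  | _ :: _, [::], _ => fun _ u => match u with end
  end.

Lemma injs_act_id P a : injs_act (injs_id P) a = a.
Proof.
by elim: P a => [|S P IH] [] //= a b; rewrite cube_map_id IH.
Qed.

Lemma injs_act_comp P Q R (v : injs Q R) (u : injs P Q) a :
  injs_act (injs_comp v u) a = injs_act v (injs_act u a).
Proof.
elim: P Q R v u a => [|S P IH] [|T Q] [|U R] // [v1 v2] [u1 u2] [a1 a2] /=.
by rewrite cube_map_comp IH.
Qed.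

Lemma injs_comp1m P Q (u : injs P Q) : injs_comp (injs_id Q) u = u.
Proof.
elim: P Q u => [|S P IH] [|T Q] //= => [[] //|[u1 u2]] /=.
by rewrite IH; congr pair; apply: injection_eq.
Qed.

Lemma injs_compm1 P Q (u : injs P Q) : injs_comp u (injs_id P) = u.
Proof.
elim: P Q u => [|S P IH] [|T Q] //= => [[] //|[u1 u2]] /=.
by rewrite IH; congr pair; apply: injection_eq.
Qed.

Lemma injs_compA P Q R T (w : injs R T) (v : injs Q R) (u : injs P Q) :
  injs_comp w (injs_comp v u) = injs_comp (injs_comp w v) u.
Proof.
elim: P Q R T w v u => [|S P IH] [|S' Q] [|S'' R] [|S''' T] //=.
by move=> [w1 w2] [v1 v2] [u1 u2] /=; rewrite IH; congr pair;
   apply: injection_eq.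
Qed.

Lemma injs_act_le P Q (u : injs P Q) a b :
  sle (injs_act u a) (injs_act u b) = sle a b.
Proof.
elim: P Q u a b => [|S P IH] [|T Q] // [u1 u2] [a1 a2] [b1 b2] /=.
by rewrite IH cube_map_le.
Qed.

Lemma injs_act_deg P Q (u : injs P Q) a : sdeg (injs_act u a) = sdeg a.
Proof.
elim: P Q u a => [|S P IH] [|T Q] // [u1 u2] [a1 a2] /=.
by rewrite IH card_imset //; apply: inj_injective.
Qed.

Lemma sle_refl P (a : sob P) : sle a a.
Proof. by elim: P a => [|S P IH] // [a1 a2] /=; rewrite subxx IH. Qed.

Lemma sle_trans P (b a c : sob P) : sle a b -> sle b c -> sle a c.
Proof.
elim: P b a c => [|S P IH] // [b1 b2] [a1 a2] [c1 c2] /=.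
move=> /andP[h1 h2] /andP[h3 h4].
by rewrite (subset_trans h1 h3) (IH _ _ _ h2 h4).
Qed.

Lemma sle_anti P (a b : sob P) : sle a b -> sle b a -> a = b.
Proof.
elim: P a b => [|S P IH]; first by case=> [] [].
move=> [a1 a2] [b1 b2] /= /andP[h1 h2] /andP[h3 h4].
by congr pair; [apply/val_inj/eqP; rewrite eqEsubset h1 | apply: IH].
Qed.

Lemma eq_sle P (a b : sob P) : a = b -> sle a b.
Proof. by move=> ->; apply: sle_refl. Qed.

(* A morphism of Pi is a functor pi_fun that is induced by a (necessarily
   unique) family of injections. *)
Record pi_hom (P Q : shape) := PiHom {
  pi_fun :> sob P -> sob Q;
  pi_inj : injs P Q;
  pi_funE : forall a, pi_fun a = injs_act pi_inj a }.

Lemma pi_le P Q (d : pi_hom P Q) a b : sle (d a) (d b) = sle a b.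
Proof. by rewrite !pi_funE injs_act_le. Qed.

Lemma pi_mono P Q (d : pi_hom P Q) a b : sle a b -> sle (d a) (d b).
Proof. by rewrite pi_le. Qed.

Lemma pi_deg P Q (d : pi_hom P Q) a : sdeg (d a) = sdeg a.
Proof. by rewrite pi_funE injs_act_deg. Qed.

Definition pi_of P Q (u : injs P Q) : pi_hom P Q :=
  @PiHom P Q (injs_act u) u (fun _ => erefl).

Definition pi_id P : pi_hom P P :=
  @PiHom P P id (injs_id P) (fun a => esym (injs_act_id a)).

Definition pi_single S T (u : injection S T) : pi_hom [:: S] [:: T] :=
  @pi_of [:: S] [:: T] (u, tt).

Lemma pi_comp_subproof P Q R (d : pi_hom Q R) (e : pi_hom P Q) a :
  d (e a) = injs_act (injs_comp (pi_inj d) (pi_inj e)) a.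
Proof. by rewrite injs_act_comp -!pi_funE. Qed.

Definition pi_comp P Q R (d : pi_hom Q R) (e : pi_hom P Q) : pi_hom P R :=
  @PiHom P R (fun a => d (e a)) _ (pi_comp_subproof d e).

(* Concatenation of lists is the product in Pi. *)
Fixpoint scat (P Q : shape) : sob P -> sob Q -> sob (P ++ Q) :=
  match P return sob P -> sob Q -> sob (P ++ Q) with
  | [::] => fun _ b => b
  | S0 :: P' => fun a b => (a.1, scat a.2 b)
  end.

Fixpoint injs_cat (P P' Q Q' : shape) :
    injs P P' -> injs Q Q' -> injs (P ++ Q) (P' ++ Q') :=
  match P, P' return injs P P' -> injs Q Q' -> injs (P ++ Q) (P' ++ Q') with
  | [::], [::] => fun _ v => v
  | S0 :: R, T :: R' => fun u v => (u.1, injs_cat u.2 v)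
  | _, _ => fun u => match u with end
  end.

Lemma sle_cat P Q (a a' : sob P) (b b' : sob Q) :
  sle (scat a b) (scat a' b') = sle a a' && sle b b'.
Proof.
by elim: P a a' => [|S P IH] // [a1 a2] [a1' a2'] /=; rewrite IH andbA.
Qed.

Lemma sle_catl P Q (a a' : sob P) (b : sob Q) :
  sle a a' -> sle (scat a b) (scat a' b).
Proof. by rewrite sle_cat sle_refl andbT. Qed.

Lemma sle_catr P Q (a : sob P) (b b' : sob Q) :
  sle b b' -> sle (scat a b) (scat a b').
Proof. by rewrite sle_cat sle_refl. Qed.

Lemma injs_act_cat P P' Q Q' (u : injs P P') (v : injs Q Q') a b :
  injs_act (injs_cat u v) (scat a b) = scat (injs_act u a) (injs_act v b).
Proof.
by elim: P P' u a => [|S P IH] [|S' P'] // [u1 u2] [a1 a2] /=; rewrite IH.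
Qed.

Definition pi_cat P P' Q Q' (d : pi_hom P P') (e : pi_hom Q Q') :
  pi_hom (P ++ Q) (P' ++ Q') := pi_of (injs_cat (pi_inj d) (pi_inj e)).

Lemma pi_cat_le P P' Q Q' (d : pi_hom P P') (e : pi_hom Q Q') a b :
  sle (scat (d a) (e b)) (pi_cat d e (scat a b)).
Proof. by rewrite /= injs_act_cat -!pi_funE sle_refl. Qed.

Section Codiagrams.
Variable D : category.

Record diagram (P : shape) := Diagram {
  dob :> sob P -> D;
  dmap : forall a b, sle a b -> (dob a ⟶ dob b);
  dmap1 : forall a (h : sle a a), dmap h = cidm (dob a);
  dmap_comp : forall a b c (h : sle a b) (k : sle b c) (l : sle a c),
    dmap k ∘ dmap h = dmap l }.

Record nattrans P (X Y : diagram P) := NatTrans {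
  nt :> forall a, X a ⟶ Y a;
  nt_nat : forall a b (h : sle a b), nt b ∘ dmap X h = dmap Y h ∘ nt a }.

Definition const_diagram P (B : D) : diagram P :=
  @Diagram P (fun _ => B) (fun _ _ _ => cidm B) (fun _ _ => erefl)
    (fun _ _ _ _ _ _ => ccomp1m (cidm B)).

Definition const_nat P (B C : D) (f : B ⟶ C) :
    nattrans (const_diagram P B) (const_diagram P C) :=
  @NatTrans P (const_diagram P B) (const_diagram P C) (fun _ => f)
    (fun _ _ _ => etrans (ccompm1 f) (esym (ccomp1m f))).

Record codiag := Codiag {
  cd_shape : shape;
  cd_diag :> diagram cd_shape }.

Record codiag_hom (X Y : codiag) := CodiagHom {
  ch_pi : pi_hom (cd_shape Y) (cd_shape X);
  ch_map :> forall b, X (ch_pi b) ⟶ Y b;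
  ch_nat : forall b b' (h : sle b b'),
    ch_map b' ∘ dmap X (pi_mono ch_pi h) = dmap Y h ∘ ch_map b }.

Definition codiag_of_nat P (X Y : diagram P) (f : nattrans X Y) :
    codiag_hom (Codiag X) (Codiag Y) :=
  @CodiagHom (Codiag X) (Codiag Y) (pi_id P) f
    (fun b b' h => etrans (congr1 (fun k => f b' ∘ dmap X k)
                            (bool_irrelevance _ h)) (nt_nat f h)).

Lemma codiag_hom_eq (X Y : codiag) (d : sob (cd_shape Y) -> sob (cd_shape X))
    u v hu hv (a a' : forall b, X (d b) ⟶ Y b) na na' :
  u = v -> (forall b, a b = a' b) ->
  @CodiagHom X Y (@PiHom _ _ d u hu) a na
  = @CodiagHom X Y (@PiHom _ _ d v hv) a' na'.
Proof.
move=> e ea; subst v; have e' : a = a' by apply: functional_extensionality_dep.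
subst a'; have e' := Prop_irrelevance hu hv; subst hv.
by rewrite (Prop_irrelevance na na').
Qed.

Lemma codiag_id_subproof (X : codiag) b b' (h : sle b b') :
  cidm (X b') ∘ dmap X (pi_mono (pi_id (cd_shape X)) h)
  = dmap X h ∘ cidm (X b).
Proof. by rewrite ccomp1m ccompm1; congr dmap; apply: bool_irrelevance. Qed.

Definition codiag_id (X : codiag) : codiag_hom X X :=
  @CodiagHom X X (pi_id _) (fun b => cidm (X b)) (@codiag_id_subproof X).

Section Comp.
Variables (X Y Z : codiag) (g : codiag_hom Y Z) (f : codiag_hom X Y).

Let cmap c : X (pi_comp (ch_pi f) (ch_pi g) c) ⟶ Z c := g c ∘ f (ch_pi g c).

Lemma codiag_comp_subproof c c' (h : sle c c') :
  cmap c' ∘ dmap X (pi_mono (pi_comp (ch_pi f) (ch_pi g)) h)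
  = dmap Z h ∘ cmap c.
Proof.
rewrite /cmap ccompA -ch_nat -!ccompA -ch_nat.
by congr (_ ∘ (_ ∘ dmap _ _)); apply: bool_irrelevance.
Qed.

Definition codiag_comp : codiag_hom X Z :=
  @CodiagHom X Z (pi_comp (ch_pi f) (ch_pi g)) cmap codiag_comp_subproof.
End Comp.

Lemma codiag_compA X Y Z T (h : codiag_hom Z T) (g : codiag_hom Y Z)
    (f : codiag_hom X Y) :
  codiag_comp h (codiag_comp g f) = codiag_comp (codiag_comp h g) f.
Proof.
apply: codiag_hom_eq => [|b /=]; first by rewrite /= injs_compA.
by rewrite ccompA.
Qed.

Lemma codiag_comp1m X Y (f : codiag_hom X Y) : codiag_comp (codiag_id Y) f = f.
Proof.
case: f => [[d u hu] a na]; apply: codiag_hom_eq => [|b /=].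
  by rewrite /= injs_compm1.
by rewrite ccomp1m.
Qed.

Lemma codiag_compm1 X Y (f : codiag_hom X Y) : codiag_comp f (codiag_id X) = f.
Proof.
case: f => [[d u hu] a na]; apply: codiag_hom_eq => [|b /=].
  by rewrite /= injs_comp1m.
by rewrite ccompm1.
Qed.

Definition CoDiag : category :=
  Category codiag_compA codiag_comp1m codiag_compm1.

(* The morphism of codiagrams from the constant diagram on Q to the constant
   diagram on P induced by d : P -> Q. *)
Definition const_pi P Q (d : pi_hom P Q) (B : D) :
    codiag_hom (Codiag (const_diagram Q B)) (Codiag (const_diagram P B)) :=
  @CodiagHom (Codiag (const_diagram Q B)) (Codiag (const_diagram P B))
    d (fun _ => cidm B) (fun _ _ _ => erefl).

End Codiagrams.

Section IteratedSimple.
Variables (D : category) (s : functor (CoDiag D) D).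

Section Slice.
Variables (P Q : shape) (X : diagram D (P ++ Q)).

Lemma slice_comp_subproof (a : sob P) (b b' b'' : sob Q)
    (h : sle b b') (k : sle b' b'') (l : sle b b'') :
  dmap X (sle_catr a k) ∘ dmap X (sle_catr a h) = dmap X (sle_catr a l).
Proof. exact: dmap_comp. Qed.

Definition slice (a : sob P) : diagram D Q :=
  @Diagram D Q (fun b => X (scat a b)) (fun b b' h => dmap X (sle_catr a h))
    (fun b h => dmap1 X (sle_catr a h)) (@slice_comp_subproof a).

Lemma slice_nat_subproof (a a' : sob P) (h : sle a a') b b' (k : sle b b') :
  dmap X (sle_catl b' h) ∘ dmap (slice a) k
  = dmap (slice a') k ∘ dmap X (sle_catl b h).
Proof.
have l : sle (scat a b) (scat a' b') by rewrite sle_cat h k.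
by rewrite !(dmap_comp X _ _ l).
Qed.

Definition slice_nat (a a' : sob P) (h : sle a a') :
    nattrans (slice a) (slice a') :=
  @NatTrans D Q (slice a) (slice a') (fun b => dmap X (sle_catl b h))
    (@slice_nat_subproof a a' h).

Let imap a a' (h : sle a a') : s (Codiag (slice a)) ⟶ s (Codiag (slice a')) :=
  fmap s (codiag_of_nat (slice_nat h)).

Lemma iter_id_subproof a (h : sle a a) :
  imap h = cidm (s (Codiag (slice a))).
Proof.
rewrite /imap -fmap1; congr fmap; apply: codiag_hom_eq => // b /=.
exact: dmap1.
Qed.

Lemma iter_comp_subproof a b c (h : sle a b) (k : sle b c) (l : sle a c) :
  imap k ∘ imap h = imap l.
Proof.
rewrite /imap -fmap_comp; congr fmap; apply: codiag_hom_eq => [|x /=].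
  by rewrite /= injs_comp1m.
exact: dmap_comp.
Qed.

(* The diagram a |-> s_Q (X (a, -)), so that s_P s_Q X = s (Codiag iter). *)
Definition iter : diagram D P :=
  @Diagram D P (fun a => s (Codiag (slice a))) imap iter_id_subproof
    iter_comp_subproof.

End Slice.

Section SliceHom.
Variables (P P' Q Q' : shape) (X : diagram D (P ++ Q)) (Y : diagram D (P' ++ Q')).
Variables (d : pi_hom P' P) (e : pi_hom Q' Q).
Variable a : forall c, X (pi_cat d e c) ⟶ Y c.
Hypothesis a_nat : forall c c' (h : sle c c'),
  a c' ∘ dmap X (pi_mono (pi_cat d e) h) = dmap Y h ∘ a c.

Let smap (b : sob P') (b' : sob Q') : X (scat (d b) (e b')) ⟶ Y (scat b b') :=
  a (scat b b') ∘ dmap X (pi_cat_le d e b b').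

Lemma slice_hom_subproof b b1 b2 (h : sle b1 b2) :
  smap b b2 ∘ dmap (slice X (d b)) (pi_mono e h)
  = dmap (slice Y b) h ∘ smap b b1.
Proof.
rewrite /smap /= ccompA -a_nat -!ccompA; congr (_ ∘ _).
have l : sle (scat (d b) (e b1)) (pi_cat d e (scat b b2)).
  apply: sle_trans (pi_cat_le _ _ _ _) _.
  by apply: pi_mono; apply: sle_catr.
by rewrite !(dmap_comp X _ _ l).
Qed.

Definition slice_hom (b : sob P') :
    codiag_hom (Codiag (slice X (d b))) (Codiag (slice Y b)) :=
  @CodiagHom D (Codiag (slice X (d b))) (Codiag (slice Y b))
    e (smap b) (@slice_hom_subproof b).

Lemma iter_hom_subproof b b' (h : sle b b') :
  fmap s (slice_hom b') ∘ dmap (iter X) (pi_mono d h)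
  = dmap (iter Y) h ∘ fmap s (slice_hom b).
Proof.
rewrite /= -!fmap_comp; congr fmap; apply: codiag_hom_eq => [|c /=].
  by rewrite /= injs_comp1m injs_compm1.
rewrite /smap ccompA -a_nat -!ccompA; congr (_ ∘ _).
have l : sle (scat (d b) (e c)) (pi_cat d e (scat b' c)).
  apply: sle_trans (pi_cat_le _ _ _ _) _.
  by apply: pi_mono; apply: sle_catl.
by rewrite !(dmap_comp X _ _ l).
Qed.

(* The morphism s_P s_Q X -> s_P' s_Q' Y induced by (a, d x e) comes from this
   morphism of codiagrams. *)
Definition iter_hom : codiag_hom (Codiag (iter X)) (Codiag (iter Y)) :=
  @CodiagHom D (Codiag (iter X)) (Codiag (iter Y))
    d (fun b => fmap s (slice_hom b)) iter_hom_subproof.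

Definition cat_hom : codiag_hom (Codiag X) (Codiag Y) :=
  @CodiagHom D (Codiag X) (Codiag Y) (pi_cat d e) a a_nat.

End SliceHom.

(* The diagrams slice (const_diagram (P ++ Q) B) a and const_diagram Q B have
   the same objects and the same maps; this is the identity between them. *)
Definition slice_const P Q (B : D) (a : sob P) :
    nattrans (const_diagram Q B) (slice (const_diagram (P ++ Q) B) a) :=
  @NatTrans D Q (const_diagram Q B) (slice (const_diagram (P ++ Q) B) a)
    (fun _ => cidm B) (fun _ _ _ => erefl).

Lemma iter_const_subproof P Q (B : D) a b (h : sle a b) :
  fmap s (codiag_of_nat (@slice_const P Q B b))
    ∘ dmap (const_diagram P (s (Codiag (const_diagram Q B)))) h
  = dmap (iter (const_diagram (P ++ Q) B)) h
    ∘ fmap s (codiag_of_nat (slice_const Q B a)).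
Proof. by rewrite ccompm1 /= -fmap_comp; congr fmap; apply: codiag_hom_eq;
  [rewrite /= injs_comp1m | move=> x /=; rewrite ccomp1m]. Qed.

Definition iter_const P Q (B : D) :
    nattrans (const_diagram P (s (Codiag (const_diagram Q B))))
             (iter (const_diagram (P ++ Q) B)) :=
  @NatTrans D P (const_diagram P (s (Codiag (const_diagram Q B))))
    (iter (const_diagram (P ++ Q) B))
    (fun a => fmap s (codiag_of_nat (slice_const Q B a)))
    (@iter_const_subproof P Q B).

End IteratedSimple.

Lemma card_ord_gt0 n : (0 < #|{: 'I_n.+1}|)%N. Proof. by rewrite card_ord. Qed.

Definition ord_nefin n : nefin := NeFin (card_ord_gt0 n).
Definition square n : shape := [:: ord_nefin n].

Section Cospan.
Variables (D : category) (one : zero_object D) (B C : D) (f : B ⟶ C).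

(* The diagram B -f-> C <- 1 on square 1: a non-empty subset of {0, 1} is given
   by its two membership bits, and B, C, 1 sit at {0}, {0, 1}, {1}. *)
Definition cospan_ob (m0 m1 : bool) : D :=
  if m0 then (if m1 then C else B) else one.

Definition cospan_map (m0 m1 n0 n1 : bool) :
    m0 ==> n0 -> m1 ==> n1 -> cospan_ob m0 m1 ⟶ cospan_ob n0 n1 :=
  match m0, m1, n0, n1
  return m0 ==> n0 -> m1 ==> n1 -> cospan_ob m0 m1 ⟶ cospan_ob n0 n1 with
  | false, _, n0, n1 => fun _ _ => zfrom one (cospan_ob n0 n1)
  | true, false, true, false => fun _ _ => cidm B
  | true, false, true, true => fun _ _ => f
  | true, true, true, true => fun _ _ => cidm C
  | true, true, true, false => fun _ k => match notF k with end
  | true, _, false, _ => fun h _ => match notF h with end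
  end.

Definition cospan_bit (a : sob (square 1)) (i : 'I_2) : bool := i \in val a.1.

Lemma cospan_le (a b : sob (square 1)) (i : 'I_2) :
  sle a b -> cospan_bit a i ==> cospan_bit b i.
Proof. by case/andP=> /subsetP h _; apply/implyP; apply: h. Qed.

Let i0 : 'I_2 := ord0.
Let i1 : 'I_2 := ord_max.

Lemma cospan_id_subproof a (h : sle a a) :
  cospan_map (cospan_le i0 h) (cospan_le i1 h)
  = cidm (cospan_ob (cospan_bit a i0) (cospan_bit a i1)).
Proof.
move: (cospan_le i0 h) (cospan_le i1 h).
case: (cospan_bit a i0); case: (cospan_bit a i1) => //= _ _;
  by rewrite [RHS]zfrom_unique.
Qed.

Lemma cospan_comp_subproof a b c (h : sle a b) (k : sle b c) (l : sle a c) :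
  cospan_map (cospan_le i0 k) (cospan_le i1 k)
    ∘ cospan_map (cospan_le i0 h) (cospan_le i1 h)
  = cospan_map (cospan_le i0 l) (cospan_le i1 l).
Proof.
move: (cospan_le i0 h) (cospan_le i1 h) (cospan_le i0 k) (cospan_le i1 k).
move: (cospan_le i0 l) (cospan_le i1 l).
case: (cospan_bit a i0) => /=; last first.
  by move=> *; rewrite [LHS]zfrom_unique.
case: (cospan_bit b i0); case: (cospan_bit c i0) => //.
case: (cospan_bit a i1); case: (cospan_bit b i1) => //;
case: (cospan_bit c i1) => //= *; by rewrite ?ccomp1m ?ccompm1.
Qed.

Definition cospan : diagram D (square 1) :=
  Diagram cospan_id_subproof cospan_comp_subproof.

End Cospan.

Section Extension.
Variables (D : category) (one : zero_object D).
Variables (S T : nefin) (u : injection S T).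

(* u^-1(a) if a is contained in u(S), and None otherwise. *)
Definition preim (a : sob [:: T]) : option (sob [:: S]) :=
  if val a.1 \subset u @: setT
  then omap (fun b => (b, tt)) (insub (u @^-1: val a.1) : option (cube S))
  else None.

Definition ole (x y : option (sob [:: S])) : bool :=
  match x, y with
  | Some a, Some b => sle a b
  | _, None => true
  | None, Some _ => false
  end.

Lemma preim_le a b : sle a b -> ole (preim a) (preim b).
Proof.
case/andP => h _; rewrite /preim.
case: ifPn => [ha|ha]; case: ifPn => [hb|hb] //=; last first.
- by case/negP: ha; apply: subset_trans h hb.
- by case: insubP.
case: insubP => [x hx ex|]; last first.
  have /set0Pn[y ya] := valP a.1.
  have /imsetP[z _ ez] := subsetP ha _ ya.
  by case/set0Pn; exists z; rewrite inE -ez.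
case: insubP => [y hy ey|] //=.
by rewrite ex ey preimsetS.
Qed.

Lemma preim_act (a : sob [:: S]) : ole (preim (pi_single u a)) (Some a).
Proof.
rewrite /preim /= imsetS ?subsetT //.
have e : u @^-1: (u @: val a.1) = val a.1.
  apply/setP => x; rewrite inE; apply/imsetP/idP => [[y ya /inj_injective ->]|] //.
  by move=> xa; exists x.
rewrite e; case: insubP => [x hx ex|] /=; first by rewrite ex subxx.
by rewrite (valP a.1).
Qed.

Variable X : diagram D [:: S].

Definition ext_ob (x : option (sob [:: S])) : D :=
  if x is Some a then X a else one.

Definition ext_map x y : ole x y -> ext_ob x ⟶ ext_ob y :=
  match x, y return ole x y -> ext_ob x ⟶ ext_ob y with
  | Some a, Some b => fun h => dmap X h
  | x, None => fun _ => zto one (ext_ob x)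
  | None, Some _ => fun h => match notF h with end
  end.

Lemma ext_comp x y z (h : ole x y) (k : ole y z) (l : ole x z) :
  ext_map k ∘ ext_map h = ext_map l.
Proof.
case: z k l => [c|] k l; last first.
  by rewrite [LHS](zto_unique (z := one)) [RHS](zto_unique (z := one)).
case: y h k => [b|] // h k; case: x h l => [a|] // h l /=.
exact: dmap_comp.
Qed.

Lemma ext_id x (h : ole x x) : ext_map h = cidm (ext_ob x).
Proof.
case: x h => [a|] h /=; first exact: dmap1.
by rewrite [RHS](zto_unique (z := one)).
Qed.

Definition extension : diagram D [:: T] :=
  @Diagram D [:: T] (fun a => ext_ob (preim a))
    (fun a b h => ext_map (preim_le h))
    (fun a h => ext_id (preim_le h))
    (fun a b c h k l => ext_comp (preim_le h) (preim_le k) (preim_le l)).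

Lemma extension_nat_subproof a b (h : sle a b) :
  ext_map (preim_act b) ∘ dmap extension (pi_mono (pi_single u) h)
  = dmap X h ∘ ext_map (preim_act a).
Proof.
have l : ole (preim (pi_single u a)) (Some b).
  case: (preim _) (preim_act a) => //= x hx; exact: sle_trans h.
rewrite /= (ext_comp _ _ l); apply: esym.
exact: (@ext_comp _ (Some a) (Some b)).
Qed.

(* The identity (u_* X)(u(a)) = X(a), as a morphism of codiagrams over u. *)
Definition extension_hom : codiag_hom (Codiag extension) (Codiag X) :=
  @CodiagHom D (Codiag extension) (Codiag X) (pi_single u)
    (fun a => ext_map (preim_act a)) extension_nat_subproof.

End Extension.

Section Descent.
Variables (D : category) (E : morphism_class D) (s : functor (CoDiag D) D).

Definition simple P (X : diagram D P) : D := s (Codiag X).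
Definition simple_map P (X Y : diagram D P) (f : nattrans X Y) :
  simple X ⟶ simple Y := fmap s (codiag_of_nat f).

(* mu is indexed by the two factors P, Q and by the diagram X on P x Q. *)
Definition factorization_family := forall P Q (X : diagram D (P ++ Q)),
  ho_mor E (simple X) (simple (iter s X)).

Definition is_factorization (mu : factorization_family) : Prop :=
  (forall P Q (X : diagram D (P ++ Q)), ho_iso (mu P Q X)) /\
  (forall P P' Q Q' (X : diagram D (P ++ Q)) (Y : diagram D (P' ++ Q'))
     (d : pi_hom P' P) (e : pi_hom Q' Q)
     (a : forall c, X (pi_cat d e c) ⟶ Y c)
     (a_nat : forall c c' (h : sle c c'),
        a c' ∘ dmap X (pi_mono (pi_cat d e) h) = dmap Y h ∘ a c),
   ho_eq (ho_comp (mu P' Q' Y) (ho_loc E (fmap s (cat_hom a_nat))))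
         (ho_comp (ho_loc E (fmap s (iter_hom s a_nat))) (mu P Q X))).

Definition normalization_family := forall P (B : D),
  B ⟶ simple (const_diagram P B).

Definition is_normalization (mu : factorization_family)
    (lambda : normalization_family) : Prop :=
  [/\ forall P (B C : D) (f : B ⟶ C),
        simple_map (const_nat P f) ∘ lambda P B = lambda P C ∘ f,
      forall P Q (d : pi_hom P Q) (B : D),
        fmap s (const_pi d B) ∘ lambda Q B = lambda P B,
      forall P Q (B : D),
        ho_eq (ho_comp (mu P Q (const_diagram (P ++ Q) B))
                       (ho_loc E (lambda (P ++ Q) B)))
              (ho_loc E (simple_map (iter_const s P Q B)
                         ∘ (lambda P (simple (const_diagram Q B))
                            ∘ lambda Q B)))
    & forall B : D, E (lambda (square 0) B)].

Definition acyclic (one X : D) : Prop := weakly_equivalent E X one.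

Record descent_axioms (one : zero_object D) : Prop := DescentAxioms {
  cd_has_products : forall X Y : D,
    exists (P : D) (p : P ⟶ X) (q : P ⟶ Y), is_product p q;
  cd_saturated : forall (X Y : D) (f : X ⟶ Y),
    E f <-> ho_iso (ho_loc E f);
  cd_stable : forall (X Y X' Y' P P' : D)
    (p : P ⟶ X) (q : P ⟶ Y) (p' : P' ⟶ X') (q' : P' ⟶ Y')
    (f : X ⟶ X') (g : Y ⟶ Y') (h : P ⟶ P'),
    is_product p q -> is_product p' q' ->
    p' ∘ h = f ∘ p -> q' ∘ h = g ∘ q -> E f -> E g -> E h;
  cd_products : forall P (X Y Z : diagram D P)
    (p : nattrans Z X) (q : nattrans Z Y),
    (forall a, is_product (p a) (q a)) ->
    forall (Q : D) (p' : Q ⟶ simple X) (q' : Q ⟶ simple Y)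
      (h : simple Z ⟶ Q),
    is_product p' q' -> p' ∘ h = simple_map p -> q' ∘ h = simple_map q -> E h;
  cd_unit : forall P, E (zto one (simple (const_diagram P one)));
  cd_factorization_normalization :
    exists (mu : factorization_family) (lambda : normalization_family),
      is_factorization mu /\ is_normalization mu lambda;
  cd_exactness : forall P (X Y : diagram D P) (f : nattrans X Y),
    (forall a, E (f a)) -> E (simple_map f);
  cd_acyclicity : forall (B C : D) (f : B ⟶ C),
    E f <-> acyclic one (simple (cospan one f));
  cd_extension : forall (S T : nefin) (u : injection S T)
    (X : diagram D [:: S]),
    E (fmap s (extension_hom one u X)) }.

Definition cohomological_descent_category : Prop :=
  exists one : zero_object D, descent_axioms one.

End Descent.

Section CubeSigns.
Local Open Scope ring_scope.

Definition rk (S : finType) (x : S) : nat := enum_rank x.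

Lemma rk_total (S : finType) (x y : S) : x != y -> (rk y < rk x)%N = ~~ (rk x < rk y)%N.
Proof.
move=> ne; rewrite -leqNgt ltn_neqAle; case: eqVneq => // e.
by case/eqP: ne; apply/enum_rank_inj/val_inj.
Qed.

(* Incidence number of a in b = a + {y}: (-1) to the position of y in b. *)
Definition cube_inc (S : nefin) (a b : cube S) : int :=
  \sum_(y : S | (y \notin val a) && (val b == y |: val a))
    (-1) ^+ #|[set x in val a | (rk x < rk y)%N]|.

(* The alternating sign of the bijection a -> u(a). *)
Definition cube_sgn (S T : nefin) (u : injection S T) (a : cube S) : int :=
  \prod_(x in val a) \prod_(y in val a)
    (-1) ^+ ((rk x < rk y)%N && (rk (u y) < rk (u x))%N).

Lemma cube_incP (S : nefin) (a b : cube S) : cube_inc a b != 0 ->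
  exists2 y, y \notin val a & val b = y |: val a.
Proof.
case: (pickP (fun y => (y \notin val a) && (val b == y |: val a))).
  by move=> y /andP[h /eqP e] _; exists y.
by move=> h; rewrite /cube_inc big_pred0 ?eqxx.
Qed.

Lemma cube_incE (S : nefin) (a b : cube S) y :
  y \notin val a -> val b = y |: val a ->
  cube_inc a b = \prod_(x in val a) (-1) ^+ (rk x < rk y)%N.
Proof.
move=> ya eb; rewrite /cube_inc (big_pred1 y) => [|z].
  rewrite prodrXr; congr (_ ^+ _).
  by rewrite -sum1dep_card big_mkcondr; apply: eq_bigr => x _; case: ifP.
apply/andP/eqP => [[za /eqP ez]|->]; last by rewrite ya eb.
by have := setU11 y (val a); rewrite -eb ez !inE (negbTE ya) orbF => /eqP.
Qed.

Lemma signr_sqr (b : bool) : (-1) ^+ b * (-1) ^+ b = 1 :> int.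
Proof. by case: b. Qed.

Lemma anti0 (x : int) : x = - x -> x = 0.
Proof. by move=> /eqP; rewrite -addr_eq0 -mulr2n mulrn_eq0 => /eqP. Qed.

Lemma cube_inc_inc (S : nefin) (a c : cube S) :
  \sum_(b : cube S) cube_inc a b * cube_inc b c = 0.
Proof.
pose s (y : S) : int := \prod_(x in val a) (-1) ^+ (rk x < rk y)%N.
pose F y z : int := if [&& y \notin val a, z \notin val a, y != z &
    val c == z |: (y |: val a)] then s y * s z * (-1) ^+ (rk y < rk z)%N else 0.
have bd y : y |: val a != set0 by apply/set0Pn; exists y; rewrite setU11.
pose B y : cube S := exist (fun A : {set S} => A != set0) _ (bd y).
transitivity (\sum_(y : S) \sum_(z : S) F y z).
  transitivity (\sum_(b : cube S) \sum_(y : S | (y \notin val a) && (b == B y))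
     s y * cube_inc (B y) c).
    apply: eq_bigr => b _; case: (eqVneq (cube_inc a b) 0) => [e|].
      rewrite e mul0r big_pred0 // => y.
      apply/negP => /andP[ya /eqP eb].
      have := cube_incE ya (congr1 val eb); rewrite e => /eqP.
      rewrite eq_sym prodf_seq_eq0 => /hasP[x _ /andP[_]].
      by rewrite signr_eq0.
    case/cube_incP => y ya eb; rewrite (cube_incE ya eb) [RHS](big_pred1 y) => [|z].
      have -> : b = B y by apply: val_inj; rewrite /= -eb.
      by [].
    apply/andP/eqP => [[za /eqP ez]|->].
      by have := setU11 y (val a); rewrite -eb ez /= !inE (negbTE ya) orbF => /eqP.
    by split=> //; apply/eqP/val_inj.
  rewrite (exchange_big_dep predT) //=; apply: eq_bigr => y _.
  case: (boolP (y \in val a)) => ya /=.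
    by rewrite big_pred0 // big1 // => z _; rewrite /F ya.
  rewrite big_pred1_eq /cube_inc mulr_sumr big_mkcond; apply: eq_bigr => z _.
  rewrite /F ya /= !inE negb_or [z == y]eq_sym -andbA andbCA.
  case: ifP => // /and3P[za zy _].
  rewrite -mulrA; congr (_ * _).
  transitivity (\prod_(x in y |: val a) (-1) ^+ (rk x < rk z)%N : int).
    rewrite prodrXr; congr (_ ^+ _).
    by rewrite -sum1dep_card big_mkcondr; apply: eq_bigr => x _; case: ifP.
  by rewrite big_setU1 //= mulrC.
apply: anti0; rewrite {1}exchange_big -sumrN; apply: eq_bigr => y _.
rewrite -sumrN; apply: eq_bigr => z _; rewrite /F.
rewrite [z == y]eq_sym setUCA andbCA.
case: ifP => [/and4P[_ _ yz _]|]; last by rewrite oppr0.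
rewrite (rk_total yz) [s z * _]mulrC -mulrN.
by case: (rk y < rk z)%N; rewrite ?opprK.
Qed.

Lemma prod_pairs (S : finType) (a : {set S}) (h : S -> S -> int) :
  (forall x, h x x = 1) ->
  \prod_(x in a) \prod_(y in a) h x y
  = \prod_(x in a) \prod_(y in a)
      (if (rk x < rk y)%N then h x y * h y x else 1).
Proof.
move=> hx.
transitivity (\prod_(x in a) \prod_(y in a) (if (rk x < rk y)%N then h x y else 1)
   * \prod_(x in a) \prod_(y in a) (if (rk y < rk x)%N then h x y else 1)).
  rewrite -big_split; apply: eq_bigr => x _; rewrite -big_split.
  apply: eq_bigr => y _ /=; case: (eqVneq x y) => [->|ne].
    by rewrite ltnn mulr1.
  by rewrite (rk_total ne); case: ifP; rewrite /= ?mulr1 ?mul1r.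
rewrite [X in _ * X]exchange_big -big_split; apply: eq_bigr => x _.
rewrite -big_split; apply: eq_bigr => y _ /=.
by case: ifP; rewrite ?mulr1.
Qed.

Lemma cube_sgn_sqr (S T : nefin) (u : injection S T) a :
  cube_sgn u a * cube_sgn u a = 1.
Proof.
rewrite /cube_sgn -big_split big1 // => x _; rewrite -big_split big1 // => y _.
exact: signr_sqr.
Qed.

Lemma cube_sgn_id (S : nefin) a : cube_sgn (injection_id S) a = 1.
Proof.
rewrite /cube_sgn big1 // => x _; rewrite big1 // => y _ /=.
by case: ltngtP.
Qed.

Lemma cube_sgn_comp (S T U : nefin) (v : injection T U) (u : injection S T) a :
  cube_sgn (injection_comp v u) a = cube_sgn v (cube_map u a) * cube_sgn u a.
Proof.
suff h : cube_sgn (injection_comp v u) a * cube_sgn v (cube_map u a) * cube_sgn u a = 1.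
  by rewrite -[RHS]mul1r -h mulrACA cube_sgn_sqr mulr1 -mulrA cube_sgn_sqr mulr1.
have -> : cube_sgn v (cube_map u a) = \prod_(x in val a) \prod_(y in val a)
    (-1) ^+ ((rk (u x) < rk (u y))%N && (rk (v (u y)) < rk (v (u x)))%N).
  rewrite /cube_sgn /= big_imset /=; last by move=> ? ? _ _; apply: inj_injective.
  by apply: eq_bigr => x _; rewrite big_imset //= => ? ? _ _; apply: inj_injective.
rewrite /cube_sgn -!big_split /=.
under eq_bigr => x _ do rewrite -!big_split /=.
rewrite prod_pairs => [|x]; last by rewrite !ltnn.
rewrite big1 // => x _; rewrite big1 // => y _; case: ifP => // xy.
have ne : x != y by apply: contraTneq xy => ->; rewrite ltnn.
have une : u x != u y by apply: contra ne => /eqP/inj_injective ->.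
have vne : v (u x) != v (u y) by apply: contra une => /eqP/inj_injective ->.
rewrite (rk_total ne) (rk_total une) (rk_total vne) xy.
by case: (rk (u x) < _)%N; case: (rk (v (u x)) < _)%N.
Qed.

Lemma cube_inc_map (S T : nefin) (u : injection S T) (a b : cube S) :
  cube_inc (cube_map u a) (cube_map u b) * cube_sgn u b
  = cube_sgn u a * cube_inc a b.
Proof.
have incu : cube_inc (cube_map u a) (cube_map u b) != 0 ->
    exists2 y, y \notin val a & val b = y |: val a.
  case/cube_incP => y ya /= e.
  have /imsetP[z zb ez] : y \in u @: val b by rewrite e setU11.
  exists z; first by apply: contra ya => za; rewrite ez /= imset_f.
  apply: (imset_inj (@inj_injective _ _ u)); rewrite e ez.
  by rewrite imsetU1.
case: (boolP ((cube_inc a b == 0)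
   && (cube_inc (cube_map u a) (cube_map u b) == 0))).
  by case/andP => /eqP -> /eqP ->; rewrite mul0r mulr0.
rewrite negb_and => h.
have [y ya eb] : exists2 y, y \notin val a & val b = y |: val a.
  by case/orP: h => [/cube_incP|/incu].
have uya : u y \notin val (cube_map u a).
  by rewrite /= mem_imset //; apply: inj_injective.
rewrite (cube_incE ya eb) (cube_incE uya) /=; last by rewrite eb imsetU1.
rewrite big_imset /=; last by move=> ? ? _ _; apply: inj_injective.
rewrite /cube_sgn eb big_setU1 //= big_setU1 //= ltnn /= mul1r.
under [X in _ * (_ * X)]eq_bigr => x _ do rewrite big_setU1 //=.
rewrite big_split /= mulrA [_ * (_ * _)]mulrCA mulrA mulrC.
rewrite [LHS]mulrC [RHS]mulrC; congr (_ * _).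
rewrite -!big_split /=; apply: eq_bigr => x xa.
have ne : x != y by apply: contraNneq ya => <-.
have une : u x != u y by apply: contra ne => /eqP/inj_injective ->.
rewrite (rk_total ne) (rk_total une).
by case: (rk x < rk y)%N; case: (rk (u x) < _)%N.
Qed.
End CubeSigns.

Section Signs.
Local Open Scope ring_scope.

(* Koszul rule: moving past the first component contributes (-1)^|a_1|. *)
Fixpoint sinc (P : shape) : sob P -> sob P -> int :=
  match P return sob P -> sob P -> int with
  | [::] => fun _ _ => 0
  | S0 :: P' => fun a b =>
      (a.2 == b.2)%:R * cube_inc a.1 b.1
      + (a.1 == b.1)%:R * ((-1) ^+ #|val a.1|.-1 * sinc a.2 b.2)
  end.

Fixpoint ssgn (P Q : shape) : injs P Q -> sob P -> int :=
  match P, Q return injs P Q -> sob P -> int with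
  | S0 :: P', T :: Q' => fun u a => cube_sgn u.1 a.1 * ssgn u.2 a.2
  | _, _ => fun _ _ => 1
  end.

Lemma sincP (P : shape) (a b : sob P) : sinc a b != 0 ->
  sle a b /\ sdeg b = (sdeg a).+1.
Proof.
elim: P a b => [|S P IH] //= [a1 a2] [b1 b2] /= h.
have [/andP[/eqP e h1]|/andP[/eqP e h2]] :
    (a2 == b2) && (cube_inc a1 b1 != 0) \/ (a1 == b1) && (sinc a2 b2 != 0).
- case: (eqVneq a2 b2) h => /= _ h; last first.
    right; move: h; rewrite mul0r add0r; case: (a1 == b1) => /=.
      by rewrite mul1r mulf_eq0 signr_eq0.
    by rewrite mul0r eqxx.
  case: (eqVneq (cube_inc a1 b1) 0) h => h; last by left.
  rewrite h mulr0 add0r; case: (a1 == b1) => /=.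
    by rewrite mul1r mulf_eq0 signr_eq0; right.
  by rewrite mul0r eqxx.
- subst b2; have [y ya eb] := cube_incP h1.
  rewrite sle_refl eb subsetUr cardsU1 ya add1n /=; split=> //.
  by have /set0Pn[x xa] := valP a1; rewrite (cardsD1 x) xa.
- subst b1; have [-> ->] := IH _ _ h2.
  by rewrite subxx addnS.
Qed.

Lemma sinc_sinc (P : shape) (a c : sob P) :
  \sum_(b : sob P) sinc a b * sinc b c = 0.
Proof.
elim: P a c => [|S P IH] /=; first by move=> a c; rewrite big1 // => b; rewrite mul0r.
case=> [a1 a2] [c1 c2] /=.
rewrite -(pair_bigA _ (fun b1 b2 =>
  ((a2 == b2)%:R * cube_inc a1 b1
      + (a1 == b1)%:R * ((-1) ^+ #|val a1|.-1 * sinc a2 b2)) *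
  ((b2 == c2)%:R * cube_inc b1 c1
      + (b1 == c1)%:R * ((-1) ^+ #|val b1|.-1 * sinc b2 c2)))) /=.
have d0 (I : finType) (i : I) (F : I -> int) : \sum_j (i == j)%:R * F j = F i.
  rewrite (bigD1 i) //= eqxx mul1r big1 ?addr0 // => j ji.
  by rewrite eq_sym (negbTE ji) mul0r.
have d1 (I : finType) (i : I) (F : I -> int) : \sum_j (j == i)%:R * F j = F i.
  by rewrite -[RHS]d0; apply: eq_bigr => j _; rewrite eq_sym.
pose t (x : cube S) : int := (-1) ^+ #|val x|.-1.
have e1 : \sum_b1 \sum_b2 ((a2 == b2)%:R * cube_inc a1 b1) *
    ((b2 == c2)%:R * cube_inc b1 c1) = 0.
  transitivity (\sum_b1 (a2 == c2)%:R * (cube_inc a1 b1 * cube_inc b1 c1)).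
    apply: eq_bigr => b1 _; rewrite -[RHS](d0 _ a2 (fun b2 => (b2 == c2)%:R * _)).
    by apply: eq_bigr => b2 _; rewrite -!mulrA; congr (_ * _); rewrite mulrCA.
  by rewrite -mulr_sumr cube_inc_inc mulr0.
have e2 : \sum_b1 \sum_b2 ((a2 == b2)%:R * cube_inc a1 b1) *
    ((b1 == c1)%:R * (t b1 * sinc b2 c2)) = cube_inc a1 c1 * t c1 * sinc a2 c2.
  rewrite -[RHS](d1 _ c1 (fun b1 => cube_inc a1 b1 * t b1 * sinc a2 c2)).
  apply: eq_bigr => b1 _.
  rewrite -[RHS](d0 _ a2 (fun b2 => (b1 == c1)%:R * (cube_inc a1 b1 * t b1 * sinc b2 c2))).
  apply: eq_bigr => b2 _; rewrite -!mulrA; congr (_ * _).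
  by rewrite mulrCA.
have e3 : \sum_b1 \sum_b2 ((a1 == b1)%:R * (t a1 * sinc a2 b2)) *
    ((b2 == c2)%:R * cube_inc b1 c1) = cube_inc a1 c1 * t a1 * sinc a2 c2.
  rewrite -[RHS](d0 _ a1 (fun b1 => cube_inc b1 c1 * t a1 * sinc a2 c2)).
  apply: eq_bigr => b1 _.
  rewrite -[RHS](d1 _ c2 (fun b2 => (a1 == b1)%:R * (cube_inc b1 c1 * t a1 * sinc a2 b2))).
  apply: eq_bigr => b2 _; rewrite mulrCA -!mulrA; congr (_ * (_ * _)).
  by rewrite [RHS]mulrC -!mulrA; congr (_ * _); rewrite mulrC.
have e4 : \sum_b1 \sum_b2 ((a1 == b1)%:R * (t a1 * sinc a2 b2)) *
    ((b1 == c1)%:R * (t b1 * sinc b2 c2)) = 0.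
  apply: big1 => b1 _.
  transitivity ((a1 == b1)%:R * (b1 == c1)%:R * (t a1 * t b1) *
      \sum_b2 sinc a2 b2 * sinc b2 c2).
    rewrite mulr_sumr; apply: eq_bigr => b2 _.
    by rewrite mulrACA -[RHS]mulrA; congr (_ * _); rewrite mulrACA.
  by rewrite IH mulr0.
transitivity (cube_inc a1 c1 * (t c1 + t a1) * sinc a2 c2).
  rewrite mulrDr mulrDl -e2 -e3 -[RHS]addr0 -[X in _ + X]e4 -[RHS]add0r.
  rewrite -[X in X + _]e1 -!big_split /=; apply: eq_bigr => b1 _.
  rewrite -!big_split /=; apply: eq_bigr => b2 _.
  by rewrite mulrDl !mulrDr -!addrA.
case: (eqVneq (cube_inc a1 c1) 0) => [->|/cube_incP[y ya ec]].
  by rewrite !mul0r.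
suff -> : t c1 = - t a1 by rewrite addNr mulr0 mul0r.
rewrite /t ec cardsU1 ya add1n /=; have /set0Pn[x xa] := valP a1.
by rewrite (cardsD1 x) xa add1n /= exprS mulN1r.
Qed.

Lemma ssgn_id P (a : sob P) : ssgn (injs_id P) a = 1.
Proof.
by elim: P a => [|S P IH] //= [a1 a2] /=; rewrite cube_sgn_id IH mulr1.
Qed.

Lemma ssgn_comp P Q R (v : injs Q R) (u : injs P Q) a :
  ssgn (injs_comp v u) a = ssgn v (injs_act u a) * ssgn u a.
Proof.
elim: P Q R v u a => [|S P IH] [|T Q] [|U R] //=.
by move=> [v1 v2] [u1 u2] [a1 a2] /=; rewrite cube_sgn_comp IH mulrACA.
Qed.

Lemma cube_map_inj S T (u : injection S T) : injective (cube_map u).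
Proof.
move=> a b /(congr1 val) /= e; apply: val_inj.
exact: imset_inj (@inj_injective _ _ u) _ _ e.
Qed.

Lemma injs_act_inj P Q (u : injs P Q) : injective (injs_act u).
Proof.
elim: P Q u => [|S P IH] [|T Q] //=; first by move=> [] [] [].
move=> [u1 u2] [a1 a2] [b1 b2] /= e; congr pair.
  have e1 : cube_map u1 a1 = cube_map u1 b1 := congr1 fst e.
  exact: cube_map_inj e1.
exact: (IH _ u2 _ _ (congr1 snd e)).
Qed.

Lemma sinc_act P Q (u : injs P Q) (a b : sob P) :
  sinc (injs_act u a) (injs_act u b) * ssgn u b = ssgn u a * sinc a b.
Proof.
elim: P Q u a b => [|S P IH] [|T Q] //=.
move=> [u1 u2] [a1 a2] [b1 b2] /=.
rewrite (inj_eq (@injs_act_inj _ _ u2)) (inj_eq (@cube_map_inj _ _ u1)).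
rewrite card_imset; last exact: inj_injective.
rewrite mulrDl mulrDr; congr (_ + _).
  case: (eqVneq a2 b2) => [<-|_]; last by rewrite !mul0r mulr0.
  by rewrite !mul1r mulrA cube_inc_map mulrAC.
case: (eqVneq a1 b1) => [<-|_]; last by rewrite !mul0r mulr0.
rewrite !mul1r -!mulrA [X in _ * X = _]mulrCA IH mulrCA; congr (_ * _).
by rewrite mulrCA.
Qed.

Lemma cube_le_map S T (u : injection S T) (c : cube T) (b : cube S) :
  val c \subset val (cube_map u b) -> exists a, c = cube_map u a.
Proof.
move=> /subsetP h.
have e : u @: (u @^-1: val c) = val c.
  apply/setP => y; apply/imsetP/idP => [[x xc ->]|yc].
    by move: xc; rewrite inE.
  have /imsetP[x xb ex] := h _ yc; exists x => //.
  by rewrite inE -ex.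
have ne : u @^-1: val c != set0.
  by apply: contraNneq (valP c) => e0; rewrite -e e0 imset0.
by exists (exist (fun A : {set S} => A != set0) _ ne); apply: val_inj; rewrite /= e.
Qed.

Lemma sle_act P Q (u : injs P Q) c b :
  sle c (injs_act u b) -> exists a, c = injs_act u a.
Proof.
elim: P Q u c b => [|S P IH] [|T Q] //=; first by move=> _ [] _ _; exists tt.
move=> [u1 u2] [c1 c2] [b1 b2] /= /andP[/cube_le_map[a1 ->] /IH[a2 ->]].
by exists (a1, a2).
Qed.
End Signs.

Local Open Scope ring_scope.

(* With classical choice every type carries the eqType and choiceType structures
   required by zmodType, so an arbitrary preadditive category is of this form. *)
Record preadditive := Preadditive {
  pob :> Type;
  phom : pob -> pob -> zmodType;
  pidm : forall X, phom X X;
  pcomp : forall X Y Z, phom Y Z -> phom X Y -> phom X Z;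
  pcompA : forall X Y Z T (h : phom Z T) (g : phom Y Z) (f : phom X Y),
    pcomp h (pcomp g f) = pcomp (pcomp h g) f;
  pcomp1m : forall X Y (f : phom X Y), pcomp (pidm Y) f = f;
  pcompm1 : forall X Y (f : phom X Y), pcomp f (pidm X) = f;
  pcompDl : forall X Y Z (g g' : phom Y Z) (f : phom X Y),
    pcomp (g + g') f = pcomp g f + pcomp g' f;
  pcompDr : forall X Y Z (g : phom Y Z) (f f' : phom X Y),
    pcomp g (f + f') = pcomp g f + pcomp g f' }.

Notation "X ~> Y" := (phom X Y).
Notation "g ⊙ f" := (pcomp g f).
Arguments pidm {p} X.

Section PreadditiveNotions.
Variable A : preadditive.

Definition is_mono (X Y : A) (f : X ~> Y) : Prop :=
  forall Z (g h : Z ~> X), f ⊙ g = f ⊙ h -> g = h.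

Definition is_epi (X Y : A) (f : X ~> Y) : Prop :=
  forall Z (g h : Y ~> Z), g ⊙ f = h ⊙ f -> g = h.

Definition is_iso (X Y : A) (f : X ~> Y) : Prop :=
  exists g : Y ~> X, g ⊙ f = pidm X /\ f ⊙ g = pidm Y.

Definition is_zero (X : A) : Prop :=
  forall Y, (forall f : X ~> Y, f = 0) /\ (forall f : Y ~> X, f = 0).

Definition is_kernel (X Y K : A) (f : X ~> Y) (k : K ~> X) : Prop :=
  f ⊙ k = 0 /\
  forall Z (g : Z ~> X), f ⊙ g = 0 -> exists! h : Z ~> K, k ⊙ h = g.

Definition is_cokernel (X Y C : A) (f : X ~> Y) (c : Y ~> C) : Prop :=
  c ⊙ f = 0 /\
  forall Z (g : Y ~> Z), g ⊙ f = 0 -> exists! h : C ~> Z, h ⊙ c = g.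

Definition through (W X Z : A) (i : W ~> X) (x : Z ~> X) : Prop :=
  exists y : Z ~> W, i ⊙ y = x.

End PreadditiveNotions.

Record abelian := Abelian {
  ab_pre :> preadditive;
  bip : forall (I : finType) (F : I -> ab_pre), ab_pre;
  bin : forall (I : finType) (F : I -> ab_pre) i, F i ~> bip F;
  bpr : forall (I : finType) (F : I -> ab_pre) i, bip F ~> F i;
  bpr_in : forall (I : finType) (F : I -> ab_pre) i,
    bpr F i ⊙ bin F i = pidm (F i);
  bpr_in0 : forall (I : finType) (F : I -> ab_pre) i j, i != j ->
    bpr F j ⊙ bin F i = 0;
  bin_pr : forall (I : finType) (F : I -> ab_pre),
    \sum_i bin F i ⊙ bpr F i = pidm (bip F);
  ker : forall (X Y : ab_pre), X ~> Y -> ab_pre;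
  kerm : forall (X Y : ab_pre) (f : X ~> Y), ker f ~> X;
  kerP : forall (X Y : ab_pre) (f : X ~> Y), is_kernel f (kerm f);
  coker : forall (X Y : ab_pre), X ~> Y -> ab_pre;
  cokerm : forall (X Y : ab_pre) (f : X ~> Y), Y ~> coker f;
  cokerP : forall (X Y : ab_pre) (f : X ~> Y), is_cokernel f (cokerm f);
  mono_normal : forall (X Y : ab_pre) (f : X ~> Y),
    is_mono f -> is_kernel (cokerm f) f;
  epi_normal : forall (X Y : ab_pre) (f : X ~> Y),
    is_epi f -> is_cokernel (kerm f) f }.

Section PreadditiveTheory.
Variable A : preadditive.
Implicit Types X Y Z : A.

Lemma pcomp0m X Y Z (f : X ~> Y) : (0 : Y ~> Z) ⊙ f = 0.
Proof. by apply: (addrI ((0 : Y ~> Z) ⊙ f)); rewrite -pcompDl !addr0. Qed.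

Lemma pcompm0 X Y Z (f : Y ~> Z) : f ⊙ (0 : X ~> Y) = 0.
Proof. by apply: (addrI (f ⊙ (0 : X ~> Y))); rewrite -pcompDr !addr0. Qed.

Lemma pcompNl X Y Z (g : Y ~> Z) (f : X ~> Y) : (- g) ⊙ f = - (g ⊙ f).
Proof. by apply: (addrI (g ⊙ f)); rewrite -pcompDl !subrr pcomp0m. Qed.

Lemma pcompNr X Y Z (g : Y ~> Z) (f : X ~> Y) : g ⊙ (- f) = - (g ⊙ f).
Proof. by apply: (addrI (g ⊙ f)); rewrite -pcompDr !subrr pcompm0. Qed.

Lemma pcompMl X Y Z (g : Y ~> Z) (f : X ~> Y) n : (g *~ n) ⊙ f = (g ⊙ f) *~ n.
Proof.
have h m : (g *+ m) ⊙ f = (g ⊙ f) *+ m.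
  by elim: m => [|m IH]; rewrite ?mulr0n ?pcomp0m // !mulrS pcompDl IH.
by case: n => n; rewrite ?NegzE ?mulrNz ?pcompNl -!pmulrn h.
Qed.

Lemma pcompMr X Y Z (g : Y ~> Z) (f : X ~> Y) n : g ⊙ (f *~ n) = (g ⊙ f) *~ n.
Proof.
have h m : g ⊙ (f *+ m) = (g ⊙ f) *+ m.
  by elim: m => [|m IH]; rewrite ?mulr0n ?pcompm0 // !mulrS pcompDr IH.
by case: n => n; rewrite ?NegzE ?mulrNz ?pcompNr -!pmulrn h.
Qed.

Lemma pcomp_suml X Y Z (I : finType) (g : I -> Y ~> Z) (f : X ~> Y) :
  (\sum_i g i) ⊙ f = \sum_i g i ⊙ f.
Proof.
apply: (big_morph (fun g => g ⊙ f)); last exact: pcomp0m.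
by move=> *; apply: pcompDl.
Qed.

Lemma pcomp_sumr X Y Z (I : finType) (g : Y ~> Z) (f : I -> X ~> Y) :
  g ⊙ (\sum_i f i) = \sum_i g ⊙ f i.
Proof.
apply: (big_morph (fun f => g ⊙ f)); last exact: pcompm0.
by move=> *; apply: pcompDr.
Qed.

Lemma through_comp (W X Z Z' : A) (i : W ~> X) (x : Z ~> X) (z : Z' ~> Z) :
  through i x -> through i (x ⊙ z).
Proof. by case=> y <-; exists (y ⊙ z); rewrite pcompA. Qed.

Lemma through_trans (W W' X Z : A) (i : W ~> X) (j : W' ~> X) (x : Z ~> X) :
  through i j -> through j x -> through i x.
Proof. by case=> y <- [z <-]; exists (y ⊙ z); rewrite pcompA. Qed.

Lemma through0 (W X Z : A) (i : W ~> X) : through i (0 : Z ~> X).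
Proof. by exists 0; rewrite pcompm0. Qed.

Lemma kernel_mono X Y K (f : X ~> Y) (k : K ~> X) : is_kernel f k -> is_mono k.
Proof.
case=> fk u Z g h e.
have [w [_ uw]] := u Z (k ⊙ h) (etrans (pcompA _ _ _)
  (etrans (congr1 (fun t => t ⊙ h) fk) (pcomp0m _ h))).
by rewrite -(uw g e) (uw h erefl).
Qed.

Lemma cokernel_epi X Y C (f : X ~> Y) (c : Y ~> C) : is_cokernel f c -> is_epi c.
Proof.
case=> cf u Z g h e.
have [w [_ uw]] := u Z (h ⊙ c) (etrans (esym (pcompA _ _ _))
  (etrans (congr1 (fun t => h ⊙ t) cf) (pcompm0 _ h))).
by rewrite -(uw g e) (uw h erefl).
Qed.

End PreadditiveTheory.

Section AbelianTheory.
Variable A : abelian.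
Implicit Types X Y Z : A.

Definition bcotuple (I : finType) (F : I -> A) X (g : forall i, F i ~> X) :
  bip F ~> X := \sum_i g i ⊙ bpr F i.

Definition btuple (I : finType) (F : I -> A) X (g : forall i, X ~> F i) :
  X ~> bip F := \sum_i bin F i ⊙ g i.

Lemma bpr_tuple (I : finType) (F : I -> A) X (g : forall i, X ~> F i) i :
  bpr F i ⊙ btuple g = g i.
Proof.
rewrite pcomp_sumr (bigD1 i) //= pcompA bpr_in pcomp1m big1 ?addr0 // => j ji.
by rewrite pcompA bpr_in0 // pcomp0m.
Qed.

Lemma bcotuple_in (I : finType) (F : I -> A) X (g : forall i, F i ~> X) i :
  bcotuple g ⊙ bin F i = g i.
Proof.
rewrite pcomp_suml (bigD1 i) //= -pcompA bpr_in pcompm1 big1 ?addr0 // => j ji.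
by rewrite -pcompA bpr_in0 ?pcompm0 // eq_sym.
Qed.

Lemma bip_ext_pr (I : finType) (F : I -> A) X (f g : X ~> bip F) :
  (forall i, bpr F i ⊙ f = bpr F i ⊙ g) -> f = g.
Proof.
move=> h; rewrite -[f]pcomp1m -[g]pcomp1m -bin_pr !pcomp_suml.
by apply: eq_bigr => i _; rewrite -!pcompA h.
Qed.

Lemma bip_ext_in (I : finType) (F : I -> A) X (f g : bip F ~> X) :
  (forall i, f ⊙ bin F i = g ⊙ bin F i) -> f = g.
Proof.
move=> h; rewrite -[f]pcompm1 -[g]pcompm1 -bin_pr !pcomp_sumr.
by apply: eq_bigr => i _; rewrite !pcompA h.
Qed.

Lemma through_ker X Y Z (f : X ~> Y) (x : Z ~> X) :
  through (kerm f) x <-> f ⊙ x = 0.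
Proof.
split=> [[y <-]|/(proj2 (kerP f))[y [ey _]]]; last by exists y.
by rewrite pcompA (proj1 (kerP f)) pcomp0m.
Qed.

Lemma through_mono (W X Z : A) (i : W ~> X) (x : Z ~> X) :
  is_mono i -> (through i x <-> cokerm i ⊙ x = 0).
Proof.
move=> /mono_normal[h u]; split=> [[y <-]|/u[y [ey _]]]; last by exists y.
by rewrite pcompA h pcomp0m.
Qed.

Record subquotient X := Subquotient {
  sq_sub : A;
  sq_in : sq_sub ~> X;
  sq_ob :> A;
  sq_pr : sq_sub ~> sq_ob;
  sq_mono : is_mono sq_in;
  sq_epi : is_epi sq_pr }.

Definition induces X X' (S : subquotient X) (S' : subquotient X') (g : X ~> X')
    (h : S ~> S') : Prop :=
  exists y : sq_sub S ~> sq_sub S',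
    sq_in S' ⊙ y = g ⊙ sq_in S /\ sq_pr S' ⊙ y = h ⊙ sq_pr S.

Lemma induces_unique X X' (S : subquotient X) (S' : subquotient X') g h h' :
  @induces X X' S S' g h -> induces g h' -> h = h'.
Proof.
case=> y [e1 e2] [y' [e1' e2']]; apply: (@sq_epi _ S).
rewrite -e2 -e2'; congr (_ ⊙ _).
by apply: (@sq_mono _ S'); rewrite e1.
Qed.

Lemma induces_comp X X' X'' (S : subquotient X) (S' : subquotient X')
    (S'' : subquotient X'') g h g' h' :
  @induces _ _ S S' g h -> @induces _ _ S' S'' g' h' ->
  @induces _ _ S S'' (g' ⊙ g) (h' ⊙ h).
Proof.
case=> y [e1 e2] [y' [e1' e2']]; exists (y' ⊙ y).
by split; [rewrite pcompA e1' -pcompA e1 | rewrite pcompA e2' -pcompA e2];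
   rewrite pcompA.
Qed.

Lemma induces0 X X' (S : subquotient X) (S' : subquotient X') :
  @induces _ _ S S' 0 0.
Proof. by exists 0; rewrite !pcompm0 !pcomp0m. Qed.

(* The subquotient ker g / im f of Y, for X -f-> Y -g-> Z with g f = 0. *)
Section Cohomology.
Variables (X Y Z : A) (f : X ~> Y) (g : Y ~> Z) (gf : g ⊙ f = 0).

Definition coh_lift : X ~> ker g :=
  projT1 (boolp.cid (proj2 (through_ker g f) gf)).

Definition cohomology : subquotient Y :=
  Subquotient (kernel_mono (kerP g)) (cokernel_epi (cokerP coh_lift)).

Lemma coh_liftE : kerm g ⊙ coh_lift = f.
Proof. exact: projT2 (boolp.cid (proj2 (through_ker g f) gf)). Qed.
End Cohomology.

Lemma cohomology_map_ex X Y Z X' Y' Z' (f : X ~> Y) (g : Y ~> Z)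
    (gf : g ⊙ f = 0) (f' : X' ~> Y') (g' : Y' ~> Z') (gf' : g' ⊙ f' = 0)
    (a : X ~> X') (b : Y ~> Y') (c : Z ~> Z') :
  b ⊙ f = f' ⊙ a -> c ⊙ g = g' ⊙ b ->
  exists h, @induces _ _ (cohomology gf) (cohomology gf') b h.
Proof.
move=> e1 e2.
have [y ey] : through (kerm g') (b ⊙ kerm g).
  by apply/through_ker; rewrite pcompA -e2 -pcompA (proj1 (kerP g)) pcompm0.
have e0 : (cokerm (coh_lift gf') ⊙ y) ⊙ coh_lift gf = 0.
  have -> : (cokerm (coh_lift gf') ⊙ y) ⊙ coh_lift gf
      = cokerm (coh_lift gf') ⊙ (coh_lift gf' ⊙ a).
    rewrite -pcompA; congr (_ ⊙ _); apply: (kernel_mono (kerP g')).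
    by rewrite !pcompA ey coh_liftE -e1 -pcompA coh_liftE.
  by rewrite pcompA (proj1 (cokerP _)) pcomp0m.
have [h [eh _]] := proj2 (cokerP (coh_lift gf)) _ _ e0.
by exists h, y.
Qed.

End AbelianTheory.

Section FilteredComplexes.
Variable A : abelian.

Record filtered := Filtered {
  fl_ob :> A;
  fl_sub : int -> A;
  fl_in : forall p, fl_sub p ~> fl_ob;
  fl_mono : forall p, is_mono (fl_in p);
  fl_incr : forall p q, p <= q -> through (fl_in q) (fl_in p) }.

Definition filtered_map (X Y : filtered) (f : X ~> Y) : Prop :=
  forall p, through (fl_in Y p) (f ⊙ fl_in X p).

(* The differential is a family dif i j indexed by all pairs of degrees, that
   vanishes unless j = i + 1. *)
Record fcomplex := FComplex {
  fc_ob :> int -> filtered;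
  dif : forall i j, fc_ob i ~> fc_ob j;
  dif_filtered : forall i j, filtered_map (dif i j);
  dif_shape : forall i j, j != i + 1 -> dif i j = 0;
  dif_dif : forall i j k, dif j k ⊙ dif i j = 0;
  fc_bounded : exists N, forall n, n < N -> is_zero (fc_ob n) }.

Record fmorphism (K L : fcomplex) := FMorphism {
  fm :> forall n, K n ~> L n;
  fm_filtered : forall n, filtered_map (fm n);
  fm_dif : forall i j, fm j ⊙ dif K i j = dif L i j ⊙ fm i }.

Lemma fmorphism_eq K L (f g : fmorphism K L) : (forall n, f n = g n) -> f = g.
Proof.
case: f g => [f f1 f2] [g g1 g2] /= h; have e := functional_extensionality_dep h; subst g.
by rewrite (Prop_irrelevance f1 g1) (Prop_irrelevance f2 g2).
Qed.

Lemma filtered_map1 (X : filtered) : filtered_map (pidm X).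
Proof. by move=> p; exists (pidm _); rewrite pcomp1m pcompm1. Qed.

Lemma filtered_map_comp (X Y Z : filtered) (g : Y ~> Z) (f : X ~> Y) :
  filtered_map g -> filtered_map f -> filtered_map (g ⊙ f).
Proof.
move=> hg hf p; rewrite -pcompA; have [y <-] := hf p.
by rewrite pcompA; apply: through_comp.
Qed.

Definition fmor_id (K : fcomplex) : fmorphism K K :=
  @FMorphism K K (fun n => pidm (K n)) (fun n => filtered_map1 (K n))
    (fun i j => etrans (pcomp1m _) (esym (pcompm1 _))).

Lemma fmor_comp_subproof K L M (g : fmorphism L M) (f : fmorphism K L) i j :
  (g j ⊙ f j) ⊙ dif K i j = dif M i j ⊙ (g i ⊙ f i).
Proof. by rewrite -pcompA fm_dif !pcompA fm_dif. Qed.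

Definition fmor_comp K L M (g : fmorphism L M) (f : fmorphism K L) :
    fmorphism K M :=
  @FMorphism K M (fun n => g n ⊙ f n)
    (fun n => filtered_map_comp (fm_filtered g n) (fm_filtered f n))
    (fmor_comp_subproof g f).

Definition CplusF : category.
Proof.
refine (@Category fcomplex fmorphism fmor_id fmor_comp _ _ _).
- by move=> *; apply: fmorphism_eq => n /=; rewrite pcompA.
- by move=> *; apply: fmorphism_eq => n /=; rewrite pcomp1m.
- by move=> *; apply: fmorphism_eq => n /=; rewrite pcompm1.
Defined.

Section Page.
Variables (r : nat) (K : fcomplex).

(* The subobject W_a K^n \cap d^-1 (W_b K^(n+1)) of K^n. *)
Definition zker_ob (n a b : int) : A :=
  ker (cokerm (fl_in (K (n + 1)) b) ⊙ (dif K n (n + 1) ⊙ fl_in (K n) a)).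
Definition zker_in (n a b : int) : zker_ob n a b ~> K n :=
  fl_in (K n) a ⊙ kerm _.

Lemma zker_mono n a b : is_mono (zker_in n a b).
Proof.
move=> Z g h; rewrite /zker_in -!pcompA => /fl_mono.
exact: (kernel_mono (kerP _)).
Qed.

Lemma zker_dif n a b :
  cokerm (fl_in (K (n + 1)) b) ⊙ (dif K n (n + 1) ⊙ zker_in n a b) = 0.
Proof.
have h X Y Z T U (c : T ~> U) (d : Z ~> T) (i : Y ~> Z) (k : X ~> Y) :
  c ⊙ (d ⊙ i) ⊙ k = 0 -> c ⊙ (d ⊙ (i ⊙ k)) = 0 by rewrite !pcompA.
by apply: h; apply: (proj1 (kerP _)).
Qed.

Lemma zkerP n a b Z (x : Z ~> K n) :
  through (zker_in n a b) x <->
  through (fl_in (K n) a) x /\ forall m, through (fl_in (K m) b) (dif K n m ⊙ x).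
Proof.
split=> [[y <-]|[[y <-] hb]].
  split; first by exists (kerm _ ⊙ y); rewrite pcompA.
  move=> m; case: (eqVneq m (n + 1)) => [->|ne]; last first.
    by rewrite dif_shape // pcomp0m; apply: through0.
  apply/through_mono; first exact: fl_mono.
  by rewrite 2!pcompA -(pcompA _ (dif _ _ _)) zker_dif pcomp0m.
have e := proj1 (through_mono _ (@fl_mono (K (n + 1)) b)) (hb (n + 1)).
have : through (kerm (cokerm (fl_in (K (n + 1)) b) ⊙
         (dif K n (n + 1) ⊙ fl_in (K n) a))) y.
  by apply/through_ker; rewrite -!pcompA.
by case=> z <-; exists z; apply: esym; apply: pcompA.
Qed.

Lemma zker_self n a b :
  through (fl_in (K n) a) (zker_in n a b) /\
  forall m, through (fl_in (K m) b) (dif K n m ⊙ zker_in n a b).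
Proof. by apply/zkerP; exists (pidm _); rewrite pcompm1. Qed.

Local Notation r' := (r%:Z).

Lemma page_in_subproof n p : through (zker_in n (- p) (- p - r'))
  (zker_in n (- p - 1) (- p - r')).
Proof.
have [h1 h2] := zker_self n (- p - 1) (- p - r').
apply/zkerP; split=> //; apply: through_trans h1.
by apply: fl_incr; rewrite lerBlDr lerDl.
Qed.

Lemma page_dif_subproof m n p : through (zker_in n (- p) (- p - r'))
  (dif K m n ⊙ zker_in m (- p + r' - 1) (- p)).
Proof.
have [h1 h2] := zker_self m (- p + r' - 1) (- p).
apply/zkerP; split=> // k; rewrite pcompA dif_dif pcomp0m.
exact: through0.
Qed.

(* With F^p = W_(-p) and Z_r^p = F^p K^n \cap d^-1 (F^(p+r) K^(n+1)), the sum
   map Z_(r-1)^(p+1) + Z_(r-1)^(p-r+1) -> Z_r^p, the inclusion on the first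
   summand and the differential on the second one. *)
Definition page_bound_ob (n p : int) (b : bool) : A :=
  if b then zker_ob n (- p - 1) (- p - r')
  else zker_ob (n - 1) (- p + r' - 1) (- p).

Definition page_bound (n p : int) :
    bip (page_bound_ob n p) ~> zker_ob n (- p) (- p - r') :=
  bcotuple (fun b => match b return page_bound_ob n p b ~> _ with
    | true => projT1 (boolp.cid (page_in_subproof n p))
    | false => projT1 (boolp.cid (page_dif_subproof (n - 1) n p))
    end).

(* Z_r^p / (Z_(r-1)^(p+1) + d Z_(r-1)^(p-r+1)) in total degree n. *)
Definition page_n (n p : int) : subquotient (K n) :=
  Subquotient (@zker_mono n (- p) (- p - r'))
    (cokernel_epi (cokerP (page_bound n p))).

Lemma page_bound0 n p Z (h : zker_ob n (- p) (- p - r') ~> Z) :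
  (forall y : zker_ob n (- p - 1) (- p - r') ~> _,
     zker_in n (- p) (- p - r') ⊙ y = zker_in n (- p - 1) (- p - r') ->
     h ⊙ y = 0) ->
  (forall y : zker_ob (n - 1) (- p + r' - 1) (- p) ~> _,
     zker_in n (- p) (- p - r') ⊙ y
       = dif K (n - 1) n ⊙ zker_in (n - 1) (- p + r' - 1) (- p) ->
     h ⊙ y = 0) ->
  h ⊙ page_bound n p = 0.
Proof.
move=> h1 h2; apply: bip_ext_in => b; rewrite -pcompA bcotuple_in pcomp0m.
case: b.
  exact: h1 (projT2 (boolp.cid (page_in_subproof n p))).
exact: h2 (projT2 (boolp.cid (page_dif_subproof (n - 1) n p))).
Qed.

Lemma page_pr0_in n p Z (y : Z ~> zker_ob n (- p) (- p - r')) :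
  through (zker_in n (- p - 1) (- p - r')) (zker_in n (- p) (- p - r') ⊙ y) ->
  sq_pr (page_n n p) ⊙ y = 0.
Proof.
case=> x ex; have [z ez] : through (page_bound n p) y.
  exists (bin (page_bound_ob n p) true ⊙ x); rewrite pcompA bcotuple_in.
  apply: (@zker_mono n (- p) (- p - r')); rewrite pcompA -ex; congr (_ ⊙ _).
  exact: projT2 (boolp.cid (page_in_subproof n p)).
by rewrite -ez pcompA /= (proj1 (cokerP _)) pcomp0m.
Qed.

Lemma page_pr0_dif n p m Z (y : Z ~> zker_ob n (- p) (- p - r')) (x : Z ~> K m) :
  dif K m n ⊙ x = zker_in n (- p) (- p - r') ⊙ y ->
  through (zker_in m (- p + r' - 1) (- p)) x ->
  sq_pr (page_n n p) ⊙ y = 0.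
Proof.
case: (eqVneq n (m + 1)) => [en|ne].
  have em : m = n - 1 by rewrite en addrK.
  clear en; subst m => e [x' ex]; have [z ez] : through (page_bound n p) y.
    exists (bin (page_bound_ob n p) false ⊙ x'); rewrite pcompA bcotuple_in.
    apply: (@zker_mono n (- p) (- p - r')); rewrite pcompA -e -ex pcompA.
    congr (_ ⊙ _).
    exact: projT2 (boolp.cid (page_dif_subproof (n - 1) n p)).
  by rewrite -ez pcompA /= (proj1 (cokerP _)) pcomp0m.
rewrite dif_shape // pcomp0m => e _.
have -> : y = 0 by apply: (@zker_mono n (- p) (- p - r')); rewrite -e pcompm0.
exact: pcompm0.
Qed.

Lemma page_d_ex n p n' p' : p' = p + r' ->
  exists h, @induces A _ _ (page_n n p) (page_n n' p') (dif K n n') h.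
Proof.
move=> ep; have [_ hz] := zker_self n (- p) (- p - r').
have ea : - p' = - p - r' by rewrite ep opprD.
have [y ey] : through (zker_in n' (- p') (- p' - r'))
    (dif K n n' ⊙ zker_in n (- p) (- p - r')).
  apply/zkerP; split; first by rewrite ea.
  by move=> m; rewrite pcompA dif_dif pcomp0m; apply: through0.
have e0 : (sq_pr (page_n n' p') ⊙ y) ⊙ page_bound n p = 0.
  apply: page_bound0 => z ez; rewrite -pcompA.
    apply: (@page_pr0_dif _ _ n _ _ (zker_in n (- p - 1) (- p - r'))).
      by rewrite [RHS]pcompA ey -ez pcompA.
    by rewrite ea subrK; exists (pidm _); rewrite pcompm1.
  have -> : y ⊙ z = 0; last exact: pcompm0.
  apply: (@zker_mono n' (- p') (- p' - r')).
  by rewrite pcompA ey -pcompA ez pcompA dif_dif pcomp0m pcompm0.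
have [h [eh _]] := proj2 (cokerP (page_bound n p)) _ _ e0.
by exists h, y.
Qed.

(* E_r^{p,q} as a subquotient of K^(p+q). *)
Definition page (p q : int) : subquotient (K (p + q)) := page_n (p + q) p.

(* The differential d_r. The degree q' is left free: d_r vanishes unless
   p' + q' = p + q + 1, that is, unless q' = q - r + 1. *)
Definition page_d (p q p' q' : int) (ep : p' = p + r') : page p q ~> page p' q' :=
  projT1 (boolp.cid (page_d_ex (p + q) (p' + q') ep)).

Lemma page_dP p q p' q' (ep : p' = p + r') :
  induces (dif K (p + q) (p' + q')) (page_d q q' ep).
Proof. exact: projT2 (boolp.cid (page_d_ex (p + q) (p' + q') ep)). Qed.

Lemma page_dd p q p' q' p'' q'' (e : p' = p + r') (e' : p'' = p' + r') :
  page_d q' q'' e' ⊙ page_d q q' e = 0.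
Proof.
apply: (induces_unique (induces_comp (page_dP q q' e) (page_dP q' q'' e'))).
by rewrite dif_dif; apply: induces0.
Qed.

(* The cohomology of (E_r, d_r) at E_r^{p,q}, for
   E_r^{p-r,q+r-1} -> E_r^{p,q} -> E_r^{p+r,q-r+1}. *)
Definition page_coh (p q : int) : subquotient (page p q) :=
  cohomology (page_dd (q + r' - 1) q (q - r' + 1) (esym (subrK r' p)) (erefl (p + r'))).

End Page.

Section PageMap.
Variables (r : nat) (K L : fcomplex) (f : fmorphism K L).

Lemma zker_map n a b :
  through (zker_in L n a b) (f n ⊙ zker_in K n a b).
Proof.
have [h1 h2] := zker_self K n a b.
have hf m c Z (x : Z ~> K m) : through (fl_in (K m) c) x ->
    through (fl_in (L m) c) (f m ⊙ x).
  by case=> y <-; rewrite pcompA; apply: through_comp; apply: fm_filtered.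
apply/zkerP; split; first exact: hf.
by move=> m; rewrite pcompA -fm_dif -pcompA; apply: hf.
Qed.

Lemma page_map_ex p q :
  exists h, @induces A _ _ (page r K p q) (page r L p q) (f (p + q)) h.
Proof.
rewrite /page; move: (p + q) => n.
have [y ey] := zker_map n (- p) (- p - r%:Z).
have e0 : (sq_pr (page_n r L n p) ⊙ y) ⊙ page_bound r K n p = 0.
  apply: page_bound0 => z ez; rewrite -pcompA.
    apply: page_pr0_in; rewrite pcompA ey -pcompA ez.
    exact: zker_map.
  apply: (@page_pr0_dif _ _ _ _ (n - 1) _ _
    (f (n - 1) ⊙ zker_in K (n - 1) (- p + r%:Z - 1) (- p))).
    by rewrite [RHS]pcompA ey -[RHS]pcompA ez [LHS]pcompA -fm_dif [RHS]pcompA.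
  exact: zker_map.
have [h [eh _]] := proj2 (cokerP (page_bound r K n p)) _ _ e0.
by exists h, y.
Qed.

Definition page_map (p q : int) : page r K p q ~> page r L p q :=
  projT1 (boolp.cid (page_map_ex p q)).

Lemma page_mapP p q : induces (f (p + q)) (page_map p q).
Proof. exact: projT2 (boolp.cid (page_map_ex p q)). Qed.

Lemma page_map_d p q p' q' (e : p' = p + r%:Z) :
  page_map p' q' ⊙ page_d K q q' e = page_d L q q' e ⊙ page_map p q.
Proof.
apply: (induces_unique (induces_comp (page_dP K q q' e) (page_mapP p' q'))).
rewrite fm_dif.
exact: (induces_comp (page_mapP p q) (page_dP L q q' e)).
Qed.

Lemma page_coh_map_ex p q :
  exists h, induces (S := page_coh r K p q) (S' := page_coh r L p q)
    (page_map p q) h.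
Proof. by apply: cohomology_map_ex; apply: page_map_d. Qed.

Definition page_coh_map (p q : int) : page_coh r K p q ~> page_coh r L p q :=
  projT1 (boolp.cid (page_coh_map_ex p q)).

Lemma page_coh_mapP p q : induces (page_map p q) (page_coh_map p q).
Proof. exact: projT2 (boolp.cid (page_coh_map_ex p q)). Qed.

End PageMap.

Definition Er_quasi_iso (r : nat) : morphism_class CplusF :=
  fun (K L : fcomplex) (f : fmorphism K L) =>
    forall p q, is_iso (page_coh_map r f p q).

End FilteredComplexes.

Section Shift.
Variable A : abelian.

(* The identity of K i, read as a morphism K i -> K j for i = j. *)
Definition shift (K : fcomplex A) (i j : int) : K i ~> K j :=
  match i =P j with
  | ReflectT e => match e in _ = k return K i ~> K k with erefl => pidm (K i) end
  | ReflectF _ => 0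
  end.

Lemma shift_id (K : fcomplex A) i : shift K i i = pidm (K i).
Proof. by rewrite /shift; case: eqP => // e; rewrite (eq_irrelevance e erefl). Qed.

Lemma shift_ne (K : fcomplex A) i j : i != j -> shift K i j = 0.
Proof. by rewrite /shift; case: eqP. Qed.

Lemma shift_nat (K L : fcomplex A) (f : fmorphism K L) i j :
  f j ⊙ shift K i j = shift L i j ⊙ f i.
Proof.
case: (eqVneq i j) => [<-|ne]; first by rewrite !shift_id pcompm1 pcomp1m.
by rewrite !shift_ne // pcompm0 pcomp0m.
Qed.

Lemma shift_filtered (K : fcomplex A) i j : filtered_map (shift K i j).
Proof.
case: (eqVneq i j) => [<-|ne]; first by rewrite shift_id; apply: filtered_map1.
by rewrite shift_ne // => p; rewrite pcomp0m; apply: through0.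
Qed.

Lemma shift_comp (K : fcomplex A) i j k : i = j ->
  shift K j k ⊙ shift K i j = shift K i k.
Proof. by move=> <-; rewrite shift_id pcompm1. Qed.

Lemma dif_shift (K : fcomplex A) i j k :
  dif K j k ⊙ shift K i j = shift K (j + 1) k ⊙ dif K i (j + 1).
Proof.
case: (eqVneq i j) => [<-|ne]; last first.
  rewrite shift_ne // pcompm0 (@dif_shape _ K i (j + 1)) ?pcompm0 //.
  by rewrite (inj_eq (addIr _)) eq_sym.
rewrite shift_id pcompm1; case: (eqVneq (i + 1) k) => [<-|ne].
  by rewrite shift_id pcomp1m.
by rewrite shift_ne // pcomp0m dif_shape // eq_sym.
Qed.

Lemma through_sum (W X Z : A) (i : W ~> X) (I : finType) (x : I -> Z ~> X) :
  (forall t, through i (x t)) -> through i (\sum_t x t).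
Proof.
move=> h; apply: big_ind => [|y z [y' <-] [z' <-]|t _]; [exact: through0| |exact: h].
by exists (y' + z'); rewrite pcompDr.
Qed.

Lemma throughD (W X Z : A) (i : W ~> X) (x y : Z ~> X) :
  through i x -> through i y -> through i (x + y).
Proof. by case=> x' <- [y' <-]; exists (x' + y'); rewrite pcompDr. Qed.

Lemma throughM (W X Z : A) (i : W ~> X) (x : Z ~> X) n :
  through i x -> through i (x *~ n).
Proof. by case=> x' <-; exists (x' *~ n); rewrite pcompMr. Qed.

End Shift.

Lemma sle_deg P (a b : sob P) : sle a b -> (sdeg a <= sdeg b)%N.
Proof.
elim: P a b => [|S P IH] //= [a1 a2] [b1 b2] /= /andP[h1 /IH h2].
apply: leq_add => //; rewrite -!subn1 leq_sub2r //.
exact: subset_leq_card.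
Qed.

Section Simple.
Variables (A : abelian) (r : nat).

Section Object.
Variables (P : shape) (X : diagram (CplusF A) P).

Definition cx (a : sob P) : fcomplex A := X a.

(* X(a <= b) in degree i, or 0 if a <= b does not hold. *)
Definition cx_map (a b : sob P) (i : int) : cx a i ~> cx b i :=
  match sle a b =P true with
  | ReflectT h => (dmap X h : fmorphism (cx a) (cx b)) i
  | ReflectF _ => 0
  end.

Lemma cx_mapE a b i (h : sle a b) :
  cx_map a b i = (dmap X h : fmorphism (cx a) (cx b)) i.
Proof. by rewrite /cx_map; case: eqP => // h'; rewrite (bool_irrelevance h h'). Qed.

Lemma cx_map0 a b i : ~~ sle a b -> cx_map a b i = 0.
Proof. by rewrite /cx_map; case: eqP => // e; rewrite e. Qed.

Lemma cx_map_comp a b c i : sle a b -> sle b c ->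
  cx_map b c i ⊙ cx_map a b i = cx_map a c i.
Proof.
move=> h k; have l := sle_trans h k.
by rewrite (cx_mapE _ h) (cx_mapE _ k) (cx_mapE _ l) -(dmap_comp X h k l).
Qed.

Lemma cx_map1 a i : cx_map a a i = pidm (cx a i).
Proof. by rewrite (cx_mapE _ (sle_refl a)) dmap1. Qed.

Definition sdegree (n : int) (a : sob P) : int := n - (sdeg a)%:Z.

Definition simple_ob (n : int) : A := bip (fun a => cx a (sdegree n a)).

Definition simple_sub (n p : int) : A :=
  bip (fun a => fl_sub (cx a (sdegree n a)) (p + (r * sdeg a)%N%:Z)).

Definition simple_in (n p : int) : simple_sub n p ~> simple_ob n :=
  btuple (fun a => fl_in (cx a (sdegree n a)) (p + (r * sdeg a)%N%:Z) ⊙ bpr _ a).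

Lemma bpr_simple_in n p a : bpr _ a ⊙ simple_in n p
  = fl_in (cx a (sdegree n a)) (p + (r * sdeg a)%N%:Z) ⊙ bpr _ a.
Proof. exact: bpr_tuple. Qed.

Lemma simple_mono n p : is_mono (simple_in n p).
Proof.
move=> Z g h e; apply: bip_ext_pr => a.
apply: (@fl_mono _ (cx a (sdegree n a)) (p + (r * sdeg a)%N%:Z)).
by rewrite !pcompA -!bpr_simple_in -!pcompA e.
Qed.

Lemma simple_through n p Z (x : Z ~> simple_ob n) :
  (forall a, through (fl_in (cx a (sdegree n a)) (p + (r * sdeg a)%N%:Z))
               (bpr _ a ⊙ x)) ->
  through (simple_in n p) x.
Proof.
move=> h; exists (btuple (fun a => projT1 (boolp.cid (h a)))).
apply: bip_ext_pr => a; rewrite pcompA bpr_simple_in -pcompA bpr_tuple.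
exact: projT2 (boolp.cid (h a)).
Qed.

Lemma simple_incr n p q : p <= q -> through (simple_in n q) (simple_in n p).
Proof.
move=> pq; apply: simple_through => a; rewrite bpr_simple_in.
by apply: through_comp; apply: fl_incr; rewrite lerD2r.
Qed.

Definition simple_filtered (n : int) : filtered A :=
  Filtered (@simple_mono n) (@simple_incr n).

Definition coef (K : fcomplex A) (i j s e : int) : K i ~> K j :=
  dif K i j *~ s + shift K i j *~ e.

(* The component X^a -> X^b of the differential. It is (-1)^|a| d for a = b, and
   the incidence number of a and b times X(a <= b) for |b| = |a| + 1. *)
Definition simple_comp (n m : int) (a b : sob P) :
    cx a (sdegree n a) ~> cx b (sdegree m b) :=
  coef (cx b) (sdegree n a) (sdegree m b) ((a == b)%:R * (-1) ^+ sdeg a)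
    (sinc a b) ⊙ cx_map a b (sdegree n a).

Definition simple_dif (n m : int) : simple_filtered n ~> simple_filtered m :=
  btuple (fun b => \sum_a simple_comp n m a b ⊙ bpr _ a).

Lemma coef_filtered K i j s e : filtered_map (coef K i j s e).
Proof.
move=> p; rewrite pcompDl !pcompMl.
by apply: throughD; apply: throughM; [apply: dif_filtered|apply: shift_filtered].
Qed.

Lemma simple_dif_filtered n m : filtered_map (simple_dif n m).
Proof.
move=> p; apply: simple_through => b; rewrite pcompA bpr_tuple pcomp_suml.
apply: through_sum => a; rewrite -pcompA bpr_simple_in pcompA.
apply: through_comp; rewrite /simple_comp.
case: (boolP (sle a b)) => h; last first.
  by rewrite cx_map0 // pcompm0 pcomp0m; apply: through0.
rewrite -pcompA (cx_mapE _ h).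
have [y <-] := fm_filtered (dmap X h : fmorphism (cx a) (cx b)) (sdegree n a)
  (p + (r * sdeg a)%N%:Z).
rewrite pcompA; apply: through_comp.
have [z <-] := @coef_filtered (cx b) (sdegree n a) (sdegree m b)
  ((a == b)%:R * (-1) ^+ sdeg a) (sinc a b) (p + (r * sdeg a)%N%:Z).
apply: through_comp; apply: fl_incr; rewrite lerD2l lez_nat.
by rewrite leq_mul2l sle_deg ?orbT.
Qed.

Lemma simple_dif_shape n m : m != n + 1 -> simple_dif n m = 0.
Proof.
move=> ne; apply: bip_ext_pr => b; rewrite bpr_tuple pcompm0 big1 // => a _.
suff -> : simple_comp n m a b = 0 by rewrite pcomp0m.
rewrite /simple_comp /coef; case: (eqVneq a b) => [<-|_]; last first.
  rewrite mul0r mulr0z add0r; case: (eqVneq (sinc a b) 0) => [->|].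
    by rewrite mulr0z pcomp0m.
  case/sincP => _ e; rewrite shift_ne ?mul0rz ?pcomp0m //.
  apply: contraNneq ne; rewrite /sdegree e => e'.
  by rewrite -[m](subrK (sdeg a).+1%:Z) -e' -addn1 PoszD addrA subrK.
rewrite dif_shape.
  rewrite mul0rz add0r; case: (eqVneq (sinc a a) 0) => [->|].
    by rewrite mulr0z pcomp0m.
  by case/sincP => _ /eqP; rewrite -addn1 -[X in X == _]addn0 eqn_add2l.
by rewrite /sdegree addrAC (inj_eq (addIr _)).
Qed.

Lemma coef_nat (K L : fcomplex A) (f : fmorphism K L) i j s e :
  f j ⊙ coef K i j s e = coef L i j s e ⊙ f i.
Proof.
by rewrite pcompDr pcompDl !pcompMr !pcompMl fm_dif shift_nat.
Qed.

Lemma cx_map_coef a b i j s e :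
  cx_map a b j ⊙ coef (cx a) i j s e = coef (cx b) i j s e ⊙ cx_map a b i.
Proof.
case: (boolP (sle a b)) => h; last by rewrite !cx_map0 // pcomp0m pcompm0.
rewrite !(cx_mapE _ h); exact: coef_nat.
Qed.

Lemma simple_comp_comp n m k a c :
  \sum_b simple_comp m k b c ⊙ simple_comp n m a b = 0.
Proof.
pose s (x : sob P) : int := (-1) ^+ sdeg x.
pose K := cx c; pose i := sdegree n a; pose l := sdegree k c.
pose T b := cx_map b c i ⊙ cx_map a b i.
have E b : simple_comp m k b c ⊙ simple_comp n m a b =
   (dif K (sdegree m b) l ⊙ shift K i (sdegree m b)) ⊙ T b
      *~ (sinc a b * ((b == c)%:R * s b))
   + (shift K (sdegree m b) l ⊙ dif K i (sdegree m b)) ⊙ T b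
      *~ ((a == b)%:R * s a * sinc b c)
   + (shift K (sdegree m b) l ⊙ shift K i (sdegree m b)) ⊙ T b
      *~ (sinc a b * sinc b c).
  rewrite /simple_comp -pcompA (pcompA (cx_map b c _)) cx_map_coef -pcompA pcompA.
  rewrite -/(T b) /coef pcompDl !pcompDr !pcompMl !pcompMr dif_dif !mul0rz add0r.
  rewrite pcompDl [X in _ + X]pcompDl !pcompMl -!mulrzA -addrA.
  by [].
rewrite (eq_bigr _ (fun b _ => E b)) !big_split /=.
have -> : \sum_b (shift K (sdegree m b) l ⊙ shift K i (sdegree m b)) ⊙ T b
    *~ (sinc a b * sinc b c) = 0.
  pose j := m - (sdeg a).+1%:Z.
  transitivity (\sum_b (shift K j l ⊙ shift K i j) ⊙ cx_map a c i
      *~ (sinc a b * sinc b c)).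
    apply: eq_bigr => b _; case: (eqVneq (sinc a b) 0) => [->|h1].
      by rewrite mul0r !mulr0z.
    case: (eqVneq (sinc b c) 0) => [->|h2]; first by rewrite mulr0 !mulr0z.
    have [ab db] := sincP h1; have [bc _] := sincP h2.
    by rewrite /T cx_map_comp // /sdegree db.
  by rewrite -mulrz_sumr sinc_sinc mulr0z.
rewrite (bigD1 c) //= big1 => [|b /negbTE nbc]; last first.
  by rewrite nbc mul0r mulr0 mulr0z.
rewrite (bigD1 a) //= big1 => [|b]; last first.
  by rewrite eq_sym => /negbTE nba; rewrite nba !mul0r mulr0z.
rewrite !eqxx !mul1r !addr0 /T !cx_map1 pcomp1m pcompm1.
case: (eqVneq (sinc a c) 0) => [->|/sincP[_ dc]].
  by rewrite mul0r mulr0 !mulr0z addr0.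
rewrite dif_shift.
have -> : sdegree m c + 1 = sdegree m a.
  by rewrite /sdegree dc -addn1 PoszD opprD addrA subrK.
rewrite -mulrzDr /s dc exprS mulN1r mulrN [_ * sinc a c]mulrC addNr.
exact: mulr0z.
Qed.

Lemma simple_dif_dif n m k : simple_dif m k ⊙ simple_dif n m = 0.
Proof.
apply: bip_ext_pr => c; rewrite pcompA bpr_tuple pcompm0 pcomp_suml.
transitivity (\sum_b \sum_a
    (simple_comp m k b c ⊙ simple_comp n m a b) ⊙ bpr _ a).
  apply: eq_bigr => b _; rewrite -pcompA bpr_tuple pcomp_sumr.
  by apply: eq_bigr => a _; rewrite pcompA.
rewrite exchange_big big1 //= => a _.
by rewrite -pcomp_suml simple_comp_comp pcomp0m.
Qed.

Lemma simple_bounded : exists N, forall n, n < N -> is_zero (simple_filtered n).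
Proof.
have [N hN] := boolp.choice (fun a => fc_bounded (cx a)).
exists (- \sum_a `|N a|) => n hn.
have h0 : pidm (simple_ob n) = 0.
  rewrite /simple_ob -bin_pr big1 // => a _.
  have na : sdegree n a < N a.
    apply: le_lt_trans (lt_le_trans hn _); first by rewrite lerBlDr lerDl.
    apply: le_trans (lerNnormlW _); last exact: lexx.
    by rewrite lerN2 (bigD1 a) //= lerDl sumr_ge0.
  by rewrite (proj2 (hN a _ na _) (bpr _ a)) pcompm0.
move=> Y; split=> f.
  by rewrite -[f](pcompm1 (f : simple_ob n ~> Y)) h0 pcompm0.
by rewrite -[f](pcomp1m (f : Y ~> simple_ob n)) h0 pcomp0m.
Qed.

Definition simple_complex : fcomplex A :=
  FComplex simple_dif_filtered simple_dif_shape simple_dif_dif simple_bounded.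

End Object.

Section Morphism.
Variables X Y : codiag (CplusF A).
Variable f : codiag_hom X Y.

Local Notation d := (ch_pi f).
Let fc b : fmorphism (cx X (d b)) (cx Y b) := f b.

Lemma sdegree_pi n b : sdegree n (d b) = sdegree n b.
Proof. by rewrite /sdegree pi_deg. Qed.

(* The component on Y^b is, up to the sign of d, the composite of the projection
   to X^(d b) and of f_b; shift accounts for |d b| = |b|. *)
Definition simple_fm (n : int) : simple_complex X n ~> simple_complex Y n :=
  btuple (fun b => (shift (cx Y b) (sdegree n (d b)) (sdegree n b)
    ⊙ (fc b (sdegree n (d b))
       ⊙ bpr (fun a => cx X a (sdegree n a)) (d b))) *~ ssgn (pi_inj d) b).

Lemma simple_fm_filtered n : filtered_map (simple_fm n).
Proof.
move=> p; apply: simple_through => b; rewrite pcompA bpr_tuple pcompMl.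
apply: throughM; rewrite -!pcompA bpr_simple_in.
have [y ey] := fm_filtered (fc b) (sdegree n (d b)) (p + (r * sdeg (d b))%N%:Z).
rewrite (pcompA (fc b _)) -ey !pcompA; do 2 apply: through_comp.
rewrite pi_deg; exact: shift_filtered.
Qed.

Lemma shift_coef (K : fcomplex A) i j i' j' s e : i = i' -> j = j' ->
  shift K j j' ⊙ coef K i j s e = coef K i' j' s e ⊙ shift K i i'.
Proof. by move=> <- <-; rewrite !shift_id pcomp1m pcompm1. Qed.

Lemma coefM (K : fcomplex A) i j s e t :
  coef K i j s e *~ t = coef K i j (s * t) (e * t).
Proof. by rewrite /coef mulrzDl -!mulrzA. Qed.

Lemma simple_fm_comp n m b b' :
  (shift (cx Y b') (sdegree m (d b')) (sdegree m b')
    ⊙ (fc b' (sdegree m (d b')) ⊙ simple_comp X n m (d b) (d b')))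
    *~ ssgn (pi_inj d) b'
  = (simple_comp Y n m b b'
     ⊙ (shift (cx Y b) (sdegree n (d b)) (sdegree n b)
        ⊙ fc b (sdegree n (d b)))) *~ ssgn (pi_inj d) b.
Proof.
have fX i : fc b' i ⊙ cx_map X (d b) (d b') i = cx_map Y b b' i ⊙ fc b i.
  case: (boolP (sle b b')) => h; last first.
    by rewrite !cx_map0 ?pi_le // pcompm0 pcomp0m.
  rewrite (cx_mapE _ _ h) (cx_mapE _ _ (pi_mono d h)).
  exact: (congr1 (fun g : fmorphism (cx X (d b)) (cx Y b') => g i) (ch_nat f h)).
have sX i j : cx_map Y b b' j ⊙ shift (cx Y b) i j
    = shift (cx Y b') i j ⊙ cx_map Y b b' i.
  case: (boolP (sle b b')) => h; last by rewrite !cx_map0 // pcompm0 pcomp0m.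
  by rewrite !(cx_mapE _ _ h) shift_nat.
rewrite /simple_comp [X in (_ ⊙ X) *~ _]pcompA coef_nat -[X in _ ⊙ X]pcompA fX.
rewrite pcompA (shift_coef _ _ _ (sdegree_pi n b) (sdegree_pi m b')).
rewrite -!pcompA (pcompA (cx_map Y b b' _)) sX -!pcompA -!pcompMl.
congr (_ ⊙ _); rewrite !coefM !pi_deg; congr coef.
  rewrite !pi_funE (inj_eq (@injs_act_inj _ _ _)).
  by case: (eqVneq b b') => [->|] //; rewrite !mul0r.
by rewrite !pi_funE sinc_act mulrC.
Qed.

Lemma simple_fm_dif n m :
  simple_fm m ⊙ dif (simple_complex X) n m
  = dif (simple_complex Y) n m ⊙ simple_fm n.
Proof.
apply: bip_ext_pr => b'; rewrite !pcompA !bpr_tuple pcomp_suml pcompMl.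
pose G a := (shift (cx Y b') (sdegree m (d b')) (sdegree m b')
  ⊙ (fc b' (sdegree m (d b')) ⊙ (simple_comp X n m a (d b')
     ⊙ bpr (fun a => cx X a (sdegree n a)) a))) *~ ssgn (pi_inj d) b'.
transitivity (\sum_a G a).
  by rewrite -2!pcompA bpr_tuple 2!pcomp_sumr mulrz_suml.
have G0 a : a \notin d @: setT -> G a = 0.
  move=> ha; suff e : simple_comp X n m a (d b') = 0.
    by rewrite /G e pcomp0m !pcompm0 mul0rz.
  rewrite /simple_comp cx_map0 ?pcompm0 //; apply: contra ha.
  rewrite pi_funE => /sle_act[b ->]; apply/imsetP; exists b => //.
  by rewrite pi_funE.
rewrite (bigID (mem (d @: setT))) /= [X in _ + X]big1 // addr0.
rewrite big_imset /=; last first.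
  by move=> x y _ _; rewrite !pi_funE => /injs_act_inj.
apply: eq_big => [b|b _]; first by rewrite inE.
rewrite /G -[RHS]pcompA bpr_tuple pcompMr 2!pcompA -pcompMl -[X in X *~ _]pcompA.
rewrite simple_fm_comp pcompMl; congr (_ *~ _).
by rewrite -!pcompA.
Qed.

Definition simple_mor : fmorphism (simple_complex X) (simple_complex Y) :=
  FMorphism simple_fm_filtered simple_fm_dif.

End Morphism.

Lemma simple_mor_id (X : CoDiag (CplusF A)) :
  simple_mor (codiag_id X) = fmor_id (simple_complex X).
Proof.
apply: fmorphism_eq => n /=; apply: bip_ext_pr => b.
by rewrite bpr_tuple pcompm1 ssgn_id shift_id !pcomp1m.
Qed.

Lemma simple_mor_comp (X Y Z : CoDiag (CplusF A)) (g : codiag_hom Y Z)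
    (f : codiag_hom X Y) :
  simple_mor (codiag_comp g f) = fmor_comp (simple_mor g) (simple_mor f).
Proof.
apply: fmorphism_eq => n /=; apply: bip_ext_pr => c.
rewrite bpr_tuple [RHS]pcompA bpr_tuple pcompMl -[X in _ = X *~ _]pcompA.
rewrite -[X in _ = (_ ⊙ X) *~ _]pcompA bpr_tuple !pcompMr ssgn_comp -pi_funE mulrzA.
congr (_ *~ _ *~ _).

rewrite (pcompA _ (shift _ _ _)) shift_nat !pcompA.
by rewrite shift_comp // sdegree_pi.
Qed.

Definition simple_functor : functor (CoDiag (CplusF A)) (CplusF A) :=
  @Functor (CoDiag (CplusF A)) (CplusF A) (fun X => simple_complex X)
    simple_mor simple_mor_id simple_mor_comp.

End Simple.

(* Main.v *)
From mathcomp Require Import all_boot all_order all_algebra.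
From mathcomp Require Import boolp zify.
Require Import Defs.

Set Implicit Arguments.
Unset Strict Implicit.
Unset Printing Implicit Defensive.

Import Order.TTheory GRing.Theory Num.Theory.
Local Open Scope ring_scope.

(** The class of E_r-quasi-isomorphisms is the class of morphisms inverted by
the functor E_(r+1), viewed as a family of additive functors to the abelian
category.  This alone makes it saturated (Er_saturated) and stable under
products (Er_stable).  Products themselves are computed degreewise.  The other
axioms are about the simple complex s^r(X), the direct sum of the X^a with
degrees shifted by |a| and weights shifted by r|a|.  The shift is chosen so that
the maps X^a -> X^b of the diagram, with |b| = |a| + 1, lower the weight by r:
up to terms that drop the weight by r, the differential of s^r(X) is the sum of
the signed differentials of the X^a (simple_dif_sinj), and the maps of the
diagram first enter in d_r.

Arguments with elements are made in an arbitrary abelian category by taking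
morphisms T ~> X for elements of X, and by reading every existence assertion as
existence after an epimorphism T' ~> T.  In this language f : K -> L is an
E_r-quasi-isomorphism if and only if it is injective and surjective on the
classes of the elements x of W_p with dx in W_(p-r-1), taken modulo
W_(p-1) + d W_(p+r).  These two properties together say that E_(r+1) of the
r-cone of f vanishes; cone_acyclic is this condition written out, and
Er_quasi_isoP is the equivalence.

Exactness (simple_cone_acyclic) is then an elimination: if f is pointwise
cone-acyclic and (x, y) is a cycle of the cone of s^r(f), pick a vertex a of
least degree in the support of (x, y).  The component at a is a cycle of the
cone of f_a, hence a boundary up to lower weight; subtracting the boundary and
the remainder, both extended by zero to s^r, removes a from the support and
only changes components at larger vertices.

Acyclicity (Er_acyclicity) holds because s^r of B -> C <- 0 is, up to signs,
the r-cone of B -> C.  The remaining comparison maps are isomorphisms of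
filtered complexes up to degree bookkeeping: s^r(X x Y) is a product since s^r
is additive, the extension by zero of a diagram adds zero summands and permutes
the others with a sign (Er_simple_mor_iso), and mu regroups the double sum over
(a, b), the Koszul signs in the differential matching on both sides (sinc_cat,
mu_dif).  Finally lambda sends B diagonally to the vertices of degree 0; it
commutes with the differentials because the two ends of every edge contribute
with opposite signs (sinc_vertices). *)

(** * Identities in abelian groups *)

(** Formal sums.  Two of them have the same value in every abelian group as
soon as their integer coefficients agree, which is decided by computation; the
tactic zmodule reifies both sides of an equation and runs this test. *)
Inductive zexp := ZAtom of nat | ZZero | ZAdd of zexp & zexp | ZOpp of zexp.

Fixpoint zeval (V : zmodType) (env : seq V) (e : zexp) : V :=
  match e with
  | ZAtom i => env`_i
  | ZZero => 0
  | ZAdd a b => zeval env a + zeval env b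
  | ZOpp a => - zeval env a
  end.

Fixpoint zcoef (e : zexp) (i : nat) : int :=
  match e with
  | ZAtom j => (i == j)%:Z
  | ZZero => 0
  | ZAdd a b => zcoef a i + zcoef b i
  | ZOpp a => - zcoef a i
  end.

Lemma zevalE (V : zmodType) (env : seq V) e :
  zeval env e = \sum_(0 <= i < size env) env`_i *~ zcoef e i.
Proof.
elim: e => [j||a IHa b IHb|a IHa] /=; rewrite ?IHa ?IHb.
- case: (ltnP j (size env)) => hj; last first.
    rewrite nth_default // big_nat big1 // => i /andP[_ hi].
    by case: eqVneq hi => [->|]; rewrite ?ltnNge ?hj // mulr0z.
  rewrite (bigD1_seq j) ?mem_index_iota ?iota_uniq //= eqxx mulr1z big1 ?addr0 //.
  by move=> i /negbTE ->; rewrite mulr0z.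
- by rewrite big1 // => i _; rewrite mulr0z.
- by rewrite -big_split /=; apply: eq_bigr => i _; rewrite mulrzDr.
- by rewrite -sumrN; apply: eq_bigr => i _; rewrite mulrNz.
Qed.

Lemma zeval_eq (V : zmodType) (env : seq V) e e' :
  all (fun i => zcoef e i == zcoef e' i) (iota 0 (size env)) ->
  zeval env e = zeval env e'.
Proof.
move/allP=> h; rewrite !zevalE; apply: eq_big_nat => i /andP[_ hi].
by rewrite (eqP (h i _)) // mem_iota.
Qed.

Ltac zindex x l :=
  lazymatch l with
  | ?y :: ?t => match goal with
      | _ => let _ := match goal with _ => constr_eq x y end in constr:(0%N)
      | _ => let n := zindex x t in constr:(n.+1)
      end
  end.
Ltac zinsert x l :=
  match goal with
  | _ => let _ := zindex x l in l
  | _ => lazymatch l with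
         | ?y :: ?t => let t' := zinsert x t in constr:(y :: t')
         | _ => constr:(x :: l)
         end
  end.
Ltac zatoms t l :=
  lazymatch t with
  | Algebra.add ?a ?b => let l' := zatoms a l in zatoms b l'
  | Algebra.opp ?a => zatoms a l
  | Algebra.zero => l
  | _ => zinsert t l
  end.
Ltac zquote t l :=
  lazymatch t with
  | Algebra.add ?a ?b => let a' := zquote a l in let b' := zquote b l in constr:(ZAdd a' b')
  | Algebra.opp ?a => let a' := zquote a l in constr:(ZOpp a')
  | Algebra.zero => constr:(ZZero)
  | _ => let n := zindex t l in constr:(ZAtom n)
  end.
Ltac zmodule :=
  lazymatch goal with
  | |- @eq ?T ?u ?v =>
    let l0 := constr:(@nil T) in
    let l1 := zatoms u l0 in
    let l := zatoms v l1 in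
    let a := zquote u l in
    let b := zquote v l in
    exact: (@zeval_eq _ l a b isT)
  end.

(** * Elements up to epimorphic covers *)

Section Covers.
Variable A : abelian.
Implicit Types X Y Z T : A.

Lemma mono_epi_iso X Y (f : X ~> Y) : is_mono f -> is_epi f -> is_iso f.
Proof.
move=> mf ef; have [_ u] := epi_normal ef.
have k0 : kerm f = 0 by apply: mf; rewrite (proj1 (kerP f)) pcompm0.
have [g [gf _]] := u X (pidm X) (etrans (pcomp1m _) k0).
exists g; split=> //; apply: ef.
by rewrite -pcompA gf pcomp1m pcompm1.
Qed.

Lemma is_monoP X Y (f : X ~> Y) :
  (forall T (x : T ~> X), f ⊙ x = 0 -> x = 0) -> is_mono f.
Proof.
move=> h T x y e; apply/eqP; rewrite -subr_eq0; apply/eqP/h.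
by rewrite pcompDr pcompNr e subrr.
Qed.

Lemma is_epiP X Y (f : X ~> Y) :
  (forall Z (h : Y ~> Z), h ⊙ f = 0 -> h = 0) -> is_epi f.
Proof.
move=> h T x y e; apply/eqP; rewrite -subr_eq0; apply/eqP/h.
by rewrite pcompDl pcompNl e subrr.
Qed.

Lemma epi_eq0 X Y Z (e : X ~> Y) (h : Y ~> Z) : is_epi e -> h ⊙ e = 0 -> h = 0.
Proof. by move=> ee he; apply: ee; rewrite he pcomp0m. Qed.

Lemma epi_id X : is_epi (pidm X).
Proof. by move=> Z g h; rewrite !pcompm1. Qed.

Lemma epi_comp X Y Z (g : Y ~> Z) (f : X ~> Y) :
  is_epi g -> is_epi f -> is_epi (g ⊙ f).
Proof. by move=> eg ef T h k; rewrite !pcompA => /ef /eg. Qed.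

(** Pullbacks of epimorphisms are epimorphisms: T' is the pullback of x and g,
the kernel of x - g on the biproduct of T and X. *)
Lemma epi_lift X Y T (g : X ~> Y) (x : T ~> Y) : is_epi g ->
  exists T' (e : T' ~> T) (y : T' ~> X), is_epi e /\ g ⊙ y = x ⊙ e.
Proof.
move=> eg.
pose F (b : bool) := if b then T else X.
pose pT : bip F ~> T := bpr F true.
pose pX : bip F ~> X := bpr F false.
pose iX : X ~> bip F := bin F false.
have pTi : pT ⊙ iX = 0 by apply: (@bpr_in0 A bool F false true).
have pXi : pX ⊙ iX = pidm X by apply: (@bpr_in A bool F false).
pose m := x ⊙ pT - g ⊙ pX.
have mi : m ⊙ iX = - g.
  by rewrite pcompDl pcompNl -!pcompA pTi pXi pcompm0 pcompm1 add0r.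
have em : is_epi m.
  apply: is_epiP => Z h h0; apply: (epi_eq0 eg); apply/eqP.
  by rewrite -oppr_eq0 -pcompNr -mi pcompA h0 pcomp0m.
have [_ u] := epi_normal em.
exists (ker m), (pT ⊙ kerm m), (pX ⊙ kerm m); split; last first.
  apply/eqP; rewrite eq_sym -subr_eq0 !pcompA -pcompNl -pcompDl.
  by rewrite (proj1 (kerP m)).
apply: is_epiP => Z h; rewrite pcompA => /u[t [et _]].
have t0 : t = 0.
  apply: (epi_eq0 eg); apply/eqP; rewrite -oppr_eq0 -pcompNr -mi pcompA et.
  by rewrite -pcompA pTi pcompm0.
have iT : pT ⊙ bin F true = pidm T by apply: (@bpr_in A bool F true).
by rewrite -[h]pcompm1 -iT pcompA -et t0 !pcomp0m.
Qed.

(** Exactness of X -> Y -> coker g on elements: g is an epimorphism onto its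
image k = ker (coker g), because a monomorphism into k through which g factors
is a kernel of a map that vanishes on coker g. *)
Lemma coker_lift X Y T (g : X ~> Y) (y : T ~> Y) : cokerm g ⊙ y = 0 ->
  exists T' (e : T' ~> T) (x : T' ~> X), is_epi e /\ g ⊙ x = y ⊙ e.
Proof.
move=> y0; pose k := kerm (cokerm g).
have [g' eg'] : through k g by apply/through_ker; apply: (proj1 (cokerP g)).
have [y' ey'] : through k y by apply/through_ker.
have mk : is_mono k by apply: kernel_mono (kerP _).
have eg : is_epi g'.
  apply: is_epiP => Z h h0; pose m := kerm h.
  have [g'' eg''] : through m g' by apply/through_ker.
  have mkm : is_mono (k ⊙ m).
    by move=> U a b; rewrite -!pcompA => /mk; apply: (kernel_mono (kerP h)).
  have c0 : cokerm (k ⊙ m) ⊙ g = 0.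
    have -> : cokerm (k ⊙ m) ⊙ g = (cokerm (k ⊙ m) ⊙ (k ⊙ m)) ⊙ g''.
      by rewrite -pcompA -(pcompA k) eg'' eg'.
    by rewrite (proj1 (cokerP (k ⊙ m))) pcomp0m.
  have [t [et _]] := proj2 (cokerP g) _ _ c0.
  have ck : cokerm (k ⊙ m) ⊙ k = 0.
    by rewrite -et -pcompA (proj1 (kerP (cokerm g))) pcompm0.
  have [s es] := proj2 (through_mono k mkm) ck.
  have ms : m ⊙ s = pidm _ by apply: mk; rewrite pcompA es pcompm1.
  by rewrite -[h]pcompm1 -ms pcompA (proj1 (kerP h)) pcomp0m.
have [T' [e [x [ee ex]]]] := epi_lift y' eg.
exists T', e, x; split=> //.
have -> : g ⊙ x = (k ⊙ g') ⊙ x by rewrite eg'.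
by rewrite -pcompA ex pcompA ey'.
Qed.

(** The local reading of an existence assertion about T-valued elements, as for
sheaves, with the epimorphisms onto T as coverings. *)
Definition locally T (Q : forall T', (T' ~> T) -> Prop) : Prop :=
  exists T' (e : T' ~> T), is_epi e /\ Q T' e.

Lemma locally_id T (Q : forall T', (T' ~> T) -> Prop) : Q T (pidm T) -> locally Q.
Proof. by exists T, (pidm T); split=> //; apply: epi_id. Qed.

Lemma locally_comp T (Q : forall T', (T' ~> T) -> Prop) T1 (e1 : T1 ~> T) :
  is_epi e1 -> locally (fun T' e => Q T' (e1 ⊙ e)) -> locally Q.
Proof.
by move=> h [T' [e [ee q]]]; exists T', (e1 ⊙ e); split=> //; apply: epi_comp.
Qed.

Lemma epiP X Y (f : X ~> Y) :
  is_epi f <-> forall T (y : T ~> Y),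
    locally (fun T' e => exists x : T' ~> X, f ⊙ x = y ⊙ e).
Proof.
split=> [ef T y|h].
  by have [T' [e [x [ee ex]]]] := epi_lift y ef; exists T', e; split=> //; exists x.
have [T [e [ee [x ex]]]] := h Y (pidm Y).
apply: is_epiP => Z g g0; apply: (epi_eq0 ee).
by rewrite -[e]pcomp1m -ex pcompA g0 pcomp0m.
Qed.

End Covers.

(** * Elements of the pages of the spectral sequence *)

Section Elements.
Variable A : abelian.

Definition lies (X : filtered A) (p : int) (T : A) (x : T ~> X) : Prop :=
  through (fl_in X p) x.

Section Lies.
Variables (X : filtered A).
Implicit Types (T : A) (p q : int).

Lemma lies0 p T : lies p (0 : T ~> X). Proof. exact: through0. Qed.

Lemma liesD p T (x y : T ~> X) : lies p x -> lies p y -> lies p (x + y).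
Proof. exact: throughD. Qed.

Lemma liesM p T (x : T ~> X) n : lies p x -> lies p (x *~ n).
Proof. exact: throughM. Qed.

Lemma liesN p T (x : T ~> X) : lies p x -> lies p (- x).
Proof. by move=> h; rewrite -[x]mulr1z -mulrNz; apply: liesM. Qed.

Lemma liesB p T (x y : T ~> X) : lies p x -> lies p y -> lies p (x - y).
Proof. by move=> hx hy; apply: liesD => //; apply: liesN. Qed.

Lemma lies_comp p T T' (x : T ~> X) (e : T' ~> T) : lies p x -> lies p (x ⊙ e).
Proof. exact: through_comp. Qed.

Lemma lies_le p q T (x : T ~> X) : p <= q -> lies p x -> lies q x.
Proof. by move=> pq; apply: through_trans; apply: fl_incr. Qed.

End Lies.

Lemma lies_map (X Y : filtered A) (f : X ~> Y) p (T : A) (x : T ~> X) :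
  filtered_map f -> lies p x -> lies p (f ⊙ x).
Proof. by move=> hf [y <-]; rewrite pcompA; apply: through_comp; apply: hf. Qed.

(** All target degrees m are allowed: the differential vanishes unless
m = n + 1, and no transport along an equality of degrees is then needed. *)
Definition dlies (K : fcomplex A) (n p : int) (T : A) (x : T ~> K n) : Prop :=
  forall m, lies p (dif K n m ⊙ x).

Section DLies.
Variables (K : fcomplex A) (n : int).
Implicit Types (T : A) (p q : int).

Lemma dlies0 p T : dlies p (0 : T ~> K n).
Proof. by move=> m; rewrite pcompm0; apply: lies0. Qed.

Lemma dliesD p T (x y : T ~> K n) : dlies p x -> dlies p y -> dlies p (x + y).
Proof. by move=> hx hy m; rewrite pcompDr; apply: liesD. Qed.

Lemma dliesN p T (x : T ~> K n) : dlies p x -> dlies p (- x).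
Proof. by move=> hx m; rewrite pcompNr; apply: liesN. Qed.

Lemma dliesB p T (x y : T ~> K n) : dlies p x -> dlies p y -> dlies p (x - y).
Proof. by move=> hx hy; apply: dliesD => //; apply: dliesN. Qed.

Lemma dlies_comp p T T' (x : T ~> K n) (e : T' ~> T) : dlies p x -> dlies p (x ⊙ e).
Proof. by move=> hx m; rewrite pcompA; apply: lies_comp. Qed.

Lemma dlies_le p q T (x : T ~> K n) : p <= q -> dlies p x -> dlies q x.
Proof. by move=> pq hx m; apply: lies_le (hx m). Qed.

Lemma dlies_dif p m T (x : T ~> K m) : dlies p (dif K m n ⊙ x).
Proof. by move=> k; rewrite pcompA dif_dif pcomp0m; apply: lies0. Qed.

End DLies.

Lemma zker_lies (K : fcomplex A) n a b (T : A) (x : T ~> K n) :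
  through (zker_in K n a b) x <-> lies a x /\ dlies b x.
Proof. exact: zkerP. Qed.

Section Represent.
Variables (X : A) (S : subquotient X).

Definition represents T (x : T ~> X) (s : T ~> S) : Prop :=
  exists2 y : T ~> sq_sub S, sq_in S ⊙ y = x & sq_pr S ⊙ y = s.

Lemma representsB T (x x' : T ~> X) s s' :
  represents x s -> represents x' s' -> represents (x - x') (s - s').
Proof.
by case=> y <- <- [y' <- <-]; exists (y - y'); rewrite pcompDr pcompNr.
Qed.

Lemma represents_comp T T' (x : T ~> X) s (e : T' ~> T) :
  represents x s -> represents (x ⊙ e) (s ⊙ e).
Proof. by case=> y <- <-; exists (y ⊙ e); rewrite pcompA. Qed.

Lemma represents_through T (x : T ~> X) : through (sq_in S) x ->
  exists s, represents x s.
Proof. by case=> y ey; exists (sq_pr S ⊙ y), y. Qed.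

Lemma represents_in T (x : T ~> X) s : represents x s -> through (sq_in S) x.
Proof. by case=> y ey _; exists y. Qed.

Lemma represents_lift T (s : T ~> S) :
  locally (fun T' e => exists x : T' ~> X, represents x (s ⊙ e)).
Proof.
have [T' [e [y [ee ey]]]] := epi_lift s (@sq_epi _ _ S).
by exists T', e; split=> //; exists (sq_in S ⊙ y), y.
Qed.

End Represent.

Arguments represents {X} S {T} x s.

Lemma induces_represents (X X' : A) (S : subquotient X) (S' : subquotient X') g h
    T (x : T ~> X) s :
  induces g h -> represents S x s -> represents S' (g ⊙ x) (h ⊙ s).
Proof.
case=> w [e1 e2] [y <- <-]; exists (w ⊙ y); first by rewrite pcompA e1 -pcompA.
by rewrite pcompA e2 -pcompA.
Qed.

Lemma induces_add (X X' : A) (S : subquotient X) (S' : subquotient X') g g' h h' :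
  induces (S := S) (S' := S') g h -> induces g' h' ->
  induces (S := S) (S' := S') (g + g') (h + h').
Proof.
case=> y [e1 e2] [y' [e1' e2']]; exists (y + y').
by rewrite !pcompDl !pcompDr e1 e2 e1' e2'.
Qed.

Lemma induces_id (X : A) (S : subquotient X) : induces (S := S) (S' := S) (pidm X) (pidm S).
Proof. by exists (pidm _); rewrite !pcompm1 !pcomp1m. Qed.

Section CohomologyElements.
Variables (X Y Z : A) (f : X ~> Y) (g : Y ~> Z) (gf : g ⊙ f = 0).
Local Notation H := (cohomology gf).

Lemma coh_represents_ex T (y : T ~> Y) :
  (exists s, represents H y s) <-> g ⊙ y = 0.
Proof.
split=> [[s /represents_in]|h]; first by move/through_ker.
by apply: represents_through; apply/through_ker.
Qed.

Lemma coh_represents0 T (y : T ~> Y) s : represents H y s ->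
  (s = 0 <-> locally (fun T' e => exists x : T' ~> X, y ⊙ e = f ⊙ x)).
Proof.
case=> w ew es; split=> [s0|[T' [e [ee [x ex]]]]].
  have [T' [e [x [ee ex]]]] : exists T' (e : T' ~> T) (x : T' ~> X),
     is_epi e /\ coh_lift gf ⊙ x = w ⊙ e.
    by apply: coker_lift; rewrite es.
  exists T', e; split=> //; exists x.
  by rewrite -ew -pcompA -[sq_in _]/(kerm g) -ex pcompA coh_liftE.
apply: (epi_eq0 ee); rewrite -es -pcompA.
have -> : w ⊙ e = coh_lift gf ⊙ x.
  by apply: (@sq_mono _ _ H); rewrite [LHS]pcompA ew ex [RHS]pcompA /= coh_liftE.
by rewrite pcompA /= (proj1 (cokerP _)) pcomp0m.
Qed.
End CohomologyElements.

Lemma pcomp_congr (X Y Z W : A) (g : Y ~> Z) (f : X ~> Y) h (k : W ~> X) :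
  g ⊙ f = h -> g ⊙ (f ⊙ k) = h ⊙ k.
Proof. by move=> <-; rewrite pcompA. Qed.

Section Page.
Variables (r : nat) (K : fcomplex A).
Local Notation r' := (r%:Z).

Lemma page_represents_ex n p T (x : T ~> K n) :
  (exists u, represents (page_n r K n p) x u) <->
  lies (- p) x /\ dlies (- p - r') x.
Proof.
split=> [[s /represents_in /zker_lies] //|h].
by apply: represents_through; apply/zker_lies.
Qed.

(** The denominator is Z_(r-1)^(p+1) + d Z_(r-1)^(p-r+1), with a in the first
summand and b in Z_(r-1)^(p-r+1): d a = d x lies in W_(-p-r). *)
Lemma page_represents0 n p T (x : T ~> K n) u : represents (page_n r K n p) x u ->
  (u = 0 <-> locally (fun T' e => exists (a : T' ~> K n) m (b : T' ~> K m),
     [/\ lies (- p - 1) a, lies (- p + r' - 1) b, dlies (- p) b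
       & x ⊙ e = a + dif K m n ⊙ b])).
Proof.
case=> y ey eu; split=> [u0|[T' [e [ee [a [m [b [ha hb hdb ex]]]]]]]].
  have [T' [e [v [ee ev]]]] : exists T' (e : T' ~> T) v,
     is_epi e /\ page_bound r K n p ⊙ v = y ⊙ e.
    by apply: coker_lift; rewrite eu.
  exists T', e; split=> //.
  have a1 : lies (- p - 1) (zker_in K n (- p - 1) (- p - r')
      ⊙ (bpr (page_bound_ob r K n p) true ⊙ v)).
    by apply: lies_comp; case: (zker_self K n (- p - 1) (- p - r')).
  pose b := zker_in K (n - 1) (- p + r' - 1) (- p) ⊙
     (bpr (page_bound_ob r K n p) false ⊙ v).
  have [b1 b2] : lies (- p + r' - 1) b /\ dlies (- p) b.
    have [h1 h2] := zker_self K (n - 1) (- p + r' - 1) (- p).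
    by split; [apply: lies_comp|apply: dlies_comp].
  exists (zker_in K n (- p - 1) (- p - r')
      ⊙ (bpr (page_bound_ob r K n p) true ⊙ v)), (n - 1), b; split=> //.
  rewrite -ey -[_ ⊙ y]/(zker_in K n (- p) (- p - r') ⊙ y) -pcompA -ev.
  rewrite /page_bound /bcotuple big_bool pcompDl pcompDr; congr (_ + _).
    rewrite -pcompA.
    exact: pcomp_congr (bpr (page_bound_ob r K n p) true ⊙ v)
      (projT2 (boolp.cid (page_in_subproof r K n p))).
  rewrite -pcompA /b [RHS]pcompA.
  exact: pcomp_congr (bpr (page_bound_ob r K n p) false ⊙ v)
    (projT2 (boolp.cid (page_dif_subproof r K (n - 1) n p))).
apply: (epi_eq0 ee); rewrite -eu -pcompA.
have [hx hdx] : lies (- p) x /\ dlies (- p - r') x.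
  by apply/page_represents_ex; exists u, y.
have hda : dlies (- p - r') a.
  have -> : a = x ⊙ e - dif K m n ⊙ b by rewrite ex addrK.
  by apply: dliesB; [apply: dlies_comp|apply: dlies_dif].
have [ya eya] : through (zker_in K n (- p - 1) (- p - r')) a by apply/zker_lies.
have [yb eyb] : through (zker_in K n (- p) (- p - r')) (dif K m n ⊙ b).
  by apply/zker_lies; split; [apply: hdb|apply: dlies_dif].
have [yc eyc] := page_in_subproof r K n p.
have -> : y ⊙ e = yc ⊙ ya + yb.
  apply: (@sq_mono _ _ (page_n r K n p)); rewrite pcompA ey ex pcompDr -eya.
  by rewrite /= [X in _ = X + _]pcompA eyc eyb.
rewrite pcompDr; have -> : sq_pr (page_n r K n p) ⊙ (yc ⊙ ya) = 0.
  by apply: page_pr0_in; exists ya; rewrite pcompA eyc.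
rewrite add0r; apply: (@page_pr0_dif _ _ _ _ _ m _ _ b); first by rewrite eyb.
by apply/zker_lies.
Qed.

(** The elements of W_p that survive to E_(r+1). *)
Definition cycle n p T (x : T ~> K n) : Prop := lies p x /\ dlies (p - r' - 1) x.

(** The vanishing of the class of x in E_(r+1).  For a cycle x, it follows that
d z lies in W_p and d (x - d z) in W_(p-r-1), so that z and x - d z belong to
the terms Z_r of the denominator of E_(r+1). *)
Definition null n p T (x : T ~> K n) : Prop :=
  locally (fun T' e => exists m (z : T' ~> K m),
    lies (p + r') z /\ lies (p - 1) (x ⊙ e - dif K m n ⊙ z)).

Lemma cycle_comp n p T T' (x : T ~> K n) (e : T' ~> T) :
  cycle p x -> cycle p (x ⊙ e).
Proof. by case=> h1 h2; split; [apply: lies_comp|apply: dlies_comp]. Qed.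

Lemma null_degree m n p T (x : T ~> K n) : n = m + 1 -> null p x ->
  locally (fun T' e => exists z : T' ~> K m,
    lies (p + r') z /\ lies (p - 1) (x ⊙ e - dif K m n ⊙ z)).
Proof.
move=> en [T' [e [ee [m' [z [h1 h2]]]]]]; exists T', e; split=> //.
case: (eqVneq m' m) => [em|ne]; first by subst m'; exists z.
exists 0; split; first exact: lies0.
rewrite pcompm0; rewrite (@dif_shape _ _ m' n) ?pcomp0m // in h2.
by rewrite en (inj_eq (addIr _)) eq_sym.
Qed.

(** E_(r+1) is a subquotient of E_r, which is a subquotient of K; this composes
the two. *)
Definition represents2 p q T (x : T ~> K (p + q)) (s : T ~> page_coh r K p q) :=
  exists2 u, represents (page r K p q) x u & represents (page_coh r K p q) u s.

Section Represents2.
Variables p q : int.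

Lemma represents2B T (x x' : T ~> K (p + q)) s s' :
  represents2 x s -> represents2 x' s' -> represents2 (x - x') (s - s').
Proof.
by case=> u h1 h2 [u' h1' h2']; exists (u - u'); apply: representsB.
Qed.

Lemma represents2_comp T T' (x : T ~> K (p + q)) s (e : T' ~> T) :
  represents2 x s -> represents2 (x ⊙ e) (s ⊙ e).
Proof.
by case=> u h1 h2; exists (u ⊙ e); apply: represents_comp.
Qed.

Lemma represents2_cycle T (x : T ~> K (p + q)) : cycle (- p) x -> exists s, represents2 x s.
Proof.
case=> hx hdx.
have [u hu] : exists u, represents (page r K p q) x u.
  apply/page_represents_ex; split=> //; apply: dlies_le hdx.
  by rewrite gerDl.
suff [s hs] : exists s, represents (page_coh r K p q) u s by exists s, u.
apply/coh_represents_ex.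
have hd := induces_represents (page_dP K q (q - r' + 1) (erefl (p + r'))) hu.
apply/(page_represents0 hd); apply: locally_id.
exists (dif K (p + q) (p + r' + (q - r' + 1)) ⊙ x), 0, 0; split.
- by have := hdx (p + r' + (q - r' + 1)); rewrite opprD.
- exact: lies0.
- exact: dlies0.
- by rewrite pcompm1 pcompm0 addr0.
Qed.

(** A class of E_r killed by d_r has a representative x with d x in
W_(-p-r-1): if d x = a + d b exhibits the class of d x as zero, then x - b
represents the same class of E_r. *)
Lemma represents2_lift T (s : T ~> page_coh r K p q) :
  locally (fun T' e => exists2 x : T' ~> K (p + q), cycle (- p) x & represents2 x (s ⊙ e)).
Proof.
have [T1 [e1 [ee1 [u hu]]]] := represents_lift s.
apply: (locally_comp ee1).
have [T2 [e2 [ee2 [x hx]]]] := represents_lift u.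
apply: (locally_comp ee2).
have hd := induces_represents (page_dP K q (q - r' + 1) (erefl (p + r'))) hx.
have du : page_d K q (q - r' + 1) (erefl (p + r')) ⊙ (u ⊙ e2) = 0.
  by rewrite pcompA (proj1 (coh_represents_ex _ _) (ex_intro _ _ hu)) pcomp0m.
have [T3 [e3 [ee3 [a [m [b [ha hb hdb ex]]]]]]] := proj1 (page_represents0 hd) du.
exists T3, e3; split=> //.
have [hx1 hx2] : lies (- p) x /\ dlies (- p - r') x.
  by apply/page_represents_ex; exists (u ⊙ e2).
have [b' [hb1 hb2 eb]] : exists b' : T3 ~> K (p + q),
   [/\ lies (- p - 1) b', dlies (- p - r') b'
     & (dif K _ (p + r' + (q - r' + 1)) ⊙ x) ⊙ e3 = a + dif K _ _ ⊙ b'].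
  case: (eqVneq m (p + q)) => [em|ne].
    subst m; exists b; split=> //.
      by apply: lies_le hb; rewrite opprD subrK.
    by rewrite -opprD.
  exists 0; split; [exact: lies0|exact: dlies0|].
  rewrite ex pcompm0; congr (_ + _).
  rewrite dif_shape ?pcomp0m //.
  by apply: contra ne => /eqP e; apply/eqP; lia.
exists (x ⊙ e3 - b').
  split.
    apply: liesB; first exact: lies_comp.
    by apply: lies_le hb1; rewrite gerDl.
  move=> k; case: (eqVneq k (p + r' + (q - r' + 1))) => [->|nk].
    rewrite pcompDr pcompNr [dif K _ _ ⊙ (x ⊙ e3)]pcompA eb addrK.
    by rewrite -opprD.
  rewrite dif_shape ?pcomp0m; first exact: lies0.
  by apply: contra nk => /eqP ->; apply/eqP; lia.
exists (u ⊙ e2 ⊙ e3); last first.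
  rewrite -pcompA (pcompA s); exact: represents_comp.
have [v hv] : exists v, represents (page r K p q) b' v.
  apply/page_represents_ex; split=> //.
  by apply: lies_le hb1; rewrite gerDl.
have v0 : v = 0.
  apply/(page_represents0 hv); apply: locally_id; exists b', 0, 0; split=> //.
  - exact: lies0.
  - exact: dlies0.
  - by rewrite pcompm1 pcompm0 addr0.
rewrite -[u ⊙ e2 ⊙ e3]subr0 -v0; apply: representsB => //.
exact: represents_comp.
Qed.

(** If the class of x in E_r is d_r of the class of z, then x - d z = a + d b,
and x = a + d (z + b); conversely d z has the class of x in E_r when
x - d z lies in W_(-p-1). *)
Lemma represents2_eq0 T (x : T ~> K (p + q)) s : represents2 x s -> s = 0 <-> null (- p) x.
Proof.
case=> u hx hu; split=> [s0|].
  have [T1 [e1 [ee1 [v hv]]]] := proj1 (coh_represents0 hu) s0.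
  have [T2 [e2 [ee2 [z hz]]]] := represents_lift v.
  have hd := induces_represents (page_dP K (q + r' - 1) q (esym (subrK r' p))) hz.
  have h0 := representsB (represents_comp (e1 ⊙ e2) hx) hd.
  have u0 : u ⊙ (e1 ⊙ e2) - page_d K (q + r' - 1) q (esym (subrK r' p)) ⊙ (v ⊙ e2) = 0.
    by rewrite pcompA hv -pcompA subrr.
  have [T3 [e3 [ee3 [a [m [b [ha hb hdb ex]]]]]]] := proj1 (page_represents0 h0) u0.
  have [hz1 _] := proj1 (page_represents_ex _ _) (ex_intro _ _ hz).
  exists T3, (e1 ⊙ e2 ⊙ e3); split; first by do 2 apply: epi_comp => //.
  have [b' hb' eb] : exists2 b' : T3 ~> K (p - r' + (q + r' - 1)),
      lies (- p + r' - 1) b' & dif K m (p + q) ⊙ b = dif K _ _ ⊙ b'.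
    case: (eqVneq m (p - r' + (q + r' - 1))) => [em|ne]; first by subst m; exists b.
    exists 0; first exact: lies0.
    rewrite dif_shape ?pcomp0m ?pcompm0 //; apply: contra ne => /eqP e.
    by apply/eqP; lia.
  exists (p - r' + (q + r' - 1)), (z ⊙ e3 + b'); split.
    apply: liesD; last by apply: lies_le hb'; rewrite gerDl.
    by apply: lies_comp; apply: lies_le hz1; lia.
  rewrite pcompDr -eb opprD addrA [X in X - _ - _]pcompA.
  have -> : (x ⊙ (e1 ⊙ e2)) ⊙ e3
      = (x ⊙ (e1 ⊙ e2) - dif K (p - r' + (q + r' - 1)) (p + q) ⊙ z) ⊙ e3
        + dif K _ _ ⊙ (z ⊙ e3).
    by rewrite pcompDl pcompNl -!pcompA subrK.
  by rewrite addrK ex addrK.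
move=> hn; pose m := p - r' + (q + r' - 1).
have em : p + q = m + 1.
  by rewrite /m; lia.
have [T1 [e1 [ee1 [z [hz1 hz2]]]]] := null_degree em hn.
have [hx1 hx2] := proj1 (page_represents_ex _ _) (ex_intro _ _ hx).
have hdz : dlies (- p) z.
  move=> k; case: (eqVneq k (p + q)) => [->|ne]; last first.
    by rewrite dif_shape ?pcomp0m -?em //; apply: lies0.
  rewrite -[dif _ _ _ ⊙ z](subKr (x ⊙ e1)); apply: liesB; first exact: lies_comp.
  by apply: lies_le hz2; rewrite gerDl.
have [v hv] : exists v, represents (page r K (p - r') (q + r' - 1)) z v.
  apply/page_represents_ex; split; first by apply: lies_le hz1; lia.
  by apply: dlies_le hdz; lia.
have hd := induces_represents (page_dP K (q + r' - 1) q (esym (subrK r' p))) hv.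
have h0 := representsB (represents_comp e1 hx) hd.
have u0 : u ⊙ e1 - page_d K (q + r' - 1) q (esym (subrK r' p)) ⊙ v = 0.
  apply/(page_represents0 h0); apply: locally_id.
  exists (x ⊙ e1 - dif K _ _ ⊙ z), 0, 0; split=> //.
  - exact: lies0.
  - exact: dlies0.
  - by rewrite pcompm1 pcompm0 addr0.
apply/(coh_represents0 hu); exists T1, e1; split=> //; exists v.
by apply/eqP; rewrite -subr_eq0 u0.
Qed.

End Represents2.
End Page.
End Elements.

(** * E_r-quasi-isomorphisms on elements *)

Section NextPage.
Variables (A : abelian) (r : nat).
Local Notation r' := (r%:Z).
Implicit Types K L M : fcomplex A.

Lemma page_map_unique K L (f : fmorphism K L) p q h :
  induces (S := page r K p q) (S' := page r L p q) (f (p + q)) h ->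
  page_map r f p q = h.
Proof. exact: induces_unique (page_mapP r f p q). Qed.

Lemma page_coh_map_unique K L (f : fmorphism K L) p q h k :
  induces (S := page r K p q) (S' := page r L p q) (f (p + q)) h ->
  induces (S := page_coh r K p q) (S' := page_coh r L p q) h k ->
  page_coh_map r f p q = k.
Proof.
move=> hf hk; apply: (induces_unique (page_coh_mapP r f p q)).
by rewrite (page_map_unique hf).
Qed.

Lemma page_coh_map_id K p q :
  page_coh_map r (fmor_id K) p q = pidm (page_coh r K p q).
Proof. by apply: page_coh_map_unique; apply: induces_id. Qed.

Lemma page_coh_map_comp K L M (g : fmorphism L M) (f : fmorphism K L) p q :
  page_coh_map r (fmor_comp g f) p q
  = page_coh_map r g p q ⊙ page_coh_map r f p q.
Proof.
apply: page_coh_map_unique.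
  exact: induces_comp (page_mapP r f p q) (page_mapP r g p q).
exact: induces_comp (page_coh_mapP r f p q) (page_coh_mapP r g p q).
Qed.

Lemma page_coh_map_add K L (f g h : fmorphism K L) p q :
  (forall n, h n = f n + g n) ->
  page_coh_map r h p q = page_coh_map r f p q + page_coh_map r g p q.
Proof.
move=> e; apply: (@page_coh_map_unique _ _ h p q (page_map r f p q + page_map r g p q)).
  by rewrite e; apply: induces_add; apply: page_mapP.
by apply: induces_add; apply: page_coh_mapP.
Qed.

Lemma page_coh_map0 K L (f : fmorphism K L) p q :
  (forall n, f n = 0) -> page_coh_map r f p q = 0.
Proof.
by move=> e; apply: page_coh_map_unique; rewrite ?e; apply: induces0.
Qed.

Lemma represents2_map K L (f : fmorphism K L) p q T (x : T ~> K (p + q)) s :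
  represents2 x s -> represents2 (f (p + q) ⊙ x) (page_coh_map r f p q ⊙ s).
Proof.
case=> u hu hs; exists (page_map r f p q ⊙ u).
  exact: induces_represents (page_mapP r f p q) hu.
exact: induces_represents (page_coh_mapP r f p q) hs.
Qed.

Definition injective_on_cycles K L (f : fmorphism K L) : Prop :=
  forall n p T (x : T ~> K n), cycle r p x -> null r p (f n ⊙ x) -> null r p x.

Definition surjective_on_cycles K L (f : fmorphism K L) : Prop :=
  forall n p T (y : T ~> L n), cycle r p y ->
    locally (fun T' e => exists2 x : T' ~> K n, cycle r p x
      & null r p (y ⊙ e - f n ⊙ x)).

Lemma bidegree (n p : int) : exists p0 q, n = p0 + q /\ p = - p0.
Proof. by exists (- p), (n + p); split; lia. Qed.

Lemma page_coh_map_mono K L (f : fmorphism K L) :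
  (forall p q, is_mono (page_coh_map r f p q)) <-> injective_on_cycles f.
Proof.
split=> [h n p T x|h p q].
  have [p0 [q [en ep]]] := bidegree n p; subst n p => cx nx.
  have [s hs] := represents2_cycle cx; apply/(represents2_eq0 hs).
  apply: (h p0 q); rewrite pcompm0; exact/(represents2_eq0 (represents2_map f hs)).
apply: is_monoP => T s s0.
have [T' [e [ee [x cx hx]]]] := represents2_lift s; apply: (epi_eq0 ee).
apply/(represents2_eq0 hx); apply: h => //; apply/(represents2_eq0 (represents2_map f hx)).
by rewrite pcompA s0 pcomp0m.
Qed.

Lemma page_coh_map_epi K L (f : fmorphism K L) :
  (forall p q, is_epi (page_coh_map r f p q)) <-> surjective_on_cycles f.
Proof.
split=> [h n p T y|h p q].
  have [p0 [q [en ep]]] := bidegree n p; subst n p => cy.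
  have [s hs] := represents2_cycle cy.
  have /epiP/(_ _ s)[T1 [e1 [ee1 [t ht]]]] := h p0 q.
  apply: (locally_comp ee1).
  have [T2 [e2 [ee2 [x cx hx]]]] := represents2_lift t.
  exists T2, e2; split=> //; exists x => //.
  apply/(represents2_eq0 (represents2B (represents2_comp (e1 ⊙ e2) hs) (represents2_map f hx))).
  by rewrite !pcompA ht subrr.
apply/epiP => T s.
have [T1 [e1 [ee1 [y cy hy]]]] := represents2_lift s; apply: (locally_comp ee1).
have [T2 [e2 [ee2 [x cx hx]]]] := h _ _ _ _ cy.
have [t ht] := represents2_cycle cx; exists T2, e2; split=> //; exists t.
have := represents2B (represents2_comp e2 hy) (represents2_map f ht).
by move/represents2_eq0/proj2/(_ hx)/eqP; rewrite subr_eq0 => /eqP <-; rewrite pcompA.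
Qed.

(** E_(r+1) of the r-cone of f vanishes.  An element of W_p of the cone is a
pair (x, y) with x in W_p and y in W_(p+r), and its differential is
(d x, f x - d y) up to sign; the hypotheses say that (x, y) is a cycle and the
conclusion that it is the boundary of (z, w) up to W_(p-1). *)
Definition cone_acyclic K L (f : fmorphism K L) : Prop :=
  forall p l m n T (x : T ~> K n) (y : T ~> L m), m = l + 1 -> n = m + 1 ->
    cycle r p x -> lies (p + r') y -> lies (p - 1) (f n ⊙ x - dif L m n ⊙ y) ->
    locally (fun T' e => exists (z : T' ~> K m) (w : T' ~> L l),
      [/\ lies (p + r') z, lies (p + r' + r') w,
          lies (p - 1) (x ⊙ e - dif K m n ⊙ z)
        & lies (p + r' - 1) (y ⊙ e - f m ⊙ z + dif L l m ⊙ w)]).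

(** Given (x, y), injectivity bounds x by some z, and then y - f z is a cycle
which surjectivity corrects by f x' for a cycle x', so that z + x' works.
Conversely the pairs (x, y) with f x = d y modulo W_(p-1) give injectivity, and
the pairs (0, y) give surjectivity. *)
Lemma cone_acyclicP K L (f : fmorphism K L) :
  injective_on_cycles f /\ surjective_on_cycles f <-> cone_acyclic f.
Proof.
split=> [[hi hs] p l m n T x y em en cx ly lxy|h].
  have nx : null r p x.
    apply: hi => //; apply: locally_id; exists m, y.
    by rewrite pcompm1.
  have [T1 [e1 [ee1 [z [lz lxz]]]]] := null_degree en nx.
  apply: (locally_comp ee1).
  have cy : cycle r (p + r') (y ⊙ e1 - f m ⊙ z).
    split; first by apply: liesB; [apply: lies_comp|apply: lies_map (fm_filtered f m) lz].
    move=> k; case: (eqVneq k n) => [->|ne]; last first.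
      by rewrite dif_shape ?pcomp0m -?en //; apply: lies0.
    have -> : dif L m n ⊙ (y ⊙ e1 - f m ⊙ z) =
        f n ⊙ (x ⊙ e1 - dif K m n ⊙ z) - (f n ⊙ x - dif L m n ⊙ y) ⊙ e1.
      rewrite !pcompDr !pcompNr pcompDl pcompNl !pcompA fm_dif.
      by rewrite opprB [RHS]addrC addrA subrK.
    rewrite addrK; apply: liesB; last exact: lies_comp.
    exact: lies_map (fm_filtered f n) lxz.
  have [T2 [e2 [ee2 [x' [lx' dx'] nx']]]] := hs _ _ _ _ cy; apply: (locally_comp ee2).
  have [T3 [e3 [ee3 [w [lw lyw]]]]] := null_degree em nx'.
  exists T3, e3; split=> //; exists (z ⊙ e2 ⊙ e3 + x' ⊙ e3), (- w); split.
  - by apply: liesD; do ?apply: lies_comp.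
  - exact: liesN.
  - have -> : x ⊙ (e1 ⊙ (e2 ⊙ e3)) - dif K m n ⊙ (z ⊙ e2 ⊙ e3 + x' ⊙ e3)
       = (x ⊙ e1 - dif K m n ⊙ z) ⊙ (e2 ⊙ e3) - (dif K m n ⊙ x') ⊙ e3.
      by rewrite pcompDl pcompDr pcompNl opprD addrA !pcompA.
    apply: liesB; apply: lies_comp => //.
    by have := dx' n; rewrite addrK.
  - move: lyw; rewrite !pcompDl !pcompDr !pcompNl pcompNr !pcompA opprD.
    by rewrite !addrA.
split=> n p T.
  move=> x cx nx; pose m := n - 1; have en : n = m + 1 by rewrite /m; lia.
  have [T1 [e1 [ee1 [y [ly lxy]]]]] := null_degree en nx.
  have [] := h p (m - 1) m n T1 (x ⊙ e1) y _ en _ ly; first by lia.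
  - exact: cycle_comp.
  - by rewrite pcompA.
  move=> T2 [e2 [ee2 [z [w [lz lw lxz _]]]]].
  exists T2, (e1 ⊙ e2); split; first exact: epi_comp.
  by exists m, z; rewrite pcompA.
move=> y [ly dy].
have [] := h (p - r') (n - 1) n (n + 1) T 0 y _ erefl; first by lia.
- by split; [apply: lies0|apply: dlies0].
- by rewrite subrK.
- rewrite pcompm0 sub0r; exact/liesN/dy.
rewrite !subrK => T1 [e1 [ee1 [z [w [lz lw lxz lyw]]]]].
exists T1, e1; split=> //; exists z.
  split=> // k; case: (eqVneq k (n + 1)) => [->|ne]; last first.
    by rewrite dif_shape ?pcomp0m //; apply: lies0.
  move: lxz; rewrite pcomp0m sub0r => /liesN; rewrite opprK.
  by apply: lies_le; lia.
apply: locally_id; exists (n - 1), (- w); split; first exact: liesN.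
by rewrite pcompm1 pcompNr opprK.
Qed.

Lemma isoP (X Y : A) (f : X ~> Y) : is_iso f <-> is_mono f /\ is_epi f.
Proof.
split=> [[g [gf fg]]|[]]; last exact: mono_epi_iso.
split; [apply: is_monoP|apply: is_epiP] => Z h h0.
  by rewrite -[h]pcomp1m -gf -pcompA h0 pcompm0.
by rewrite -[h]pcompm1 -fg pcompA h0 pcomp0m.
Qed.

Theorem Er_quasi_isoP K L (f : fmorphism K L) :
  Er_quasi_iso (A := A) r f <-> cone_acyclic f.
Proof.
rewrite -cone_acyclicP -page_coh_map_mono -page_coh_map_epi; split=> [h|[h1 h2] p q].
  by split=> p q; have /isoP[] := h p q.
by apply/isoP.
Qed.

Lemma Er_quasi_iso_iso K L (f : fmorphism K L) (g : fmorphism L K) :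
  fmor_comp g f = fmor_id K -> fmor_comp f g = fmor_id L ->
  Er_quasi_iso (A := A) r f.
Proof.
move=> gf fg p q; exists (page_coh_map r g p q).
by rewrite -!page_coh_map_comp gf fg !page_coh_map_id.
Qed.

Lemma Er_quasi_iso_bij K L (f : fmorphism K L) (g : forall n, L n ~> K n) :
  (forall n, filtered_map (g n)) ->
  (forall n, g n ⊙ f n = pidm (K n)) -> (forall n, f n ⊙ g n = pidm (L n)) ->
  exists f' : fmorphism L K, [/\ forall n, f' n = g n,
    fmor_comp f' f = fmor_id K & fmor_comp f f' = fmor_id L].
Proof.
move=> hg gf fg.
have dg i j : g j ⊙ dif L i j = dif K i j ⊙ g i.
  rewrite -[dif L i j]pcompm1 -(fg i) (pcompA (dif L i j)) -fm_dif -pcompA.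
  by rewrite [LHS]pcompA gf pcomp1m.
by exists (FMorphism hg dg); split=> //; apply: fmorphism_eq.
Qed.

Local Notation E := (@Er_quasi_iso A r).

(** The functor E_(r+1) on the formal composites of the localization. *)
Fixpoint ho_page (X Y : CplusF A) (a : ho_mor E X Y) (p q : int) :
    page_coh r X p q ~> page_coh r Y p q :=
  match a in ho_mor _ X Y return page_coh r X p q ~> page_coh r Y p q with
  | ho_loc _ _ f => page_coh_map r f p q
  | ho_inv _ _ _ Ew => projT1 (boolp.cid (Ew p q))
  | ho_comp _ _ _ b a => ho_page b p q ⊙ ho_page a p q
  end.

Lemma ho_page_eq (X Y : CplusF A) (a b : ho_mor E X Y) p q :
  ho_eq a b -> ho_page a p q = ho_page b p q.
Proof.
elim=> //=.
- by move=> X' Y' a' b' c' _ -> _ ->.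
- by move=> X' Y' Z b1 b2 a1 a2 _ -> _ ->.
- by move=> *; rewrite pcompA.
- by move=> X' Y' a'; rewrite page_coh_map_id pcomp1m.
- by move=> X' Y' a'; rewrite page_coh_map_id pcompm1.
- by move=> X' Y' Z g f; apply: page_coh_map_comp.
- move=> X' Y' w Ew; rewrite page_coh_map_id.
  by case: (projT2 (boolp.cid (Ew p q))).
- move=> X' Y' w Ew; rewrite page_coh_map_id.
  by case: (projT2 (boolp.cid (Ew p q))).
Qed.

Lemma Er_saturated (X Y : CplusF A) (f : X ⟶ Y) : E f <-> ho_iso (ho_loc E f).
Proof.
split=> [Ef|[b [hl hr]] p q].
  by exists (ho_inv Ef); split; [apply: ho_invl|apply: ho_invr].
exists (ho_page b p q).
have := ho_page_eq p q hl; have := ho_page_eq p q hr => /=.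
by rewrite !page_coh_map_id.
Qed.

End NextPage.

(** * Finite products of filtered complexes *)

Section FiniteProducts.
Variable A : abelian.

(** The product is built for an arbitrary finite family: two factors give
binary products, and the empty family gives the zero object. *)
Section Product.
Variables (I : finType) (K : I -> fcomplex A).

Local Notation ob n := (bip (fun i => fl_ob (K i n))).

Definition prod_in (n p : int) : bip (fun i => fl_sub (K i n) p) ~> ob n :=
  btuple (fun i => fl_in (K i n) p ⊙ bpr _ i).

Lemma prod_mono n p : is_mono (prod_in n p).
Proof.
move=> Z g h e; apply: bip_ext_pr => i; apply: (@fl_mono _ (K i n) p).
have E : bpr _ i ⊙ prod_in n p = fl_in (K i n) p ⊙ bpr _ i by apply: bpr_tuple.
by rewrite !pcompA -E -!pcompA e.
Qed.

Lemma prod_through n p Z (x : Z ~> ob n) :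
  (forall i, through (fl_in (K i n) p) (bpr _ i ⊙ x)) -> through (prod_in n p) x.
Proof.
move=> h; exists (btuple (fun i => projT1 (boolp.cid (h i)))).
apply: bip_ext_pr => i; rewrite pcompA bpr_tuple -pcompA bpr_tuple.
exact: projT2 (boolp.cid (h i)).
Qed.

Lemma prod_incr n p q : p <= q -> through (prod_in n q) (prod_in n p).
Proof.
move=> pq; apply: prod_through => i; rewrite bpr_tuple.
by apply: through_comp; apply: fl_incr.
Qed.

Definition prod_filtered n : filtered A :=
  Filtered (@prod_mono n) (@prod_incr n).

Definition prod_dif n m : prod_filtered n ~> prod_filtered m :=
  btuple (fun i => dif (K i) n m ⊙ bpr _ i).

Lemma prod_dif_filtered n m : filtered_map (prod_dif n m).
Proof.
move=> p; apply: prod_through => i; rewrite pcompA bpr_tuple -pcompA bpr_tuple pcompA.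
by apply: through_comp; apply: dif_filtered.
Qed.

Lemma prod_dif_shape n m : m != n + 1 -> prod_dif n m = 0.
Proof.
move=> ne; apply: bip_ext_pr => i.
by rewrite bpr_tuple dif_shape // pcomp0m pcompm0.
Qed.

Lemma prod_dif_dif n m k : prod_dif m k ⊙ prod_dif n m = 0.
Proof.
apply: bip_ext_pr => i; rewrite pcompA bpr_tuple -pcompA bpr_tuple pcompA.
by rewrite dif_dif pcomp0m pcompm0.
Qed.

Lemma prod_bounded : exists N, forall n, n < N -> is_zero (prod_filtered n).
Proof.
have [N hN] := boolp.choice (fun i => fc_bounded (K i)).
exists (- \sum_i `|N i|) => n hn.
have h0 : pidm (ob n) = 0.
  rewrite -bin_pr big1 // => i _.
  have ni : n < N i.
    apply: lt_le_trans hn _; apply: le_trans (lerNnormlW _); last exact: lexx.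
    by rewrite lerN2 (bigD1 i) //= lerDl sumr_ge0.
  by rewrite (proj2 (hN i _ ni _) (bpr _ i)) pcompm0.
move=> Y; split=> f.
  by rewrite -[f](pcompm1 (f : ob n ~> Y)) h0 pcompm0.
by rewrite -[f](pcomp1m (f : Y ~> ob n)) h0 pcomp0m.
Qed.

Definition prod_complex : fcomplex A :=
  FComplex prod_dif_filtered prod_dif_shape prod_dif_dif prod_bounded.

Lemma prod_pr_filtered i n :
  filtered_map (X := prod_complex n) (Y := K i n) (bpr _ i).
Proof. by move=> p; exists (bpr _ i); rewrite bpr_tuple. Qed.

Lemma prod_pr_dif i n m :
  bpr _ i ⊙ dif prod_complex n m = dif (K i) n m ⊙ bpr _ i.
Proof. exact: bpr_tuple. Qed.

Definition prod_pr i : fmorphism prod_complex (K i) :=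
  FMorphism (prod_pr_filtered i) (prod_pr_dif i).

Section Tuple.
Variables (L : fcomplex A) (f : forall i, fmorphism L (K i)).

Definition prod_fm n : L n ~> prod_complex n := btuple (fun i => f i n).

Lemma prod_fm_filtered n : filtered_map (prod_fm n).
Proof.
by move=> p; apply: prod_through => i; rewrite pcompA bpr_tuple; apply: fm_filtered.
Qed.

Lemma prod_fm_dif n m : prod_fm m ⊙ dif L n m = dif prod_complex n m ⊙ prod_fm n.
Proof.
apply: bip_ext_pr => i; rewrite pcompA bpr_tuple fm_dif pcompA prod_pr_dif -pcompA.
by rewrite bpr_tuple.
Qed.

Definition prod_tuple : fmorphism L prod_complex :=
  FMorphism prod_fm_filtered prod_fm_dif.

End Tuple.

Lemma prod_pr_tuple L (f : forall i, fmorphism L (K i)) i :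
  fmor_comp (prod_pr i) (prod_tuple f) = f i.
Proof. by apply: fmorphism_eq => n /=; apply: bpr_tuple. Qed.

Lemma prod_ext L (f g : fmorphism L prod_complex) :
  (forall i, fmor_comp (prod_pr i) f = fmor_comp (prod_pr i) g) -> f = g.
Proof.
move=> h; apply: fmorphism_eq => n; apply: bip_ext_pr => i.
exact: (congr1 (fun k : fmorphism L (K i) => fm k n) (h i)).
Qed.

End Product.

Lemma products_exist (X Y : CplusF A) :
  exists (P : CplusF A) (p : P ⟶ X) (q : P ⟶ Y), is_product p q.
Proof.
pose K (b : bool) : fcomplex A := if b then X else Y.
exists (prod_complex K), (prod_pr K true), (prod_pr K false) => Z f g.
pose F b : fmorphism Z (K b) := match b with true => f | false => g end.
exists (prod_tuple F); split.
  by split; [apply: (prod_pr_tuple F true)|apply: (prod_pr_tuple F false)].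
move=> h [h1 h2]; apply: prod_ext => b; rewrite prod_pr_tuple.
by case: b; [apply: esym h1|apply: esym h2].
Qed.

Definition no_complex (i : void) : fcomplex A := match i with end.

Definition zero_complex : fcomplex A := prod_complex no_complex.

Lemma zero_complex_id n : pidm (zero_complex n) = 0.
Proof. by apply: bip_ext_pr; case. Qed.

Section ZeroMorphism.
Variables K L : fcomplex A.

Definition fmor_zero : fmorphism K L :=
  @FMorphism A K L (fun n => 0)
    (fun n p => eq_ind_r (through (fl_in (L n) p)) (through0 _ _)
       (pcomp0m _ (fl_in (K n) p)))
    (fun i j => etrans (pcomp0m _ _) (esym (pcompm0 _ _))).

Variables f g : fmorphism K L.

Lemma fmor_add_filtered n : filtered_map (f n + g n).
Proof. by move=> p; rewrite pcompDl; apply: throughD; apply: fm_filtered. Qed.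

Lemma fmor_add_dif i j : (f j + g j) ⊙ dif K i j = dif L i j ⊙ (f i + g i).
Proof. by rewrite pcompDl pcompDr !fm_dif. Qed.

Definition fmor_add : fmorphism K L := FMorphism fmor_add_filtered fmor_add_dif.

End ZeroMorphism.

Lemma zero_to_unique (K : fcomplex A) (f : fmorphism K zero_complex) :
  f = fmor_zero K zero_complex.
Proof.
apply: fmorphism_eq => n /=.
by rewrite -[f n]pcomp1m zero_complex_id pcomp0m.
Qed.

Lemma zero_from_unique (K : fcomplex A) (f : fmorphism zero_complex K) :
  f = fmor_zero zero_complex K.
Proof.
apply: fmorphism_eq => n /=.
by rewrite -[f n]pcompm1 zero_complex_id pcompm0.
Qed.

Definition zero_fcomplex : zero_object (CplusF A) :=
  @ZeroObject (CplusF A) zero_complex (fun K => fmor_zero K zero_complex)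
    (fun K => fmor_zero zero_complex K) zero_to_unique zero_from_unique.

(** The inclusions come from the universal property, and so does the equation
i p + j q = 1, as both sides have the same composites with p and q. *)
Lemma product_biproduct (X Y P : fcomplex A) (p : fmorphism P X) (q : fmorphism P Y) :
  is_product (D := CplusF A) p q ->
  exists (i : fmorphism X P) (j : fmorphism Y P),
    [/\ fmor_comp p i = fmor_id X, fmor_comp q i = fmor_zero X Y,
        fmor_comp p j = fmor_zero Y X, fmor_comp q j = fmor_id Y
      & forall n, pidm (P n) = i n ⊙ p n + j n ⊙ q n].
Proof.
move=> h.
have [i [[pi qi] _]] := h X (fmor_id X) (fmor_zero X Y).
have [j [[pj qj] _]] := h Y (fmor_zero Y X) (fmor_id Y).
exists i, j; split=> // n.
have [k [_ uk]] := h P p q.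
pose s : fmorphism P P := fmor_add (fmor_comp i p) (fmor_comp j q).
have e1 : k = fmor_id P.
  by apply: uk; split; apply: fmorphism_eq => m /=; rewrite pcompm1.
have e2 : k = s.
  have E (K L M : fcomplex A) (a : fmorphism L M) (b : fmorphism K L) (c : fmorphism K M) m :
    @ccomp (CplusF A) K L M a b = c -> a m ⊙ b m = c m by move=> <-.
  apply: uk; split; apply: fmorphism_eq => m /=; rewrite pcompDr !pcompA.
    by rewrite (E _ _ _ _ _ _ _ pi) (E _ _ _ _ _ _ _ pj) /= pcomp1m pcomp0m addr0.
  by rewrite (E _ _ _ _ _ _ _ qi) (E _ _ _ _ _ _ _ qj) /= pcomp1m pcomp0m add0r.
by rewrite -[RHS]/(s n) -e2 e1.
Qed.

Variable r : nat.

(** An additive functor preserves biproducts, so E_(r+1) of h is the direct sum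
of E_(r+1) of f and of g. *)
Lemma Er_stable (X Y X' Y' P P' : CplusF A)
    (p : P ⟶ X) (q : P ⟶ Y) (p' : P' ⟶ X') (q' : P' ⟶ Y')
    (f : X ⟶ X') (g : Y ⟶ Y') (h : P ⟶ P') :
  is_product p q -> is_product p' q' ->
  p' ∘ h = f ∘ p -> q' ∘ h = g ∘ q ->
  Er_quasi_iso r f -> Er_quasi_iso r g -> Er_quasi_iso r h.
Proof.
move=> /product_biproduct[i [j [pi qi pj qj ij]]].
move=> /product_biproduct[i' [j' [pi' qi' pj' qj' ij']]] hp hq Ef Eg a b.
pose F := fun (X Y : fcomplex A) (f : fmorphism X Y) => page_coh_map r f a b.
have F1 X0 : F X0 X0 (fmor_id X0) = pidm _ by apply: page_coh_map_id.
have F0 X0 Y0 : F X0 Y0 (fmor_zero X0 Y0) = 0 by apply: page_coh_map0.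
have FM X0 Y0 Z0 (u : fmorphism Y0 Z0) (v : fmorphism X0 Y0) :
  F _ _ (fmor_comp u v) = F _ _ u ⊙ F _ _ v by apply: page_coh_map_comp.
have FP : F _ _ i ⊙ F _ _ p + F _ _ j ⊙ F _ _ q = pidm _.
  rewrite -!FM -F1; apply: esym; apply: page_coh_map_add => n /=; exact: ij.
have FP' : F _ _ i' ⊙ F _ _ p' + F _ _ j' ⊙ F _ _ q' = pidm _.
  rewrite -!FM -F1; apply: esym; apply: page_coh_map_add => n /=; exact: ij'.
have Fpi : F _ _ p ⊙ F _ _ i = pidm _ by rewrite -FM pi F1.
have Fqi : F _ _ q ⊙ F _ _ i = 0 by rewrite -FM qi F0.
have Fpj : F _ _ p ⊙ F _ _ j = 0 by rewrite -FM pj F0.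
have Fqj : F _ _ q ⊙ F _ _ j = pidm _ by rewrite -FM qj F1.
have Fhp : F _ _ p' ⊙ F _ _ h = F _ _ f ⊙ F _ _ p.
  by rewrite -!FM; congr F; apply: hp.
have Fhq : F _ _ q' ⊙ F _ _ h = F _ _ g ⊙ F _ _ q.
  by rewrite -!FM; congr F; apply: hq.
have [f1 [f1f ff1]] := Ef a b; have [g1 [g1g gg1]] := Eg a b.
exists (F _ _ i ⊙ (f1 ⊙ F _ _ p') + F _ _ j ⊙ (g1 ⊙ F _ _ q')); split.
  rewrite pcompDl -!pcompA -/(F _ _ h) Fhp Fhq !(pcompA f1) !(pcompA g1).
  by rewrite f1f g1g !pcomp1m.
rewrite -/(F _ _ h) -[LHS]pcomp1m -FP' pcompDl !pcompDr.
rewrite -!pcompA (pcompA (F _ _ p') (F _ _ h)) (pcompA (F _ _ q') (F _ _ h)) Fhp Fhq.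
rewrite !(pcompA (F _ _ p')) Fhp !(pcompA (F _ _ q')) Fhq -!pcompA.
rewrite !(pcompA (F _ _ p)) !(pcompA (F _ _ q)) Fpi Fpj Fqi Fqj.
rewrite !pcomp1m !pcomp0m !pcompm0 addr0 add0r.
by rewrite !(pcompA (F _ _ f)) !(pcompA (F _ _ g)) ff1 gg1 !pcomp1m.
Qed.

End FiniteProducts.

(** * Components of the simple complex *)

Lemma sinc_lt (P : shape) (a b : sob P) : sinc a b != 0 -> a != b.
Proof. by case/sincP => _ e; apply: contra_eq_neq e => ->; lia. Qed.

Lemma sinc_diag (P : shape) (a : sob P) : sinc a a = 0.
Proof. by apply/eqP; apply: contraT => /sinc_lt; rewrite eqxx. Qed.

Lemma mulrz_signK (V : zmodType) (x : V) k : x *~ (-1) ^+ k *~ (-1) ^+ k = x.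
Proof. by rewrite -mulrzA -exprMn mulrNN mulr1 expr1n mulr1z. Qed.

Section SimpleElements.
Variables (A : abelian) (r : nat) (P : shape).
Local Notation r' := (r%:Z).

Section Components.
Variable X : diagram (CplusF A) P.
Local Notation S := (simple_complex r X).
Implicit Types (n m p : int) (a b : sob P).

Definition spr n a : S n ~> cx X a (sdegree n a) := bpr _ a.
Definition sinj n a : cx X a (sdegree n a) ~> S n := bin _ a.

Lemma spr_sinj n a : spr n a ⊙ sinj n a = pidm _.
Proof. exact: bpr_in. Qed.

Lemma spr_sinj0 n a b : a != b -> spr n b ⊙ sinj n a = 0.
Proof. exact: bpr_in0. Qed.

Lemma spr_ext n T (x y : T ~> S n) :
  (forall a, spr n a ⊙ x = spr n a ⊙ y) -> x = y.
Proof. exact: bip_ext_pr. Qed.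

Lemma simple_lies n p T (x : T ~> S n) :
  lies p x <-> forall a, lies (p + (r * sdeg a)%N%:Z) (spr n a ⊙ x).
Proof.
split=> [[y <-] a|h]; last exact: simple_through.
rewrite pcompA; have -> : spr n a ⊙ fl_in (S n) p = _ := bpr_simple_in r X n p a.
by rewrite -pcompA; exists (bpr _ a ⊙ y).
Qed.

Lemma sinj_lies n p a T (v : T ~> cx X a (sdegree n a)) :
  lies (p + (r * sdeg a)%N%:Z) v -> lies (X := S n) p (sinj n a ⊙ v).
Proof.
move=> h; apply/simple_lies => b; rewrite pcompA.
case: (eqVneq a b) => [<-|ne]; first by rewrite spr_sinj pcomp1m.
by rewrite spr_sinj0 // pcomp0m; apply: lies0.
Qed.

Lemma spr_dif n m b :
  spr m b ⊙ dif S n m = \sum_a simple_comp X n m a b ⊙ spr n a.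
Proof. exact: bpr_tuple. Qed.

Lemma spr_dif_sinj n m a b :
  spr m b ⊙ dif S n m ⊙ sinj n a = simple_comp X n m a b.
Proof.
rewrite spr_dif pcomp_suml (bigD1 a) //= -pcompA spr_sinj pcompm1.
rewrite big1 ?addr0 // => c ca.
by rewrite -pcompA spr_sinj0 ?pcompm0 // eq_sym.
Qed.

Lemma simple_comp_diag n m a : simple_comp X n m a a =
  dif (cx X a) (sdegree n a) (sdegree m a) *~ (-1) ^+ sdeg a.
Proof.
rewrite /simple_comp /coef eqxx mul1r sinc_diag mulr0z addr0 cx_map1.
by rewrite pcompm1.
Qed.

Lemma simple_comp_off n m a b : a != b -> simple_comp X n m a b =
  (shift (cx X b) (sdegree n a) (sdegree m b) ⊙ cx_map X a b (sdegree n a))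
    *~ sinc a b.
Proof.
by move/negbTE=> ne; rewrite /simple_comp /coef ne mul0r mulr0z add0r pcompMl.
Qed.

Lemma simple_comp_lies n m a b q T (v : T ~> cx X a (sdegree n a)) : a != b ->
  lies q v -> lies (X := cx X b (sdegree m b)) q (simple_comp X n m a b ⊙ v).
Proof.
move=> ne hv; rewrite simple_comp_off // pcompMl; apply: liesM; rewrite -pcompA.
apply: lies_map; first exact: shift_filtered.
case: (boolP (sle a b)) => h; last by rewrite cx_map0 // pcomp0m; apply: lies0.
by rewrite cx_mapE; apply: lies_map hv; apply: fm_filtered.
Qed.

(** On the summand at a, the differential of the simple complex is the
differential of X^a up to terms of weight lower by r: these terms lie at
vertices of degree |a| + 1, where the weights are shifted by r more. *)
Lemma simple_dif_sinj n m a c T (v : T ~> cx X a (sdegree n a)) :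
  lies (c + (r * sdeg a)%N%:Z) v ->
  lies (c - r') (dif S n m ⊙ (sinj n a ⊙ v)
    - sinj m a ⊙ ((dif (cx X a) (sdegree n a) (sdegree m a) ⊙ v) *~ (-1) ^+ sdeg a)).
Proof.
move=> hv; apply/simple_lies => b.
rewrite pcompDr pcompNr 2![spr m b ⊙ (_ ⊙ _)]pcompA [_ ⊙ (sinj n a ⊙ v)]pcompA spr_dif_sinj.
case: (eqVneq a b) => [<-|ne].
  by rewrite spr_sinj pcomp1m simple_comp_diag pcompMl subrr; apply: lies0.
rewrite spr_sinj0 // pcomp0m subr0.
case: (eqVneq (sinc a b) 0) => [e|/sincP[_ e]].
  by rewrite simple_comp_off // e mulr0z pcomp0m; apply: lies0.
apply: lies_le (simple_comp_lies m ne hv); rewrite e; lia.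
Qed.

(** At a minimal vertex of the support, the diagram contributes nothing to the
differential. *)
Lemma spr_dif_min n m a T (x : T ~> S n) :
  (forall b, sinc b a != 0 -> spr n b ⊙ x = 0) ->
  spr m a ⊙ (dif S n m ⊙ x)
  = (dif (cx X a) (sdegree n a) (sdegree m a) ⊙ (spr n a ⊙ x)) *~ (-1) ^+ sdeg a.
Proof.
move=> h; rewrite pcompA spr_dif pcomp_suml (bigD1 a) //= big1 ?addr0.
  by rewrite simple_comp_diag -pcompA pcompMl.
move=> b ne; rewrite -pcompA; case: (eqVneq (sinc b a) 0) => [e|/h ->].
  by rewrite simple_comp_off // e mulr0z pcomp0m.
by rewrite pcompm0.
Qed.

Lemma cycle_spr n p a T (x : T ~> S n) :
  (forall b, sinc b a != 0 -> spr n b ⊙ x = 0) -> cycle r p x ->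
  cycle r (p + (r * sdeg a)%N%:Z) (spr n a ⊙ x).
Proof.
move=> h [lx dx]; split; first exact: (proj1 (simple_lies _ _) lx).
move=> j; case: (eqVneq j (sdegree (n + 1) a)) => [->|ne]; last first.
  rewrite dif_shape ?pcomp0m; first exact: lies0.
  by apply: contra ne => /eqP ->; apply/eqP; rewrite /sdegree; lia.
have -> : dif (cx X a) (sdegree n a) (sdegree (n + 1) a) ⊙ (spr n a ⊙ x)
    = (spr (n + 1) a ⊙ (dif S n (n + 1) ⊙ x)) *~ (-1) ^+ sdeg a.
  by rewrite spr_dif_min // mulrz_signK.
apply: liesM; apply: lies_le (proj1 (simple_lies _ _) (dx (n + 1)) a); lia.
Qed.

End Components.

(** * Exactness *)

Section Exactness.
Variables (X Y : diagram (CplusF A) P) (f : nattrans X Y).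

Let fc a : fmorphism (cx X a) (cx Y a) := f a.
Let F : fmorphism (simple_complex r X) (simple_complex r Y) :=
  simple_mor r (codiag_of_nat f).

Lemma spr_simple_map n a : spr Y n a ⊙ F n = fc a (sdegree n a) ⊙ spr X n a.
Proof.
have e : spr Y n a ⊙ F n = _ := bpr_tuple _ a.
by rewrite e ssgn_id mulr1z shift_id pcomp1m.
Qed.

Lemma simple_map_sinj n a : F n ⊙ sinj X n a = sinj Y n a ⊙ fc a (sdegree n a).
Proof.
apply: spr_ext => b; rewrite !pcompA spr_simple_map -pcompA.
case: (eqVneq a b) => [<-|ne]; first by rewrite !spr_sinj pcompm1 pcomp1m.
by rewrite !spr_sinj0 // pcompm0 pcomp0m.
Qed.

Hypothesis f_acyclic : forall a, cone_acyclic r (fc a).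

(** Induction on the size of an upward closed set U that contains the supports
of x and y, by elimination of a vertex a of least degree in U. *)
Lemma simple_cone_acyclic_supported (U : {set sob P}) :
  (forall a b, a \in U -> sinc a b != 0 -> b \in U) ->
  forall p l m n T (x : T ~> simple_complex r X n) (y : T ~> simple_complex r Y m),
    m = l + 1 -> n = m + 1 ->
    (forall a, a \notin U -> spr X n a ⊙ x = 0 /\ spr Y m a ⊙ y = 0) ->
    cycle r p x -> lies (p + r') y ->
    lies (p - 1) (F n ⊙ x - dif (simple_complex r Y) m n ⊙ y) ->
    locally (fun T' e => exists (z : T' ~> simple_complex r X m)
                               (w : T' ~> simple_complex r Y l),
      [/\ lies (p + r') z, lies (p + r' + r') w,
          lies (p - 1) (x ⊙ e - dif (simple_complex r X) m n ⊙ z)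
        & lies (p + r' - 1) (y ⊙ e - F m ⊙ z + dif (simple_complex r Y) l m ⊙ w)]).
Proof.
move: {2}#|U| (leqnn #|U|) => k; elim: k U => [|k IH] U hk hU p l m n T x y em en h0 cyx ly lxy.
  have {h0} h a : spr X n a ⊙ x = 0 /\ spr Y m a ⊙ y = 0.
    by apply: h0; move: hk; rewrite leqn0 cards_eq0 => /eqP ->; rewrite inE.
  have x0 : x = 0 by apply: spr_ext => a; rewrite (proj1 (h a)) pcompm0.
  have y0 : y = 0 by apply: spr_ext => a; rewrite (proj2 (h a)) pcompm0.
  apply: locally_id; exists 0, 0.
  by rewrite x0 y0 !pcomp0m !pcompm0 subrr subr0 addr0; split; apply: lies0.
case: (set_0Vmem U) => [U0|[a0 a0U]].
  by apply: (IH U) => //; rewrite U0 cards0.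
case: (arg_minnP (@sdeg P) a0U) => a aU amin; have {}aU : a \in U := aU.
have below b : sinc b a != 0 -> b \notin U.
  case/sincP => _ e; apply: contraTN isT => /amin; rewrite e; lia.
pose eps : int := (-1) ^+ sdeg a; pose q := p + (r * sdeg a)%N%:Z.
pose xa := spr X n a ⊙ x; pose ya := spr Y m a ⊙ y.
pose dX i j := dif (cx X a) (sdegree i a) (sdegree j a).
pose dY i j := dif (cx Y a) (sdegree i a) (sdegree j a).
pose fa i := fc a (sdegree i a).
have dxa N : dX n N ⊙ xa = (spr X N a ⊙ (dif _ n N ⊙ x)) *~ eps.
  rewrite spr_dif_min ?mulrz_signK // => b /below/h0[] //.
have dya N : dY m N ⊙ ya = (spr Y N a ⊙ (dif _ m N ⊙ y)) *~ eps.
  rewrite spr_dif_min ?mulrz_signK // => b /below/h0[] //.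
have [lx dx] := cyx.
have ca : cycle r q xa by apply: cycle_spr => // b /below/h0[].
have lya : lies (q + r') (ya *~ eps).
  apply: liesM; apply: lies_le (proj1 (simple_lies _ _) ly a); rewrite /q; lia.
have lxya : lies (q - 1) (fa n ⊙ xa - dY m n ⊙ (ya *~ eps)).
  have -> : fa n ⊙ xa - dY m n ⊙ (ya *~ eps) =
      spr Y n a ⊙ (F n ⊙ x - dif (simple_complex r Y) m n ⊙ y).
    rewrite pcompMr dya mulrz_signK pcompDr pcompNr; congr (_ - _).
    by rewrite !pcompA spr_simple_map.
  by apply: lies_le (proj1 (simple_lies _ _) lxy a); rewrite /q; lia.
have [||T1 [e1 [ee1 [z0 [w0 [lz0 lw0 la0 lb0]]]]]] :=
    f_acyclic (l := sdegree l a) _ _ ca lya lxya.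
- by rewrite /sdegree em; lia.
- by rewrite /sdegree en; lia.
rewrite -/(dX m n) in la0; rewrite -/(dY l m) -/(fa m) in lb0.
apply: (locally_comp ee1).
(* X^a has the differential eps d inside the simple complex, hence the factors
   eps on ya and z0.  (z1, w1) is the local solution extended by zero,
   (al, be eps) the local remainder, and (x', y') what is left of (x, y). *)
pose al := xa ⊙ e1 - dX m n ⊙ z0.
pose be := (ya *~ eps) ⊙ e1 - fa m ⊙ z0 + dY l m ⊙ w0.
pose z1 := sinj X m a ⊙ (z0 *~ eps); pose w1 := sinj Y l a ⊙ w0.
pose dx1 := dif (simple_complex r X) m n ⊙ z1.
pose x' := x ⊙ e1 - dx1 - sinj X n a ⊙ al.
pose dw1 := dif (simple_complex r Y) l m ⊙ w1.
pose y' := y ⊙ e1 - F m ⊙ z1 + dw1 - sinj Y m a ⊙ (be *~ eps).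
(* R1, ..., R4 measure by how much the differential of the simple complex
   differs from that of X^a or Y^a on the terms extended by zero. *)
pose R1 := dx1 - sinj X n a ⊙ (dX m n ⊙ z0).
pose R2 N := dif (simple_complex r X) n N ⊙ (sinj X n a ⊙ al)
  - sinj X N a ⊙ ((dX n N ⊙ al) *~ eps).
pose R3 := dw1 - sinj Y m a ⊙ ((dY l m ⊙ w0) *~ eps).
pose R4 := dif (simple_complex r Y) m n ⊙ (sinj Y m a ⊙ (be *~ eps))
  - sinj Y n a ⊙ (dY m n ⊙ be).
have lz1 : lies (p + r') z1.
  by apply/sinj_lies/liesM; apply: lies_le lz0; rewrite /q; lia.
have lw1 : lies (p + r' + r') w1.
  by apply: sinj_lies; apply: lies_le lw0; rewrite /q; lia.
have lR1 : lies p R1.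
  rewrite /R1; have -> : dX m n ⊙ z0 = (dX m n ⊙ (z0 *~ eps)) *~ eps.
    by rewrite pcompMr mulrz_signK.
  apply: lies_le (simple_dif_sinj (c := p + r') _ _); first by lia.
  by apply: liesM; apply: lies_le lz0; rewrite /q; lia.
have lR2 N : lies (p - r' - 1) (R2 N).
  apply: lies_le (simple_dif_sinj (c := p - 1) _ _); first by lia.
  by apply: lies_le la0; rewrite /q; lia.
have lR3 : lies (p + r') R3.
  apply: lies_le (simple_dif_sinj (c := p + r' + r') _ _); first by lia.
  by apply: lies_le lw0; rewrite /q; lia.
have lR4 : lies (p - 1) R4.
  rewrite /R4; have -> : dY m n ⊙ be = (dY m n ⊙ (be *~ eps)) *~ eps.
    by rewrite pcompMr mulrz_signK.
  apply: lies_le (simple_dif_sinj (c := p + r' - 1) _ _); first by lia.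
  by apply: liesM; apply: lies_le lb0; rewrite /q; lia.
have x'E : x' = x ⊙ e1 - R1 - sinj X n a ⊙ (xa ⊙ e1).
  rewrite /x' /R1 /al pcompDr pcompNr; zmodule.
have y'E : y' = y ⊙ e1 - F m ⊙ z1 + R3
    - sinj Y m a ⊙ ((ya *~ eps ⊙ e1 - fa m ⊙ z0) *~ eps).
  rewrite /y' /R3 /be [in LHS]mulrzDl [X in _ - X = _]pcompDr; zmodule.
have ddx1 N : dif (simple_complex r X) n N ⊙ dx1 = 0.
  by rewrite /dx1 pcompA dif_dif pcomp0m.
have ddw1 : dif (simple_complex r Y) m n ⊙ dw1 = 0.
  by rewrite /dw1 pcompA dif_dif pcomp0m.
have dal N : dX n N ⊙ al = (dX n N ⊙ xa) ⊙ e1.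
  by rewrite /al pcompDr pcompNr [dX n N ⊙ (dX m n ⊙ _)]pcompA dif_dif pcomp0m subr0 pcompA.
have dbe : dY m n ⊙ be = (dY m n ⊙ (ya *~ eps)) ⊙ e1 - fa n ⊙ (dX m n ⊙ z0).
  rewrite /be !pcompDr pcompNr [dY m n ⊙ (dY l m ⊙ _)]pcompA dif_dif pcomp0m addr0.
  by rewrite pcompA [dY m n ⊙ (fa m ⊙ _)]pcompA [fa n ⊙ (dX m n ⊙ _)]pcompA fm_dif.
have cx' : cycle r p x'.
  split.
    rewrite x'E; apply: liesB.
      by apply: liesB => //; apply: lies_comp.
    apply: sinj_lies; apply: lies_comp; exact: (proj1 ca).
  move=> N.
  have -> : dif (simple_complex r X) n N ⊙ x' =
      (dif (simple_complex r X) n N ⊙ x) ⊙ e1 - R2 N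
      - sinj X N a ⊙ ((dX n N ⊙ xa) *~ eps ⊙ e1).
    rewrite /x' 2!pcompDr 2!pcompNr ddx1 subr0 /R2 dal pcompMl pcompA; zmodule.
  apply: liesB; first by apply: liesB => //; apply: lies_comp; apply: dx.
  apply: sinj_lies; apply: lies_comp; apply: liesM.
  by apply: lies_le (proj2 ca (sdegree N a)); rewrite /q; lia.
have ly' : lies (p + r') y'.
  rewrite y'E; apply: liesB.
    apply: liesD => //; apply: liesB; first exact: lies_comp.
    by apply: lies_map => //; apply: fm_filtered.
  apply/sinj_lies/liesM/liesB; first apply: lies_comp.
    by apply: lies_le lya; rewrite /q; lia.
  apply: lies_map; first exact: fm_filtered.
  by apply: lies_le lz0; rewrite /q; lia.
have lxy' : lies (p - 1) (F n ⊙ x' - dif (simple_complex r Y) m n ⊙ y').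
  have -> : F n ⊙ x' - dif (simple_complex r Y) m n ⊙ y' =
    (F n ⊙ x - dif (simple_complex r Y) m n ⊙ y) ⊙ e1 + R4
     - sinj Y n a ⊙ ((fa n ⊙ xa - dY m n ⊙ (ya *~ eps)) ⊙ e1).
    have Fdx1 : F n ⊙ dx1 = dif (simple_complex r Y) m n ⊙ (F m ⊙ z1).
      by rewrite /dx1 !pcompA fm_dif.
    rewrite /x' /y' 2!(pcompDr (F n)) 2!pcompNr Fdx1 3!(pcompDr (dif _ m n)) !pcompNr ddw1.
    rewrite (pcompA (F n) (sinj _ _ _)) simple_map_sinj -/(fa n) -(pcompA _ (fa n)).
    rewrite /R4 dbe /al !(pcompDl, pcompNl, pcompDr, pcompNr) !pcompA; zmodule.
  apply: liesB; first by apply: liesD => //; apply: lies_comp.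
  apply: sinj_lies; apply: lies_comp; apply: lies_le lxya; rewrite /q; lia.
(* The component of (x', y') at a vanishes by construction, and the correction
   terms live at a and at vertices above a, which are in U. *)
have h0' b : b \notin U :\ a -> spr X n b ⊙ x' = 0 /\ spr Y m b ⊙ y' = 0.
  have sp (Z : diagram (CplusF A) P) N N' c (v : T1 ~> cx Z a (sdegree N a)) :
      spr Z N' c ⊙ (dif (simple_complex r Z) N N' ⊙ (sinj Z N a ⊙ v))
      = simple_comp Z N N' a c ⊙ v.
    by rewrite !pcompA spr_dif_sinj.
  rewrite !inE negb_and negbK; case: (eqVneq b a) => [-> _|ba /= bU].
    split.
      rewrite /x' 2!(pcompDr (spr X n a)) !pcompNr /dx1 /z1 sp simple_comp_diag -/(dX m n).
      rewrite pcompMl pcompMr mulrz_signK !(pcompA (spr X n a)) spr_sinj pcomp1m.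
      by rewrite -/xa /al; zmodule.
    rewrite /y' 3!(pcompDr (spr Y m a)) !pcompNr /dw1 /w1 sp simple_comp_diag -/(dY l m).
    rewrite /z1 (pcompA (F m)) simple_map_sinj -(pcompA (sinj Y m a)).
    rewrite !(pcompA (spr Y m a)) spr_sinj !pcomp1m -/ya -/(fa m) /be.
    have epsK (V : zmodType) (v : V) : v *~ eps *~ eps = v by apply: mulrz_signK.
    rewrite 2!mulrzDl mulNrz [(ya *~ eps) ⊙ e1]pcompMl epsK.
    by rewrite !pcompMl pcompMr -/eps; zmodule.
  have s0 : sinc a b = 0.
    by apply/eqP; apply: contraNT bU; apply: hU.
  have ab : a != b by rewrite eq_sym.
  have [xb yb] := h0 b bU; split.
    rewrite /x' 2!(pcompDr (spr X n b)) !pcompNr /dx1 /z1 sp simple_comp_off // s0 mulr0z pcomp0m.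
    rewrite !(pcompA (spr X n b)) xb spr_sinj0 // !pcomp0m; zmodule.
  rewrite /y' 3!(pcompDr (spr Y m b)) !pcompNr /dw1 /w1 sp simple_comp_off // s0 mulr0z pcomp0m.
  rewrite /z1 (pcompA (F m)) simple_map_sinj -(pcompA (sinj Y m a)).
  rewrite !(pcompA (spr Y m b)) yb spr_sinj0 // !pcomp0m; zmodule.
have hk' : (#|U :\ a| <= k)%N by move: hk; rewrite (cardsD1 a) aU; lia.
have hU' b c : b \in U :\ a -> sinc b c != 0 -> c \in U :\ a.
  rewrite !inE => /andP[ba bU] s; rewrite (hU _ _ bU s) andbT.
  by apply: contraTneq (bU) => e; apply: below; rewrite -e.
have [T2 [e2 [ee2 [z2 [w2 [lz2 lw2 lxz2 lyw2]]]]]] :=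
  IH _ hk' hU' p l m n T1 x' y' em en h0' cx' ly' lxy'.
exists T2, e2; split=> //; exists (z1 ⊙ e2 + z2), (w1 ⊙ e2 + w2); split.
- by apply: liesD => //; apply: lies_comp.
- by apply: liesD => //; apply: lies_comp.
- have -> : x ⊙ (e1 ⊙ e2) - dif (simple_complex r X) m n ⊙ (z1 ⊙ e2 + z2)
    = (x' ⊙ e2 - dif (simple_complex r X) m n ⊙ z2) + (sinj X n a ⊙ al) ⊙ e2.
    rewrite /x' /dx1 !pcompDl !pcompDr !pcompNl !pcompA; zmodule.
  apply: liesD => //; apply: lies_comp; apply: sinj_lies.
  by apply: lies_le la0; rewrite /q; lia.
- have -> : y ⊙ (e1 ⊙ e2) - F m ⊙ (z1 ⊙ e2 + z2)
      + dif (simple_complex r Y) l m ⊙ (w1 ⊙ e2 + w2)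
    = (y' ⊙ e2 - F m ⊙ z2 + dif (simple_complex r Y) l m ⊙ w2)
      + (sinj Y m a ⊙ (be *~ eps)) ⊙ e2.
    rewrite /y' /dw1 !pcompDl !pcompDr !pcompNl !pcompA; zmodule.
  apply: liesD => //; apply: lies_comp; apply: sinj_lies; apply: liesM.
  by apply: lies_le lb0; rewrite /q; lia.
Qed.

Lemma simple_cone_acyclic : cone_acyclic r F.
Proof.
move=> p l m n T x y em en cyx ly lxy.
by apply: (@simple_cone_acyclic_supported setT) => // a; rewrite inE.
Qed.

End Exactness.
End SimpleElements.

Arguments spr {A r P} X n a.
Arguments sinj {A r P} X n a.

Lemma Er_exact (A : abelian) (r : nat) P (X Y : diagram (CplusF A) P) (f : nattrans X Y) :
  (forall a, Er_quasi_iso r (f a)) ->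
  Er_quasi_iso r (simple_map (simple_functor A r) f).
Proof.
move=> h; apply/Er_quasi_isoP; apply: simple_cone_acyclic => a.
exact/Er_quasi_isoP/h.
Qed.

(** * Products of diagrams *)

Section ProductsOfDiagrams.
Variables (A : abelian) (r : nat).
Local Notation s := (simple_functor A r).

Section DiagramProducts.
Variables (P : shape) (X Y Z : diagram (CplusF A) P).
Variables (p : nattrans Z X) (q : nattrans Z Y).
Hypothesis pq : forall a, is_product (p a) (q a).

Lemma product_ext a (W : CplusF A) (u v : W ⟶ Z a) :
  p a ∘ u = p a ∘ v -> q a ∘ u = q a ∘ v -> u = v.
Proof.
move=> e1 e2; have [k [_ uk]] := @pq a W (p a ∘ v) (q a ∘ v).
by rewrite -(uk u) // (uk v).
Qed.

(** The pointwise inclusions are natural because maps into a product are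
determined by their components. *)
Lemma product_biproduct_nat : exists (i : nattrans X Z) (j : nattrans Y Z),
  forall a, [/\ p a ∘ i a = cidm (X a), q a ∘ i a = fmor_zero (X a) (Y a),
    p a ∘ j a = fmor_zero (Y a) (X a), q a ∘ j a = cidm (Y a)
    & forall n, pidm ((Z a : fcomplex A) n) =
        (i a : fmorphism _ _) n ⊙ (p a : fmorphism _ _) n
        + (j a : fmorphism _ _) n ⊙ (q a : fmorphism _ _) n].
Proof.
pose H a := boolp.cid (product_biproduct (@pq a)).
pose i a : X a ⟶ Z a := projT1 (H a).
pose J a := boolp.cid (projT2 (H a)).
pose j a : Y a ⟶ Z a := projT1 (J a).
have h a := projT2 (J a); rewrite -/(i _) -/(j _) in h.
have zl (K L M : fcomplex A) (g : fmorphism L M) :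
    fmor_comp g (fmor_zero K L) = fmor_zero K M.
  by apply: fmorphism_eq => n /=; rewrite pcompm0.
have zr (K L M : fcomplex A) (g : fmorphism K L) :
    fmor_comp (fmor_zero L M) g = fmor_zero K M.
  by apply: fmorphism_eq => n /=; rewrite pcomp0m.
have ni a b (k : sle a b) : i b ∘ dmap X k = dmap Z k ∘ i a.
  have [pia qia pja qja _] := h a; have [pib qib pjb qjb _] := h b.
  apply: product_ext; rewrite !ccompA nt_nat -[_ ∘ i a]ccompA.
    by rewrite [p b ∘ i b]pib [p a ∘ i a]pia ccomp1m ccompm1.
  by rewrite [q b ∘ i b]qib [q a ∘ i a]qia [LHS]zr [RHS]zl.
have nj a b (k : sle a b) : j b ∘ dmap Y k = dmap Z k ∘ j a.
  have [pia qia pja qja _] := h a; have [pib qib pjb qjb _] := h b.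
  apply: product_ext; rewrite !ccompA nt_nat -[_ ∘ j a]ccompA.
    by rewrite [p b ∘ j b]pjb [p a ∘ j a]pja [LHS]zr [RHS]zl.
  by rewrite [q b ∘ j b]qjb [q a ∘ j a]qja ccomp1m ccompm1.
by exists (NatTrans ni), (NatTrans nj).
Qed.

Lemma Er_products (Q : CplusF A) (p' : Q ⟶ simple s X) (q' : Q ⟶ simple s Y)
    (h : simple s Z ⟶ Q) :
  is_product p' q' -> p' ∘ h = simple_map s p -> q' ∘ h = simple_map s q ->
  Er_quasi_iso r h.
Proof.
move=> pq' hp hq; have [i [j hij]] := product_biproduct_nat.
pose si : fmorphism _ _ := simple_map s i; pose sj : fmorphism _ _ := simple_map s j.
pose sp : fmorphism _ _ := simple_map s p; pose sq : fmorphism _ _ := simple_map s q.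
pose g : fmorphism Q (simple s Z) := fmor_add (fmor_comp si p') (fmor_comp sj q').
have E (K L M : fcomplex A) (a : fmorphism L M) (b : fmorphism K L) (c : fmorphism K M) m :
    @ccomp (CplusF A) K L M a b = c -> a m ⊙ b m = c m by move=> <-.
have gh n : g n ⊙ (h : fmorphism _ _) n = pidm _.
  rewrite pcompDl -!pcompA (E _ _ _ _ _ _ _ hp) (E _ _ _ _ _ _ _ hq).
  apply: spr_ext => a; have [_ _ _ _ id1] := hij a.
  rewrite pcompDr !pcompA !spr_simple_map -!pcompA !spr_simple_map pcompm1.
  by rewrite !pcompA -pcompDl -id1 pcomp1m.
have [pi qi pj qj] : [/\ forall n, sp n ⊙ si n = pidm _, forall n, sq n ⊙ si n = 0,
    forall n, sp n ⊙ sj n = 0 & forall n, sq n ⊙ sj n = pidm _].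
  split=> n; apply: spr_ext => a; have [h1 h2 h3 h4 _] := hij a;
    rewrite pcompA !spr_simple_map -pcompA !spr_simple_map pcompA.
  - by rewrite (E _ _ _ _ _ _ _ h1) pcomp1m pcompm1.
  - by rewrite (E _ _ _ _ _ _ _ h2) pcomp0m pcompm0.
  - by rewrite (E _ _ _ _ _ _ _ h3) pcomp0m pcompm0.
  - by rewrite (E _ _ _ _ _ _ _ h4) pcomp1m pcompm1.
apply: (@Er_quasi_iso_iso _ _ _ _ _ g); first exact: fmorphism_eq.
have [k [_ uk]] := pq' Q p' q'.
have <- : k = fmor_id Q by apply: uk; split; apply: ccompm1.
apply: esym; apply: uk; split; rewrite ccompA ?hp ?hq; apply: fmorphism_eq => n /=.
  by rewrite pcompDr !pcompA pi pj pcomp1m pcomp0m addr0.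
by rewrite pcompDr !pcompA qi qj pcomp1m pcomp0m add0r.
Qed.

End DiagramProducts.

Local Notation one := (zero_fcomplex A).

Lemma simple_zero P n :
  pidm (simple_complex r (const_diagram P (one : CplusF A)) n) = 0.
Proof.
apply: spr_ext => a; rewrite pcompm0 pcompm1.
rewrite -[LHS]pcomp1m; have -> : pidm (cx (const_diagram P (one : CplusF A)) a (sdegree n a)) = 0.
  exact: zero_complex_id.
exact: pcomp0m.
Qed.

Lemma Er_unit P : Er_quasi_iso r (zto one (simple s (const_diagram P one))).
Proof.
apply: (@Er_quasi_iso_iso _ _ _ _ _ (zfrom one _)); apply: fmorphism_eq => n /=.
  by rewrite pcompm0 simple_zero.
by rewrite pcompm0 zero_complex_id.
Qed.

(** * Acyclicity *)

(** The vanishing of an object is expressed by the vanishing of its identity. *)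
Lemma weakly_equivalent_page0 (X Y : CplusF A) :
  weakly_equivalent (@Er_quasi_iso A r) X Y ->
  (forall p q, pidm (page_coh r X p q) = 0) <-> (forall p q, pidm (page_coh r Y p q) = 0).
Proof.
elim=> {X Y} [X Y w Ew|//|X Y _ [h1 h2]|X Y Z _ [h1 h2] _ [h3 h4]].
- split=> h p q; have [g [gw wg]] := Ew p q.
    by rewrite -wg -[page_coh_map _ _ _ _]pcompm1 h pcompm0 pcomp0m.
  by rewrite -gw -[g]pcompm1 -[X in _ ⊙ X ⊙ _]pcompm1 h !pcompm0 pcomp0m.
- by split.
- by split=> h; [apply/h3/h1|apply/h2/h4].
Qed.

Lemma page_coh_zero p q : pidm (page_coh r (zero_complex A) p q) = 0.
Proof.
by rewrite -page_coh_map_id; apply: page_coh_map0 => n; apply: zero_complex_id.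
Qed.

(** A zigzag of E_r-quasi-isomorphisms from X to 0 forces E_(r+1)(X) = 0, so a
zigzag may be replaced by the single morphism X -> 0. *)
Lemma acyclicP (X : CplusF A) :
  acyclic (@Er_quasi_iso A r) one X <-> Er_quasi_iso r (zto one X).
Proof.
split=> [h p q|]; last exact: we_mor.
have h0 := proj2 (weakly_equivalent_page0 h) page_coh_zero p q.
exists 0; rewrite pcomp0m pcompm0 h0; split=> //.
by rewrite page_coh_zero.
Qed.

Lemma zero_cone_acyclicP (X : fcomplex A) :
  cone_acyclic r (fmor_zero X (zero_complex A)) <->
  forall p m n T (x : T ~> X n), n = m + 1 -> cycle r p x ->
    locally (fun T' e => exists2 z : T' ~> X m,
      lies (p + r%:Z) z & lies (p - 1) (x ⊙ e - dif X m n ⊙ z)).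
Proof.
have z0 n T (x : T ~> zero_complex A n) : x = 0.
  by rewrite -[x]pcomp1m zero_complex_id pcomp0m.
split=> h.
  move=> p m n T x en cyx.
  have [|||T' [e [ee [z [w [lz _ lxz _]]]]]] :=
    h p (m - 1) m n T x 0 _ en cyx _ _.
  - by lia.
  - exact: lies0.
  - by rewrite (z0 _ _ (_ ⊙ x - _)); apply: lies0.
  - by exists T', e; split=> //; exists z.
move=> p l m n T x y em en cyx _ _.
have [T' [e [ee [z lz lxz]]]] := h p m n T x en cyx.
exists T', e; split=> //; exists z, 0; split=> //; first exact: lies0.
by rewrite (z0 _ _ (_ - _ + _)); apply: lies0.
Qed.

(** The same condition with two names for each of the degrees m and n, equal
only propositionally, as they occur in the components of a simple complex. *)
Lemma cone_acyclic_shift (K L : fcomplex A) (f : fmorphism K L) :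
  cone_acyclic r f <->
  forall p l m m' n n' T (x : T ~> K n) (y : T ~> L m'),
    m = l + 1 -> n = m + 1 -> m' = m -> n' = n ->
    cycle r p x -> lies (p + r%:Z) y ->
    lies (p - 1) (shift L n n' ⊙ (f n ⊙ x) - dif L m' n' ⊙ y) ->
    locally (fun T' e => exists (z : T' ~> K m) (w : T' ~> L l),
      [/\ lies (p + r%:Z) z, lies (p + r%:Z + r%:Z) w,
          lies (p - 1) (x ⊙ e - dif K m n ⊙ z)
        & lies (p + r%:Z - 1) (y ⊙ e - shift L m m' ⊙ (f m ⊙ z) + dif L l m' ⊙ w)]).
Proof.
split=> h p l m.
  move=> m' n n' T x y em en em' en'; subst m' n'; rewrite shift_id pcomp1m => c ly lxy.
  have [T' [e [ee [z [w hzw]]]]] := h p l m n T x y em en c ly lxy.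
  by exists T', e; split=> //; exists z, w; rewrite shift_id pcomp1m.
move=> n T x y em en c ly lxy.
have [|T' [e [ee [z [w hzw]]]]] := h p l m m n n T x y em en erefl erefl c ly.
  by rewrite shift_id pcomp1m.
by rewrite shift_id pcomp1m in hzw; exists T', e; split=> //; exists z, w.
Qed.

(** The simple of a diagram on the square whose vertex v1 is zero, as the cone
of its only interesting map g; v0, v1 and v01 stand for {0}, {1} and {0, 1}. *)
Section Cone.
Variables (X : diagram (CplusF A) (square 1)) (v0 v1 v01 : sob (square 1)).
Hypothesis v_all : forall a, [\/ a = v0, a = v1 | a = v01].
Hypothesis v1_zero : forall n, pidm (cx X v1 n) = 0.
Hypotheses (v0_deg : sdeg v0 = 0%N) (v01_deg : sdeg v01 = 1%N).
Hypothesis v0_le : sle v0 v01.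
Hypothesis v_sgn : sinc v0 v01 * sinc v0 v01 = 1.

Local Notation B := (cx X v0).
Local Notation C := (cx X v01).
Let g : fmorphism B C := dmap X v0_le.
Let sg := sinc v0 v01.
Local Notation S := (simple_complex r X).

Let v_ne : v0 != v01.
Proof. by apply/eqP => e; have := v01_deg; rewrite -e v0_deg. Qed.

Let below_v0 b : sinc b v0 = 0.
Proof.
by apply/eqP; apply: contraT => /sincP[_]; rewrite v0_deg.
Qed.

Let sgK (V : zmodType) (x : V) : x *~ sg *~ sg = x.
Proof. by rewrite -mulrzA v_sgn mulr1z. Qed.

Let vanish1 n T (x : T ~> S n) : spr X n v1 ⊙ x = 0.
Proof.
by rewrite -[LHS]pcomp1m v1_zero pcomp0m.
Qed.

Let cone_lies n p T (x : T ~> S n) :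
  lies p x <-> lies p (spr X n v0 ⊙ x) /\ lies (p + r%:Z) (spr X n v01 ⊙ x).
Proof.
rewrite simple_lies; split=> [h|[h0 h01] a].
  by split; [apply: lies_le (h v0)|apply: lies_le (h v01)]; lia.
case: (v_all a) => ->; last by apply: lies_le h01; lia.
  by apply: lies_le h0; lia.
by rewrite vanish1; apply: lies0.
Qed.

Let cone_dif0 n m T (x : T ~> S n) :
  spr X m v0 ⊙ (dif S n m ⊙ x) = dif B (sdegree n v0) (sdegree m v0) ⊙ (spr X n v0 ⊙ x).
Proof.
by rewrite spr_dif_min => [|b]; rewrite ?below_v0 ?eqxx // v0_deg mulr1z.
Qed.

Let cone_dif1 n m T (x : T ~> S n) :
  spr X m v01 ⊙ (dif S n m ⊙ x)
  = (shift C (sdegree n v0) (sdegree m v01) ⊙ (g (sdegree n v0) ⊙ (spr X n v0 ⊙ x))) *~ sg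
    - dif C (sdegree n v01) (sdegree m v01) ⊙ (spr X n v01 ⊙ x).
Proof.
rewrite pcompA spr_dif pcomp_suml (bigD1 v01) //= (bigD1 v0) //= big1 ?addr0.
  rewrite simple_comp_diag v01_deg expr1 mulrNz mulr1z pcompNl pcompNl addrC.
  congr (_ - _); last by rewrite pcompA.
  by rewrite simple_comp_off // (cx_mapE _ _ v0_le) !pcompMl !pcompA.
move=> a /andP[a1 a0]; case: (v_all a) => e; subst a.
- by rewrite eqxx in a0.
- by rewrite -pcompA vanish1 pcompm0.
- by rewrite eqxx in a1.
Qed.

Let pair n T (b : T ~> B (sdegree n v0)) (c : T ~> C (sdegree n v01)) : T ~> S n :=
  sinj X n v0 ⊙ b + sinj X n v01 ⊙ c.

Let pair0 n T b c : spr X n v0 ⊙ @pair n T b c = b.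
Proof.
rewrite pcompDr !pcompA spr_sinj pcomp1m spr_sinj0 ?pcomp0m ?addr0 //.
by rewrite eq_sym.
Qed.

Let pair1 n T b c : spr X n v01 ⊙ @pair n T b c = c.
Proof.
by rewrite pcompDr !pcompA spr_sinj pcomp1m spr_sinj0 ?pcomp0m ?add0r.
Qed.

(** With components (b, c) at v0 and v01, the differential of the simple is
(d b, sg g b - d c), where the sign sg is absorbed into c. *)
Lemma cone_of_simple : cone_acyclic r g <-> cone_acyclic r (fmor_zero S (zero_complex A)).
Proof.
rewrite zero_cone_acyclicP cone_acyclic_shift; split=> h.
  move=> p m n T x en cyx.
  have c0 : cycle r p (spr X n v0 ⊙ x).
    have := @cycle_spr _ _ _ _ _ _ v0 _ _ _ cyx.
    rewrite v0_deg muln0 addr0; apply=> b; by rewrite below_v0 eqxx.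
  have [lx dx] := cyx.
  have [_ l1] := proj1 (cone_lies _ _) lx.
  have [|||||T' [e [ee [z [w [lz lw lxz lyw]]]]]] := h p (sdegree m v01) (sdegree m v0)
    (sdegree n v01) (sdegree n v0) (sdegree (n + 1) v01) T (spr X n v0 ⊙ x)
    ((spr X n v01 ⊙ x) *~ sg) _ _ _ _ c0 (liesM sg l1) _.
  - by rewrite /sdegree v0_deg v01_deg; lia.
  - by rewrite /sdegree v0_deg; lia.
  - by rewrite /sdegree v0_deg v01_deg; lia.
  - by rewrite /sdegree v0_deg v01_deg; lia.
  - have [_] := proj1 (cone_lies _ _) (dx (n + 1)).
    rewrite cone_dif1 => /(liesM sg); rewrite mulrzDl sgK mulNrz pcompMr.
    by apply: lies_le; lia.
  exists T', e; split=> //; exists (pair z (w *~ sg)).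
    by apply/cone_lies; rewrite pair0 pair1; split=> //; apply: liesM.
  apply/cone_lies; rewrite (pcompDr (spr X n v0)) (pcompDr (spr X n v01)) !pcompNr.
  rewrite cone_dif0 cone_dif1 pair0 pair1; split; first by rewrite pcompA.
  have := liesM sg lyw; rewrite 2!mulrzDl pcompMl sgK mulNrz.
  rewrite (pcompMr _ w) (pcompA (spr X n v01) x).
  by rewrite opprB addrA addrAC; apply: lies_le; lia.
move=> p l m m' n n' T x y em en em' en' cyx ly lxy.
have [N eN] : exists N, n = sdegree N v0.
  by exists n; rewrite /sdegree v0_deg; lia.
have [M eM] : exists M, m = sdegree M v0.
  by exists m; rewrite /sdegree v0_deg; lia.
have eN' : n' = sdegree (N + 1) v01.
  by move: eN; rewrite /sdegree v0_deg v01_deg; lia.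
have eM' : m' = sdegree N v01.
  by move: eN; rewrite /sdegree v0_deg v01_deg; lia.
have el : l = sdegree M v01.
  by move: eM; rewrite /sdegree v0_deg v01_deg; lia.
have eNM : N = M + 1.
  by move: eN eM; rewrite /sdegree v0_deg; lia.
clear em en em' en'; subst n m n' m' l.
have cxy : cycle r p (pair x (y *~ sg)).
  split; first by apply/cone_lies; rewrite pair0 pair1; split; [exact: (proj1 cyx)|exact: liesM].
  move=> j; case: (eqVneq j (N + 1)) => [->|ne]; last first.
    by rewrite dif_shape ?pcomp0m //; apply: lies0.
  apply/cone_lies; rewrite cone_dif0 cone_dif1 pair0 pair1; split; first exact: (proj2 cyx).
  rewrite pcompMr -mulNrz -mulrzDl; apply: liesM.
  by apply: lies_le lxy; lia.
have [T' [e [ee [u lu lxu]]]] := h p M N T _ eNM cxy.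
have [lu0 lu1] := proj1 (cone_lies _ _) lu.
exists T', e; split=> //; exists (spr X M v0 ⊙ u), ((spr X M v01 ⊙ u) *~ sg).
have [] := proj1 (cone_lies _ _) lxu.
rewrite (pcompDr (spr X N v0)) (pcompDr (spr X N v01)) !pcompNr cone_dif0 cone_dif1.
rewrite !(pcompA _ (pair _ _)) pair0 pair1 => l0 l1; split=> //; first exact: liesM.
have := liesM sg l1; rewrite mulrzDl mulNrz mulrzDl sgK mulNrz pcompMl sgK pcompMr.
by rewrite opprB addrA addrAC; apply: lies_le; lia.
Qed.

End Cone.

Section CospanVertices.

Lemma vertex_subproof (a : {set 'I_2}) i : i \in a -> a != set0.
Proof. by move=> h; apply/set0Pn; exists i. Qed.

Definition vertex (a : {set 'I_2}) i (h : i \in a) : sob (square 1) :=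
  (exist (fun a : {set 'I_2} => a != set0) a (vertex_subproof h), tt).

Definition vtx_source : sob (square 1) := vertex (set11 (ord0 : 'I_2)).
Definition vtx_zero : sob (square 1) := vertex (set11 (ord_max : 'I_2)).
Definition vtx_target : sob (square 1) := vertex (in_setT (ord0 : 'I_2)).

Lemma vertices a : [\/ a = vtx_source, a = vtx_zero | a = vtx_target].
Proof.
case: a => [[s s0] []].
have h (b : {set 'I_2}) i (ib : i \in b) : s = b ->
    (exist (fun a : {set 'I_2} => a != set0) s s0, tt) = vertex ib.
  by move=> e; congr pair; apply: val_inj.
have I2 (i : 'I_2) : i = ord0 \/ i = ord_max.
  by case: i => [[|[|//]] hi]; [left|right]; apply: val_inj.
case: (boolP (ord0 \in s)) => h0; case: (boolP (ord_max \in s)) => h1.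
- constructor 3; apply: h; apply/setP => i; rewrite !inE.
  by case: (I2 i) => ->.
- constructor 1; apply: h; apply/setP => i; rewrite !inE.
  by case: (I2 i) => ->; rewrite ?h0 ?(negbTE h1).
- constructor 2; apply: h; apply/setP => i; rewrite !inE.
  by case: (I2 i) => ->; rewrite ?h1 ?(negbTE h0).
- have /set0Pn[i] := s0.
  by case: (I2 i) => ->; rewrite ?(negbTE h1) ?(negbTE h0).
Qed.

Lemma vtx_le : sle vtx_source vtx_target.
Proof. by rewrite /= subsetT. Qed.

Lemma vtx_source_deg : sdeg vtx_source = 0%N.
Proof. by rewrite /= cards1. Qed.

Lemma vtx_target_deg : sdeg vtx_target = 1%N.
Proof. by rewrite /= cardsT card_ord. Qed.

Lemma vtx_sgn : sinc vtx_source vtx_target * sinc vtx_source vtx_target = 1.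
Proof.
have E : val vtx_target.1 = ord_max |: val vtx_source.1.
  apply/setP => i; rewrite !inE; case: i => [[|[|//]] hi] //.
have y : ord_max \notin val vtx_source.1 by rewrite inE.
rewrite [sinc _ _]/= mul1r !mulr0 addr0 (cube_incE y E).
by rewrite big_set1 signr_sqr.
Qed.

End CospanVertices.

Lemma Er_acyclicity (B C : CplusF A) (f : B ⟶ C) :
  Er_quasi_iso r f <-> acyclic (@Er_quasi_iso A r) one (simple s (cospan one f)).
Proof.
rewrite acyclicP !Er_quasi_isoP.
have z m0 m1 : m0 = false -> forall n, pidm ((cospan_ob one B C m0 m1 : fcomplex A) n) = 0.
  by move=> -> n; apply: zero_complex_id.
have m m0 m1 n0 n1 (h : m0 ==> n0) (k : m1 ==> n1) :
    m0 = true -> m1 = false -> n0 = true -> n1 = true ->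
    cone_acyclic r (cospan_map one f h k : fmorphism _ _) <-> cone_acyclic r f.
  by move: h k; case: m0; case: m1; case: n0; case: n1.
rewrite -(cone_of_simple (X := cospan one f) vertices _ vtx_source_deg
  vtx_target_deg vtx_le vtx_sgn).
  by rewrite [dmap _ _]/= m // /cospan_bit !inE.
by move=> n; apply: z; rewrite /cospan_bit inE.
Qed.

End ProductsOfDiagrams.

(** * Morphisms of codiagrams that are isomorphisms on the simple *)

Lemma ssgn_sqr P Q (u : injs P Q) a : ssgn u a * ssgn u a = 1.
Proof.
elim: P Q u a => [|S P IH] [|T Q] //= [u1 u2] [a1 a2] /=.
by rewrite mulrACA cube_sgn_sqr IH mulr1.
Qed.

Lemma pi_injective P Q (d : pi_hom P Q) : injective d.
Proof. by move=> x y; rewrite !pi_funE => /injs_act_inj. Qed.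

(** A morphism of codiagrams over d that is an isomorphism at every vertex of
Y, when X vanishes outside the image of d. *)
Section SimpleIso.
Variables (A : abelian) (r : nat).
Variables X Y : codiag (CplusF A).
Variable f : codiag_hom X Y.
Local Notation d := (ch_pi f).
Let fc b : fmorphism (cx X (d b)) (cx Y b) := f b.

Lemma spr_simple_mor n b : spr Y n b ⊙ simple_mor r f n =
  (shift (cx Y b) (sdegree n (d b)) (sdegree n b)
    ⊙ (fc b (sdegree n (d b)) ⊙ spr X n (d b))) *~ ssgn (pi_inj d) b.
Proof. exact: bpr_tuple. Qed.

Variable g : forall b, fmorphism (cx Y b) (cx X (d b)).
Hypothesis fg : forall b, fmor_comp (fc b) (g b) = fmor_id _.
Hypothesis gf : forall b, fmor_comp (g b) (fc b) = fmor_id _.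
Hypothesis X0 : forall a, a \notin codom d -> forall n, pidm (cx X a n) = 0.

Let G n : simple_complex r Y n ~> simple_complex r X n :=
  \sum_b (sinj X n (d b) ⊙ (g b (sdegree n (d b)) ⊙
    (shift (cx Y b) (sdegree n b) (sdegree n (d b)) ⊙ spr Y n b))) *~ ssgn (pi_inj d) b.

Let G_filtered n : filtered_map (G n).
Proof.
move=> p; rewrite /G pcomp_suml; apply: through_sum => b; rewrite pcompMl.
apply: throughM; rewrite -!pcompA; apply: sinj_lies.
apply: lies_map; first exact: fm_filtered.
apply: lies_map; first exact: shift_filtered.
rewrite pi_deg; move: b; apply/simple_lies.
by exists (pidm _); rewrite pcompm1.
Qed.

Lemma simple_mor_iso : exists f' : fmorphism (simple_complex r Y) (simple_complex r X),
  fmor_comp f' (simple_mor r f) = fmor_id _ /\ fmor_comp (simple_mor r f) f' = fmor_id _.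
Proof.
have E1 b n : fc b n ⊙ g b n = pidm _ := congr1 (fun h : fmorphism _ _ => h n) (fg b).
have E2 b n : g b n ⊙ fc b n = pidm _ := congr1 (fun h : fmorphism _ _ => h n) (gf b).
have sh b n : shift (cx Y b) (sdegree n (d b)) (sdegree n b)
    ⊙ shift (cx Y b) (sdegree n b) (sdegree n (d b)) = pidm _.
  by rewrite shift_comp ?sdegree_pi // shift_id.
have sh' b n : shift (cx Y b) (sdegree n b) (sdegree n (d b))
    ⊙ shift (cx Y b) (sdegree n (d b)) (sdegree n b) = pidm _.
  by rewrite shift_comp ?sdegree_pi // shift_id.
have sg2 (V : zmodType) (x : V) b : x *~ ssgn (pi_inj d) b *~ ssgn (pi_inj d) b = x.
  by rewrite -mulrzA ssgn_sqr mulr1z.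
have GF n : G n ⊙ simple_mor r f n = pidm _.
  transitivity (\sum_b @sinj _ r _ X n (d b) ⊙ @spr _ r _ X n (d b)).
    rewrite pcomp_suml; apply: eq_bigr => b _.
    rewrite pcompMl -!pcompA spr_simple_mor !pcompMr sg2.
    by rewrite (pcompA (shift _ _ _) (shift _ _ _)) sh' pcomp1m (pcompA (g b _)) E2 pcomp1m.
  rewrite -[RHS](bin_pr (fun a => cx X a (sdegree n a))) [RHS](bigID (mem (codom d))) /=.
  rewrite [X in _ = _ + X]big1 ?addr0; last first.
    by move=> a ha; rewrite -[bpr _ _]pcomp1m X0 // pcomp0m pcompm0.
  rewrite -big_uniq /=; last by rewrite map_inj_uniq ?enum_uniq //; apply: pi_injective.
  by rewrite big_map big_enum.
have FG n : simple_mor r f n ⊙ G n = pidm _.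
  apply: spr_ext => b; rewrite pcompm1 pcompA spr_simple_mor pcompMl.
  rewrite /G pcomp_sumr (bigD1 b) //= big1 ?addr0; last first.
    move=> c cb; rewrite pcompMr -!pcompA (pcompA (spr _ _ _)) spr_sinj0.
      by rewrite pcomp0m !pcompm0 mul0rz.
    by apply: contra cb => /eqP/pi_injective ->.
  rewrite pcompMr sg2 -!pcompA (pcompA (spr _ _ _) (sinj _ _ _)) spr_sinj pcomp1m.
  by rewrite (pcompA (fc b _)) E1 pcomp1m pcompA sh pcomp1m.
by have [f' [_ h1 h2]] := Er_quasi_iso_bij G_filtered GF FG; exists f'.
Qed.

Lemma Er_simple_mor_iso : Er_quasi_iso r (simple_mor r f).
Proof. by have [f' [h1 h2]] := simple_mor_iso; apply: Er_quasi_iso_iso h1 h2. Qed.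

End SimpleIso.

Section ExtensionIso.
Variables (A : abelian) (r : nat).
Local Notation one := (zero_fcomplex A).

(** u_* X is X^b at u(b), and vanishes at the vertices that are not contained
in u(S). *)
Lemma Er_extension (S T : nefin) (u : injection S T) (X : diagram (CplusF A) [:: S]) :
  Er_quasi_iso r (fmap (simple_functor A r) (extension_hom one u X)).
Proof.
have pu b : preim u (pi_single u b) = Some b.
  case: b => b []; rewrite /preim /= imsetS ?subsetT //.
  have -> : u @^-1: (u @: val b) = val b.
    apply/setP => x; rewrite inE; apply/imsetP/idP => [[y yb /inj_injective ->]|] //.
    by move=> xb; exists x.
  by rewrite valK.
have h b : ole (Some b) (preim u (pi_single u b)) by rewrite pu; exact: (@sle_refl [:: S] b).
apply: (@Er_simple_mor_iso A r (Codiag (extension one u X)) (Codiag X)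
  (extension_hom one u X) (fun b => ext_map one X (h b))) => [b|b|a].
- rewrite -[LHS]/(ext_map one X (preim_act u b) ∘ ext_map one X (h b)).
  by rewrite (ext_comp _ _ _ _ (@sle_refl [:: S] b : ole (Some b) (Some b))) ext_id.
- rewrite -[LHS]/(ext_map one X (h b) ∘ ext_map one X (preim_act u b)).
  have l : ole (preim u (pi_single u b)) (preim u (pi_single u b)).
    by rewrite pu; exact: (@sle_refl [:: S] b).
  by rewrite (ext_comp _ _ _ _ l) ext_id.
move=> ha n; suff pa : preim u a = None.
  have z x : x = None -> pidm ((ext_ob one X x : fcomplex A) n) = 0.
    by move=> ->; apply: zero_complex_id.
  exact: z.
rewrite /preim; case: ifP => // au; case/negP: ha; apply/codomP.
have ne : [set: S] != set0.
  have /set0Pn[y ya] := valP a.1; have /imsetP[x _ _] := subsetP au _ ya.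
  by apply/set0Pn; exists x; rewrite inE.
have [a' ea] := cube_le_map (b := exist (fun B : {set S} => B != set0) _ ne) au.
by exists (a', tt); case: a ea {au} => a1 [] /= ->.
Qed.

End ExtensionIso.

(** * Factorization *)

Fixpoint sfst (P Q : shape) : sob (P ++ Q) -> sob P :=
  match P return sob (P ++ Q) -> sob P with
  | [::] => fun _ => tt
  | S0 :: P' => fun c => (c.1, sfst c.2)
  end.

Fixpoint ssnd (P Q : shape) : sob (P ++ Q) -> sob Q :=
  match P return sob (P ++ Q) -> sob Q with
  | [::] => fun c => c
  | S0 :: P' => fun c => ssnd c.2
  end.

Section Concatenation.
Variables P Q : shape.

Lemma sfst_cat (a : sob P) (b : sob Q) : sfst (scat a b) = a.
Proof. by elim: P a => [|S P' IH] [] //= a1 a2; rewrite IH. Qed.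

Lemma ssnd_cat (a : sob P) (b : sob Q) : ssnd (scat a b) = b.
Proof. by elim: P a => [|S P' IH] [] //= a1 a2; rewrite IH. Qed.

Lemma scat_fst_snd (c : sob (P ++ Q)) : scat (sfst c) (ssnd c) = c.
Proof. by elim: P c => [|S P' IH] //= [c1 c2] /=; rewrite IH. Qed.

Lemma scat_eq (a a' : sob P) (b b' : sob Q) :
  (scat a b == scat a' b') = (a == a') && (b == b').
Proof.
apply/eqP/andP => [e|[/eqP -> /eqP ->] //].
split; apply/eqP.
  by have := congr1 (@sfst P Q) e; rewrite !sfst_cat.
by have := congr1 (@ssnd P Q) e; rewrite !ssnd_cat.
Qed.

Lemma sdeg_cat (a : sob P) (b : sob Q) : sdeg (scat a b) = (sdeg a + sdeg b)%N.
Proof. by elim: P a => [|S P' IH] [] //= a1 a2; rewrite IH addnA. Qed.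

Lemma sum_scat (V : zmodType) (F : sob (P ++ Q) -> V) :
  \sum_c F c = \sum_a \sum_b F (scat a b).
Proof.
rewrite pair_bigA (reindex (fun c : sob P * sob Q => scat c.1 c.2)) //=.
exists (fun c => (sfst c, ssnd c)) => [[a b] _|c _] /=.
  by rewrite sfst_cat ssnd_cat.
exact: scat_fst_snd.
Qed.

Lemma sdegree_cat n (a : sob P) (b : sob Q) :
  sdegree n (scat a b) = sdegree (sdegree n a) b.
Proof. by rewrite /sdegree sdeg_cat PoszD opprD addrA. Qed.

End Concatenation.

(** The incidence numbers of a product follow the Koszul rule, which is the
sign rule for the differential of an iterated total complex. *)
Lemma sinc_cat (P Q : shape) (a a' : sob P) (b b' : sob Q) :
  sinc (scat a b) (scat a' b') = (b == b')%:R * sinc a a'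
    + (a == a')%:R * ((-1) ^+ sdeg a * sinc b b').
Proof.
elim: P a a' => [|S P' IH] /=.
  by move=> [] []; rewrite mulr0 add0r expr0 !mul1r.
move=> [a1 a2] [a1' a2'] /=; rewrite scat_eq IH xpair_eqE.
case: (a2 == a2') => /=; case: (b == b') => /=; case: (a1 == a1') => /=;
  rewrite ?(mul1r, mul0r, addr0, add0r, mulr0) // ?exprD ?mulrDr ?mulrA //.
by rewrite addrA.
Qed.

Lemma ssgn_cat (P P' Q Q' : shape) (u : injs P P') (v : injs Q Q') a b :
  ssgn (injs_cat u v) (scat a b) = ssgn u a * ssgn v b.
Proof.
elim: P P' u a => [|S P IH] [|T P'] //=; first by move=> *; rewrite mul1r.
by move=> [u1 u2] [a1 a2] /=; rewrite IH mulrA.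
Qed.

Section MoreShift.
Variable A : abelian.
Implicit Types K : fcomplex A.

Lemma coef_shift_l K i j k s e : j = k ->
  shift K j k ⊙ coef K i j s e = coef K i k s e.
Proof. by move=> <-; rewrite shift_id pcomp1m. Qed.

Lemma coef0 K i j e : coef K i j 0 e = shift K i j *~ e.
Proof. by rewrite /coef mulr0z add0r. Qed.

Lemma coefD K i j s e s' e' :
  coef K i j (s + s') (e + e') = coef K i j s e + coef K i j s' e'.
Proof. by rewrite /coef !mulrzDr addrACA. Qed.

(** All the degrees are equal, so all the shifts are identities; they are kept
because the equalities of degrees hold only propositionally. *)
Lemma shift_transport K L M (u : fmorphism L K) (v : fmorphism M L)
    i0 i1 i2 i3 i4 i5 T (x : T ~> M i1) (y : T ~> L i0) :
  i1 = i0 -> i2 = i0 -> i3 = i0 -> i4 = i0 -> i5 = i0 ->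
  v i1 ⊙ x = shift L i0 i1 ⊙ y ->
  shift K i3 i4 ⊙ (shift K i2 i3 ⊙ ((u i2 ⊙ v i2) ⊙ (shift M i1 i2 ⊙ x)))
  = shift K i5 i4 ⊙ (shift K i0 i5 ⊙ (u i0 ⊙ y)).
Proof.
move=> e1 e2 e3 e4 e5 h; subst i1 i2 i3 i4 i5.
by move: h; rewrite !shift_id !pcomp1m -pcompA => ->.
Qed.

End MoreShift.

Section MoreSimple.
Variables (A : abelian) (r : nat) (P : shape) (X : diagram (CplusF A) P).

Lemma cx_map_shift a b i j :
  cx_map X a b j ⊙ shift (cx X a) i j = shift (cx X b) i j ⊙ cx_map X a b i.
Proof.
case: (boolP (sle a b)) => h; last by rewrite !cx_map0 // pcomp0m pcompm0.
by rewrite !(cx_mapE _ _ h) shift_nat.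
Qed.

Lemma spr_shift a i j : @spr _ r _ X j a ⊙ shift (simple_complex r X) i j =
  shift (cx X a) (sdegree i a) (sdegree j a) ⊙ spr X i a.
Proof.
case: (eqVneq i j) => [<-|ne]; first by rewrite !shift_id pcompm1 pcomp1m.
rewrite !shift_ne ?pcompm0 ?pcomp0m //.
by apply: contra ne => /eqP; rewrite /sdegree => e; apply/eqP; lia.
Qed.

Lemma coef_cx_map_shift a b i j k s e T (z : T ~> cx X a i) : i = j ->
  coef (cx X b) j k s e ⊙ cx_map X a b j ⊙ (shift (cx X a) i j ⊙ z)
  = coef (cx X b) i k s e ⊙ (cx_map X a b i ⊙ z).
Proof. by move=> <-; rewrite shift_id pcomp1m pcompA. Qed.

(** The identity X^a -> X^b for a = b, which arises from comparing
scat (d a) (e b) with the image of scat a b. *)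
Lemma spr_eq a b (h : sle a b) n : a = b ->
  (dmap X h : fmorphism (cx X a) (cx X b)) (sdegree n a) ⊙ @spr _ r _ X n a
  = shift (cx X b) (sdegree n b) (sdegree n a) ⊙ spr X n b.
Proof. by move=> e; subst b; rewrite dmap1 shift_id. Qed.

End MoreSimple.

Section Fubini.
Variables (A : abelian) (r : nat).
Local Notation s := (simple_functor A r).

Section Mu.
Variables (P Q : shape) (X : diagram (CplusF A) (P ++ Q)).

Local Notation I := (iter s X).
Local Notation TX := (simple_complex r X).
Local Notation TI := (simple_complex r I).
Local Notation sl a := (slice X a).

Definition spr2 n a b : TI n ~> cx X (scat a b) (sdegree (sdegree n a) b) :=
  @spr _ r _ (sl a) (sdegree n a) b ⊙ spr I n a.

Lemma spr2_ext n T (x y : T ~> TI n) :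
  (forall a b, spr2 n a b ⊙ x = spr2 n a b ⊙ y) -> x = y.
Proof.
move=> h; apply: spr_ext => a.
apply: (@spr_ext _ r _ (sl a) (sdegree n a)) => b.
by rewrite !pcompA; apply: h.
Qed.

Lemma spr2_lies n p T (x : T ~> TI n) :
  (forall a b, lies (p + (r * sdeg (scat a b))%N%:Z) (spr2 n a b ⊙ x)) <-> lies p x.
Proof.
split=> [h|h a b].
  apply/simple_lies => a; apply/(@simple_lies _ _ _ (sl a)) => b.
  by have := h a b; rewrite /spr2 -pcompA; apply: lies_le; rewrite sdeg_cat; lia.
rewrite /spr2 -pcompA.
have := proj1 (@simple_lies _ _ _ (sl a) _ _ _ _) (proj1 (simple_lies _ _) h a) b.
by apply: lies_le; rewrite sdeg_cat; lia.
Qed.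

(** The identity on each X^(a, b): the components n - (|a| + |b|) and
(n - |a|) - |b| of the degree agree, and no sign is involved. *)
Definition mu_fm n : TX n ~> TI n :=
  btuple (fun a => btuple (fun b =>
    shift (cx X (scat a b)) (sdegree n (scat a b)) (sdegree (sdegree n a) b)
      ⊙ spr X n (scat a b))).

Lemma spr2_mu n a b : spr2 n a b ⊙ mu_fm n =
  shift (cx X (scat a b)) (sdegree n (scat a b)) (sdegree (sdegree n a) b)
      ⊙ spr X n (scat a b).
Proof.
rewrite /spr2 -pcompA.
have -> : spr I n a ⊙ mu_fm n = _ := bpr_tuple _ a.
exact: bpr_tuple.
Qed.

Lemma mu_filtered n : filtered_map (mu_fm n).
Proof.
move=> p; apply/spr2_lies => a b; rewrite pcompA spr2_mu -pcompA.
apply: lies_map; first exact: shift_filtered.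
have h : lies (X := TX n) p (fl_in (TX n) p) by exists (pidm _); rewrite pcompm1.
exact: (proj1 (simple_lies _ _) h (scat a b)).
Qed.

Lemma cx_map_slice a b b' i : cx_map (sl a) b b' i = cx_map X (scat a b) (scat a b') i.
Proof.
case: (boolP (sle b b')) => h; last by rewrite !cx_map0 // sle_cat (negbTE h) andbF.
by rewrite (cx_mapE _ _ h) (cx_mapE _ _ (sle_catr a h)).
Qed.

Lemma spr_cx_map_iter a a' b i :
  @spr _ r _ (sl a') i b ⊙ cx_map I a a' i
  = cx_map X (scat a b) (scat a' b) (sdegree i b) ⊙ @spr _ r _ (sl a) i b.
Proof.
case: (boolP (sle a a')) => h; last first.
  by rewrite !cx_map0 ?pcompm0 ?pcomp0m // sle_cat (negbTE h).
rewrite (cx_mapE _ _ h) (cx_mapE _ _ (sle_catl b h)).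
exact: (spr_simple_map r (slice_nat X h)).
Qed.

(** On both sides the component at (a, b) is the sum of T1, which collects the
differential of X^(a, b) and the second incidence, with a' = a, and of T2, the
first incidence, with b' = b. *)
Lemma mu_dif n m : mu_fm m ⊙ dif TX n m = dif TI n m ⊙ mu_fm n.
Proof.
apply: spr2_ext => a b.
pose K := cx X (scat a b); pose k := sdegree (sdegree m a) b.
pose W a' b' := cx_map X (scat a' b') (scat a b) (sdegree n (scat a' b'))
  ⊙ @spr _ r _ X n (scat a' b').
pose T1 a' b' := coef K (sdegree n (scat a' b')) k ((b' == b)%:R * (-1) ^+ (sdeg a + sdeg b))
   ((-1) ^+ sdeg a * sinc b' b) ⊙ W a' b'.
pose T2 a' b' := coef K (sdegree n (scat a' b')) k 0 (sinc a' a) ⊙ W a' b'.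
have delta (J : finType) (V : zmodType) (j : J) (H : J -> V) :
    \sum_i H i *~ (i == j)%:R = H j.
  rewrite (bigD1 j) //= eqxx mulr1z big1 ?addr0 // => i /negbTE ->.
  by rewrite mulr0z.
transitivity (\sum_b' T1 a b' + \sum_a' T2 a' b).
  rewrite pcompA spr2_mu -pcompA spr_dif pcomp_sumr sum_scat.
  transitivity (\sum_a' \sum_b' (T1 a' b' *~ (a' == a)%:R + T2 a' b' *~ (b' == b)%:R)).
    apply: eq_bigr => a' _; apply: eq_bigr => b' _.
    rewrite /simple_comp -pcompA pcompA coef_shift_l ?sdegree_cat //.
    rewrite /T1 /T2 -!pcompMl -pcompDl !coefM -coefD; congr (coef _ _ _ _ _ ⊙ _).
      rewrite scat_eq sdeg_cat mul0r addr0.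
      by case: (eqVneq a' a) => [->|]; case: (eqVneq b' b) => [->|];
        rewrite /= ?mul1r ?mul0r ?mulr1 ?mulr0.
    rewrite sinc_cat addrC; congr (_ + _); last exact: mulrC.
    by case: (eqVneq a' a) => [->|]; rewrite ?mul1r ?mulr1 ?mul0r ?mulr0.
  under eq_bigr => a' _ do rewrite big_split /=.
  rewrite big_split /=; congr (_ + _).
    under eq_bigr => a' _ do rewrite -mulrz_suml.
    exact: delta.
  by apply: eq_bigr => a' _; apply: delta.
rewrite pcompA -[spr2 m a b ⊙ _]pcompA spr_dif.
pose U a' : TX n ~> I a' (sdegree n a') := spr I n a' ⊙ mu_fm n.
have UE a' b' : @spr _ r _ (sl a') (sdegree n a') b' ⊙ U a' =
   shift (cx X (scat a' b')) (sdegree n (scat a' b')) (sdegree (sdegree n a') b')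
      ⊙ spr X n (scat a' b').
  by rewrite -spr2_mu /spr2 pcompA.
transitivity (@spr _ r _ (sl a) (sdegree m a) b ⊙ (\sum_a' simple_comp I n m a' a ⊙ U a')).
  pose D a' := (dif (simple_complex r (sl a)) (sdegree n a') (sdegree m a)
     ⊙ (cx_map I a' a (sdegree n a') ⊙ U a')) *~ (-1) ^+ sdeg a'.
  transitivity (\sum_a' (@spr _ r _ (sl a) (sdegree m a) b ⊙ D a' *~ (a' == a)%:R
    + T2 a' b)); last first.
    rewrite pcomp_sumr; apply: eq_bigr => a' _.
    rewrite /simple_comp -pcompA /coef pcompDl pcompDr; congr (_ + _).
      rewrite /D !pcompMl !pcompMr -!mulrzA; congr (_ *~ _); exact: mulrC.
    rewrite pcompMl pcompMr /T2 coef0 pcompMl; congr (_ *~ _).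
    rewrite !pcompA spr_shift -!pcompA (pcompA _ (cx_map I _ _ _)) spr_cx_map_iter -pcompA UE.
    rewrite (pcompA (cx_map X _ _ _)) cx_map_shift !pcompA shift_comp ?sdegree_cat //.
  rewrite big_split /= delta; congr (_ + _).
  rewrite /D cx_map1 pcomp1m pcompMr pcompA spr_dif pcomp_suml mulrz_suml.
  apply: eq_bigr => b' _; rewrite -pcompA UE /simple_comp cx_map_slice.
  apply: esym; apply: etrans (congr1 (fun t => t *~ _)
    (@coef_cx_map_shift _ _ X (scat a b') (scat a b) _ _ k _ _ _ (spr X n (scat a b'))
      (sdegree_cat n a b'))) _.
  rewrite -pcompMl coefM /T1.
  congr (coef _ _ _ _ _ ⊙ _); last exact: mulrC.
  case: (eqVneq b' b) => [->|_]; last by rewrite !mul0r.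
  by rewrite !mul1r exprD mulrC.
rewrite -pcompA; congr (_ ⊙ _); rewrite pcomp_suml; apply: eq_bigr => a' _.
by rewrite pcompA.
Qed.

Definition mu : fmorphism TX TI := FMorphism mu_filtered mu_dif.

Definition mu_inv n : TI n ~> TX n :=
  \sum_a \sum_b sinj X n (scat a b) ⊙
    (shift (cx X (scat a b)) (sdegree (sdegree n a) b) (sdegree n (scat a b))
      ⊙ spr2 n a b).

Lemma mu_inv_filtered n : filtered_map (mu_inv n).
Proof.
move=> p; rewrite /mu_inv pcomp_suml; apply: through_sum => a.
rewrite pcomp_suml; apply: through_sum => b.
rewrite -!pcompA; apply: sinj_lies; apply: lies_map; first exact: shift_filtered.
have h : lies (X := TI n) p (fl_in (TI n) p) by exists (pidm _); rewrite pcompm1.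
rewrite pcompA; exact: (proj2 (spr2_lies _ _) h a b).
Qed.

Lemma mu_invK n : mu_inv n ⊙ mu_fm n = pidm _.
Proof.
rewrite -[RHS](bin_pr (fun a => cx X a (sdegree n a))) sum_scat pcomp_suml.
apply: eq_bigr => a _; rewrite pcomp_suml; apply: eq_bigr => b _.
rewrite -pcompA -[shift _ _ _ ⊙ spr2 n a b ⊙ _]pcompA spr2_mu.
rewrite (pcompA (shift _ _ _) (shift _ _ _)).
by rewrite shift_comp ?sdegree_cat // shift_id pcomp1m.
Qed.

Lemma muK n : mu_fm n ⊙ mu_inv n = pidm _.
Proof.
apply: spr2_ext => a b; rewrite pcompm1 pcompA spr2_mu -pcompA.
have e : spr X n (scat a b) ⊙ mu_inv n =
    shift (cx X (scat a b)) (sdegree (sdegree n a) b) (sdegree n (scat a b)) ⊙ spr2 n a b.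
  rewrite /mu_inv pcomp_sumr (bigD1 a) //= [X in _ + X]big1 ?addr0.
    rewrite pcomp_sumr (bigD1 b) //= big1 ?addr0; first by rewrite pcompA spr_sinj pcomp1m.
    by move=> b' hb; rewrite pcompA spr_sinj0 ?pcomp0m // scat_eq eqxx.
  move=> a' ha; rewrite pcomp_sumr big1 // => b' _.
  by rewrite pcompA spr_sinj0 ?pcomp0m // scat_eq (negbTE ha).
by rewrite e pcompA shift_comp ?sdegree_cat // shift_id pcomp1m.
Qed.

Lemma Er_mu : Er_quasi_iso r mu.
Proof.
have [f' [_ h1 h2]] := Er_quasi_iso_bij (f := mu) mu_inv_filtered mu_invK muK.
exact: Er_quasi_iso_iso h1 h2.
Qed.

End Mu.

(** At (b, b'), both composites are the projection to the image of (b, b')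
followed by a, up to the sign of d at b times the sign of e at b'. *)
Lemma mu_natural (P P' Q Q' : shape) (X : diagram (CplusF A) (P ++ Q))
    (Y : diagram (CplusF A) (P' ++ Q')) (d : pi_hom P' P) (e : pi_hom Q' Q)
    (a : forall c, X (pi_cat d e c) ⟶ Y c)
    (a_nat : forall c c' (h : sle c c'),
       a c' ∘ dmap X (pi_mono (pi_cat d e) h) = dmap Y h ∘ a c) :
  fmor_comp (mu Y) (fmap s (cat_hom a_nat)) = fmor_comp (fmap s (iter_hom s a_nat)) (mu X).
Proof.
apply: fmorphism_eq => n /=; apply: spr2_ext => b b'.
rewrite [LHS]pcompA spr2_mu -[LHS]pcompA.
have -> : spr Y n (scat b b') ⊙ simple_fm r (cat_hom a_nat) n = _ :=
  @spr_simple_mor A r _ _ (cat_hom a_nat) n (scat b b').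
rewrite /spr2 -[RHS]pcompA (pcompA (spr (iter s Y) n b)).
have -> : spr (iter s Y) n b ⊙ simple_fm r (iter_hom s a_nat) n = _ :=
  @spr_simple_mor A r _ _ (iter_hom s a_nat) n b.
rewrite pcompMl !pcompMr -pcompA (pcompA (spr _ _ b')).
have -> : spr (slice Y b) (sdegree n b) b'
      ⊙ shift (cx (iter s Y) b) (sdegree n (d b)) (sdegree n b) = _ :=
  spr_shift r (slice Y b) b' (sdegree n (d b)) (sdegree n b).
set j := sdegree n (d b).
have E1 : spr (slice Y b) j b' ⊙ (fmap s (slice_hom a_nat b) : fmorphism _ _) j = _ :=
  @spr_simple_mor A r _ _ (slice_hom a_nat b) j b'.
have E2 : spr (slice Y b) j b' ⊙ (((fmap s (slice_hom a_nat b) : fmorphism _ _) j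
      ⊙ spr (iter s X) n (d b)) ⊙ mu_fm X n)
    = (shift (cx Y (scat b b')) (sdegree j (e b')) (sdegree j b')
       ⊙ ((slice_hom a_nat b b'
             : fmorphism (cx X (scat (d b) (e b'))) (cx Y (scat b b'))) (sdegree j (e b'))
       ⊙ (spr2 X n (d b) (e b') ⊙ mu_fm X n))) *~ ssgn (pi_inj e) b'.
  rewrite -[X in _ ⊙ X]pcompA [LHS]pcompA; apply: etrans (congr1 (fun t => t ⊙ _) E1) _.
  by rewrite pcompMl; congr (_ *~ _); rewrite /spr2 -!pcompA.
rewrite spr2_mu in E2.
rewrite -[X in _ = X *~ _]pcompA.
apply: etrans _ (esym (congr1 (fun t =>
  (shift (cx Y (scat b b')) (sdegree j b') (sdegree (sdegree n b) b') ⊙ t)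
    *~ ssgn (pi_inj d) b) E2)).
rewrite pcompMr -mulrzA [_ * _]mulrC.
rewrite -[ssgn (pi_inj (ch_pi (cat_hom a_nat))) _]/(ssgn
  (injs_cat (pi_inj d) (pi_inj e)) (scat b b')).
rewrite ssgn_cat; congr (_ *~ _); apply: esym.
pose c := pi_cat d e (scat b b').
have dc : sdegree n c = sdegree n (scat b b') by rewrite /sdegree pi_deg.
have db : j = sdegree n b by rewrite /j /sdegree pi_deg.
have ec : scat (d b) (e b') = c.
  by rewrite /c /= injs_act_cat -!pi_funE.
apply: (@shift_transport A (cx Y (scat b b')) (cx X c) (cx X (scat (d b) (e b'))) (a (scat b b'))
   (dmap X (pi_cat_le d e b b')) (sdegree n c) (sdegree n (scat (d b) (e b')))).
- by rewrite ec.
- by rewrite -sdegree_cat ec.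
- by rewrite dc sdegree_cat db.
- by rewrite dc sdegree_cat.
- by rewrite dc.
- exact: spr_eq.
Qed.

End Fubini.

(** * Normalization *)

Section Vertices.

Lemma single_subproof (S : nefin) (x : S) : [set x] != set0.
Proof. by apply/set0Pn; exists x; rewrite inE. Qed.

Definition single (S : nefin) (x : S) : cube S :=
  exist (fun A : {set S} => A != set0) [set x] (single_subproof x).

Lemma card_cube (S : nefin) (a : cube S) : (#|val a|.-1 == 0)%N = (#|val a| == 1)%N.
Proof. by have := valP a; rewrite -card_gt0; case: #|_| => [|[|]]. Qed.

(** The two vertices of an edge have opposite incidence numbers: the double sum
F is antisymmetric. *)
Lemma cube_inc_vertices (S : nefin) (b : cube S) :
  \sum_(a : cube S | #|val a|.-1 == 0%N) cube_inc a b = 0.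
Proof.
pose F (y z : S) : int :=
  if (y != z) && (val b == [set z; y]) then (-1) ^+ (rk y < rk z)%N else 0.
transitivity (\sum_y \sum_z F y z).
  pose h (a : cube S) : S := xchoose (set0Pn _ (valP a)).
  rewrite (reindex (@single S)) /=; last first.
    exists h => a.
      by move=> _; apply/set1P; apply: (xchooseP (set0Pn _ (valP (single a)))).
    rewrite inE card_cube => /cards1P[x ex]; apply: val_inj => /=.
    have := xchooseP (set0Pn _ (valP a)); rewrite -/(h a) ex => /set1P ->.
    by [].
  apply: eq_big => [y|y _]; first by rewrite cards1.
  rewrite /cube_inc big_mkcond /=; apply: eq_bigr => z _.
  rewrite /F inE eq_sym; case: ifP => // _; congr (_ ^+ _).
  case: (ltnP (rk y) (rk z)) => h1.
    by apply/eqP/cards1P; exists y; apply/setP => x; rewrite !inE;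
      case: eqVneq => [->|].
  apply/eqP; rewrite cards_eq0; apply/eqP/setP => x; rewrite !inE.
  by case: eqVneq => [->|//]; rewrite ltnNge h1.
apply: anti0; rewrite {1}exchange_big -sumrN; apply: eq_bigr => y _.
rewrite -sumrN; apply: eq_bigr => z _; rewrite /F eq_sym setUC.
case: ifP => [/andP[yz _]|]; last by rewrite oppr0.
by rewrite (rk_total yz); case: (rk y < rk z)%N; rewrite ?opprK.
Qed.

(** The constant cochain 1 on the vertices of degree 0 is a cocycle. *)
Lemma sinc_vertices (P : shape) (b : sob P) : \sum_(a | sdeg a == 0%N) sinc a b = 0.
Proof.
elim: P b => [|S P IH] /=; first by move=> b; rewrite big1.
case=> b1 b2.
transitivity (\sum_(a1 : cube S | #|val a1|.-1 == 0%N) \sum_(a2 : sob P | sdeg a2 == 0%N)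
   ((a2 == b2)%:R * cube_inc a1 b1 + (a1 == b1)%:R * sinc a2 b2)).
  rewrite pair_big; apply: eq_big => [[a1 a2] /=|[a1 a2] /=].
    by rewrite addn_eq0.
  by rewrite addn_eq0 => /andP[/eqP -> _]; rewrite expr0 mul1r.
under eq_bigr => a1 _ do rewrite big_split /= -mulr_suml -mulr_sumr IH mulr0 addr0.
by rewrite -mulr_sumr cube_inc_vertices mulr0.
Qed.

Lemma cube_sgn_vertex (S T : nefin) (u : injection S T) (a : cube S) :
  (#|val a|.-1 == 0)%N -> cube_sgn u a = 1.
Proof.
by rewrite card_cube => /cards1P[x ex]; rewrite /cube_sgn ex big_set1 big_set1 ltnn.
Qed.

Lemma ssgn_vertex (P Q : shape) (u : injs P Q) (a : sob P) :
  sdeg a == 0%N -> ssgn u a = 1.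
Proof.
elim: P Q u a => [|S P IH] [|T Q] //= [u1 u2] [a1 a2] /=.
by rewrite addn_eq0 => /andP[h1 h2]; rewrite cube_sgn_vertex ?IH ?mulr1.
Qed.

End Vertices.

Section Lambda.
Variables (A : abelian) (r : nat).
Local Notation s := (simple_functor A r).

Section LambdaP.
Variables (P : shape) (B : fcomplex A).
Local Notation C := (const_diagram P (B : CplusF A)).

(** shift B n (n - |a|) is the identity of B n for |a| = 0 and vanishes
otherwise. *)
Definition lambda_fm n : B n ~> simple_complex r C n :=
  btuple (fun a => shift B n (sdegree n a)).

Lemma spr_lambda n a : spr C n a ⊙ lambda_fm n = shift B n (sdegree n a).
Proof. exact: bpr_tuple. Qed.

Lemma lambda_filtered n : filtered_map (lambda_fm n).
Proof.
move=> p; apply/simple_lies => a; rewrite pcompA spr_lambda.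
apply: lies_map; first exact: shift_filtered.
apply: lies_le (_ : p <= _) _; first by lia.
by exists (pidm _); rewrite pcompm1.
Qed.

Lemma shift_degree n (a : sob P) : sdeg a != 0%N -> shift B n (sdegree n a) = 0.
Proof.
by move=> h; apply: shift_ne; apply: contra h => /eqP; rewrite /sdegree; lia.
Qed.

Lemma lambda_dif n m :
  lambda_fm m ⊙ dif B n m = dif (simple_complex r C) n m ⊙ lambda_fm n.
Proof.
apply: spr_ext => b; rewrite !pcompA spr_lambda spr_dif pcomp_suml.
have cE a : cx_map C a b (sdegree n a) ⊙ shift B n (sdegree n a) =
   shift B n (sdegree n a) *~ (sle a b)%:R.
  case: (boolP (sle a b)) => h; last by rewrite cx_map0 // pcomp0m.
  by rewrite (cx_mapE _ _ h) pcomp1m.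
transitivity ((dif B (sdegree n b) (sdegree m b) ⊙ shift B n (sdegree n b)) *~ (-1) ^+ sdeg b
   + \sum_(a | sdeg a == 0%N) (shift B n (sdegree m b)) *~ sinc a b).
  rewrite -mulrz_sumr sinc_vertices mulr0z addr0.
  case: (eqVneq (sdeg b) 0%N) => [e|ne]; last by rewrite !shift_degree // pcompm0 pcomp0m mul0rz.
  by rewrite e expr0 mulr1z /sdegree e !subr0 !shift_id pcomp1m pcompm1.
apply: esym; rewrite (bigD1 b) //=; congr (_ + _).
  by rewrite -pcompA spr_lambda simple_comp_diag pcompMl.
rewrite [LHS]big_mkcond [RHS]big_mkcond; apply: eq_bigr => a _.
case: (eqVneq a b) => [->|ne] /=; first by rewrite sinc_diag mulr0z if_same.
rewrite -pcompA spr_lambda simple_comp_off // pcompMl.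
case: (eqVneq (sinc a b) 0) => [->|/sincP[ab _]]; first by rewrite !mulr0z if_same.
rewrite -pcompA cE ab mulr1z; case: (eqVneq (sdeg a) 0%N) => e.
  by rewrite shift_comp // /sdegree e subr0.
by rewrite shift_degree // pcompm0 mul0rz.
Qed.

Definition lambda : (B : CplusF A) ⟶ simple s C :=
  FMorphism lambda_filtered lambda_dif.

End LambdaP.

Lemma lambda_natural P (B C : CplusF A) (f : B ⟶ C) :
  simple_map s (const_nat P f) ∘ lambda P B = lambda P C ∘ f.
Proof.
apply: fmorphism_eq => n; apply: spr_ext => a.
rewrite [LHS]pcompA spr_simple_map -[LHS]pcompA [X in _ ⊙ X]spr_lambda.
rewrite [RHS]pcompA [X in _ = X ⊙ _]spr_lambda.
exact: shift_nat.
Qed.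

Lemma lambda_pi P Q (d : pi_hom P Q) (B : CplusF A) :
  fmap s (const_pi d B) ∘ lambda Q B = lambda P B.
Proof.
apply: fmorphism_eq => n; apply: spr_ext => b.
rewrite [RHS]spr_lambda [LHS]pcompA [X in X ⊙ _]spr_simple_mor.
rewrite pcompMl pcomp1m -[X in X *~ _]pcompA [X in _ ⊙ X]spr_lambda.
case: (eqVneq (sdeg b) 0%N) => e.
  rewrite ssgn_vertex ?e // mulr1z shift_comp //.
  by rewrite /sdegree pi_deg e subr0.
by rewrite !shift_degree ?pi_deg // pcompm0 mul0rz.
Qed.

Lemma Er_lambda_square0 (B : CplusF A) : Er_quasi_iso r (lambda (square 0) B).
Proof.
have deg0 (a : sob (square 0)) : sdeg a = 0%N.
  case: a => [[a a0] []] /=; rewrite addn0.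
  have : (#|a| <= 1)%N by rewrite -[X in (_ <= X)%N](card_ord 1) max_card.
  by case: #|a| => [|[|]].
pose v : sob (square 0) := (single (ord0 : ord_nefin 0), tt).
have all_v a : a = v.
  case: a => [[a a0] []]; congr pair; apply: val_inj => /=.
  have /set0Pn[i ia] := a0; apply/setP => j; rewrite inE.
  by rewrite (ord1 j) eqxx -(ord1 i) ia.
pose C := const_diagram (square 0) B.
pose g n : simple_complex r C n ~> (B : fcomplex A) n :=
  shift (B : fcomplex A) (sdegree n v) n ⊙ spr C n v.
have gf n : g n ⊙ lambda_fm (square 0) B n = pidm _.
  rewrite /g -pcompA spr_lambda shift_comp ?shift_id //.
  by rewrite /sdegree deg0 subr0.
have fg n : lambda_fm (square 0) B n ⊙ g n = pidm _.
  apply: spr_ext => a; rewrite (all_v a) pcompm1 pcompA spr_lambda /g pcompA.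
  rewrite shift_comp ?shift_id ?pcomp1m //.
  by rewrite /sdegree deg0 subr0.
have hg n : filtered_map (g n).
  move=> p; rewrite /g -pcompA; apply: lies_map; first exact: shift_filtered.
  have h : lies (X := simple_complex r C n) p (fl_in (simple_complex r C n) p).
    by exists (pidm _); rewrite pcompm1.
  by have := proj1 (simple_lies _ _) h v; rewrite deg0 muln0 addr0.
have [f' [_ h1 h2]] := Er_quasi_iso_bij (f := lambda (square 0) B : fmorphism _ _) hg gf fg.
exact: Er_quasi_iso_iso h1 h2.
Qed.

(** At (a, b) both sides are the identity for |a| = |b| = 0 and 0 otherwise. *)
Lemma lambda_mu P Q (B : CplusF A) :
  fmor_comp (mu r (const_diagram (P ++ Q) B)) (lambda (P ++ Q) B)
  = simple_map s (iter_const s P Q B)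
      ∘ (lambda P (simple s (const_diagram Q B)) ∘ lambda Q B).
Proof.
apply: fmorphism_eq => n; apply: spr2_ext => a b.
rewrite [LHS]pcompA [X in X ⊙ _ = _]spr2_mu -[LHS]pcompA [X in _ ⊙ X = _]spr_lambda.
rewrite /spr2 -[RHS]pcompA [X in _ = _ ⊙ X]pcompA [X in _ = _ ⊙ (X ⊙ _)]spr_simple_map.
pose L := lambda Q B : fmorphism _ _.
pose M := simple_complex r (const_diagram Q B).
have E1 : spr (const_diagram P (simple s (const_diagram Q B))) n a
    ⊙ (lambda P (simple s (const_diagram Q B)) ∘ lambda Q B : fmorphism _ _) n
    = L (sdegree n a) ⊙ shift (B : fcomplex A) n (sdegree n a).
  rewrite [LHS]pcompA.
  have e0 := congr1 (fun t : M n ~> M (sdegree n a) => t ⊙ L n) (spr_lambda M n a).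
  apply: (etrans e0).
  exact: esym (shift_nat L n (sdegree n a)).
have E2 : spr (slice (const_diagram (P ++ Q) B) a) (sdegree n a) b
    ⊙ (iter_const s P Q B a : fmorphism M _) (sdegree n a)
    = spr (const_diagram Q B) (sdegree n a) b.
  by apply: etrans (spr_simple_map r (slice_const Q B a) (sdegree n a) b) _; rewrite pcomp1m.
apply: esym; rewrite -[X in _ ⊙ X = _]pcompA.
apply: etrans (congr1 (fun t => _ ⊙ (_ ⊙ t)) E1) _.
rewrite pcompA; apply: etrans (congr1 (fun t => t ⊙ (L (sdegree n a)
  ⊙ shift (B : fcomplex A) n (sdegree n a))) E2) _.
rewrite pcompA; apply: etrans (congr1 (fun t => t ⊙ shift (B : fcomplex A) n
  (sdegree n a)) (spr_lambda B (sdegree n a) b)) _.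
case: (eqVneq (sdeg a) 0%N) => e.
  have na : sdegree n a = n by rewrite /sdegree e subr0.
  have nab : sdegree n (scat a b) = sdegree (sdegree n a) b by apply: sdegree_cat.
  by rewrite nab shift_id pcomp1m na shift_id pcompm1.
rewrite (shift_degree _ _ e) pcompm0 (@shift_degree _ B n (scat a b)) ?pcompm0 //.
by rewrite sdeg_cat addn_eq0 negb_and e.
Qed.

End Lambda.

(** * The descent structure *)

Theorem theorem2p8 (A : abelian) (r : nat) :
  cohomological_descent_category (@Er_quasi_iso A r) (simple_functor A r).
Proof.
exists (zero_fcomplex A); split.
- exact: products_exist.
- exact: Er_saturated.
- exact: Er_stable.
- exact: Er_products.
- exact: Er_unit.
- pose s := simple_functor A r.
  exists (fun P Q X => ho_loc _ (mu r X : simple s X ⟶ simple s (iter s X))).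
  exists (fun P B => lambda r P B); split.
    split=> [P Q X|P P' Q Q' X Y d e a a_nat].
      exact/Er_saturated/Er_mu.
    apply: ho_trans (ho_sym (ho_loc_comp _ _ _)) _.
    rewrite [_ ∘ _]mu_natural; exact: ho_loc_comp.
  split.
  + exact: lambda_natural.
  + exact: lambda_pi.
  + move=> P Q B; apply: ho_trans (ho_sym (ho_loc_comp _ _ _)) _.
    rewrite [_ ∘ _]lambda_mu; exact: ho_refl.
  + exact: Er_lambda_square0.
- exact: Er_exact.
- exact: Er_acyclicity.
- exact: Er_extension.
Qed.
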